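(* Let $g\in L^\infty[-1/2,1/2]$. Then $\mathcal F(g)=\{e^{2\pi i n x}:n\in\mathbb N_0\}\cup\{g(x)e^{2\pi i n x}:n\in\mathbb N^-\}$ is a Riesz basis for $L^2[-1/2,1/2]$ if and only if $g^{-1}\in L^\infty[-1/2,1/2]$ and $$\frac{g}{|g|}=e^{i(u^h+v+c)}\quad\text{a.e. on }[-1/2,1/2],$$ for some constant $c\in\mathbb R$ and bounded real-valued functions $u,v$ on $[-1/2,1/2]$ with $\|v\|_\infty<\pi/2$, where $u^h$ is the harmonic conjugate of $u$. *)

(* Defs.v *)
From HB Require Import structures.
From mathcomp Require Import all_boot all_order all_algebra.
From mathcomp Require Import all_classical all_reals all_analysis.
From mathcomp Require Import complex.

Set Implicit Arguments.
Unset Strict Implicit.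
Unset Printing Implicit Defensive.

Import Order.TTheory GRing.Theory Num.Theory.
Import numFieldNormedType.Exports.

Local Open Scope classical_set_scope.
Local Open Scope ring_scope.
Local Open Scope complex_scope.

Definition Ihalf (R : realType) : set R := `[- (2^-1 : R), 2^-1]%classic.

Arguments Ihalf R : clear implicits.
Notation Leb R := (@lebesgue_measure R).

Definition csq (R : realType) (z : R[i]) : R := complex.Re z ^+ 2 + complex.Im z ^+ 2.
Definition cabs (R : realType) (z : R[i]) : R := Num.sqrt (csq z).

Definition expi (R : realType) (t : R) : R[i] := Complex (cos t) (sin t).

Definition cmeasurable (R : realType) (f : R -> R[i]) : Prop :=
  measurable_fun (Ihalf R) (fun x => complex.Re (f x)) /\
  measurable_fun (Ihalf R) (fun x => complex.Im (f x)).

Definition L2 (R : realType) (f : R -> R[i]) : Prop :=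
  cmeasurable f /\
  (\int[Leb R]_(x in Ihalf R) (csq (f x))%:E < +oo)%E.

Definition L2dist2 (R : realType) (f h : R -> R[i]) : \bar R :=
  (\int[Leb R]_(x in Ihalf R) (csq (f x - h x))%:E)%E.

Definition Linf (R : realType) (f : R -> R[i]) : Prop :=
  cmeasurable f /\
  exists M : R, {ae Leb R, forall x, Ihalf R x -> cabs (f x) <= M}.

Definition Linf_inv (R : realType) (g : R -> R[i]) : Prop :=
  exists M : R, {ae Leb R, forall x, Ihalf R x -> g x != 0 /\ cabs ((g x)^-1) <= M}.

Definition lincomb (R : realType) (F : int -> R -> R[i]) (N : nat)
  (a : int -> R[i]) : R -> R[i] :=
  fun x => \sum_(k < (2 * N).+1) a (k%:Z - N%:Z)%R * F (k%:Z - N%:Z)%R x.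

Definition coefsq (R : realType) (N : nat) (a : int -> R[i]) : R :=
  \sum_(k < (2 * N).+1) csq (a (k%:Z - N%:Z)%R).

Definition riesz_basis (R : realType) (F : int -> R -> R[i]) : Prop :=
  (forall n, L2 (F n)) /\
  (forall f, L2 f -> forall eps : R, 0 < eps ->
     exists N a, (L2dist2 f (lincomb F N a) < eps%:E)%E) /\
  (exists A B : R, 0 < A /\ 0 < B /\
     forall N a,
       ((A * coefsq N a)%:E <= \int[Leb R]_(x in Ihalf R) (csq (lincomb F N a x))%:E)%E /\
       (\int[Leb R]_(x in Ihalf R) (csq (lincomb F N a x))%:E <= (B * coefsq N a)%:E)%E).

Definition expn (R : realType) (n : int) (x : R) : R[i] :=
  expi (2 * pi * n%:~R * x).

Definition Fsys (R : realType) (g : R -> R[i]) (n : int) : R -> R[i] :=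
  fun x => if (0 <= n)%R then expn n x else g x * expn n x.

(* 1-periodic extension of a function given on [-1/2,1/2) *)
Definition per (R : realType) (u : R -> R) (y : R) : R :=
  u (y - (Num.floor (y + 2^-1))%:~R).

Definition conj_trunc (R : realType) (u : R -> R) (x eps : R) : R :=
  Rintegral (Leb R) [set t : R | eps <= `|t| <= 2^-1]
    (fun t => per u (x - t) * (cos (pi * t) / sin (pi * t))).

Definition harmonic_conjugate (R : realType) (u uh : R -> R) : Prop :=
  {ae Leb R, forall x, Ihalf R x ->
     conj_trunc u x eps @[eps --> 0^'+] --> uh x}.

(* Main.v *)
Require Import Defs.
From HB Require Import structures.
From mathcomp Require Import all_boot all_order all_algebra.
From mathcomp Require Import all_classical all_reals all_analysis.
From mathcomp Require Import measurable_realfun complex zify ring lra.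

Import Order.TTheory GRing.Theory Num.Theory.
Import numFieldNormedType.Exports.
Local Open Scope classical_set_scope.
Local Open Scope ring_scope.
Local Open Scope complex_scope.

(** Write z = e^(2 pi i x). The Riesz property says that the functions p(z) + g conj(z c(z)),
    with p and c polynomials, are dense and that their squared norm is comparable to
    |p|^2 + |c|^2.

    If g/|g| = e^(i (u^h + v + c)), let G be the boundary value of the exponential of the
    Herglotz transform of u. Then g/G and g conj(G) take their values, up to a common
    rotation, in a sector of opening less than pi. Dividing by G gives the lower bound, and an
    iteration that contracts the non-analytic part of the residual gives density.

    Conversely, the lower Riesz bound A forces |g|^2 >= A a.e. and says that the form
    (1 - A) |a|^2 + int (|g|^2 - A) |c|^2 + 2 Re (int conj(g) z a c) is nonnegative.
    Extending this Hankel form one coefficient at a time, as in the Nehari and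
    Adamjan-Arov-Krein theorems, yields h with nonnegative frequencies such that
    |conj(g) - h| <= sqrt (1 - A) |g|. Density makes h outer, hence
    h = j e^(H) with H the Herglotz transform of log |h| and |j| = 1. So the argument of h
    is the harmonic conjugate of log |h|, and h/conj(g) contributes v = arg (h/conj(g)),
    which stays away from +-pi/2. *)

(** Functions on the circle are bounded measurable functions on the interval, and analytic functions
    in the disc are locally uniform limits of polynomials; nothing else of Hardy space theory is
    presupposed. The obstacle is that u^h is a pointwise limit of truncated integrals, known only
    almost everywhere. At Lebesgue points of u it is compared with the radial limit of the Herglotz
    transform: the truncated cotangent minus the conjugate Poisson kernel is odd and at most 2
    min(1/d, d/t^2). One dyadic estimate for kernels of this size also gives the Poisson and Fejer
    limits. In the converse this limit has to be produced: e^H has radial limits, but they fix the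
    argument only modulo 2 pi, and continuity along the radius selects the branch. The Hankel form
    carries the weight |g|^2 - A, so that the resulting bound on conj(g) - h is relative to |g|;
    multiplication by z preserves weighted norms, which is what the one-coefficient step needs.
    Since 1 - A < 1, the quotient h/conj(g) stays in a disc about 1 of radius less than 1, whence
    the gap below pi/2. *)

Notation "z ^~*" := (conjc z) (at level 1, format "z ^~*").

(** * Bounded measurable functions on the interval and their integrals *)

Section BoundedMeasurable.
Context {R : realType}.
Implicit Types (f g : R -> R) (M : R).

Definition I f : R := \int[Leb R]_(x in Ihalf R) f x.

(** The bound holds everywhere on the interval, not almost everywhere: the class is then closed
    under products and under composition with continuous functions, and all its members are
    integrable. *)
Definition bm f : Prop :=
  measurable_fun (Ihalf R) f /\ exists M, forall x, Ihalf R x -> `|f x| <= M.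

Lemma measurable_Ihalf : measurable (Ihalf R).
Proof. exact: measurable_itv. Qed.

Lemma Leb_Ihalf : Leb R (Ihalf R) = 1%:E.
Proof.
rewrite /Ihalf lebesgue_measure_itv /= lte_fin.
rewrite ifT; last by lra.
by rewrite -EFinD; congr (_%:E); lra.
Qed.

Lemma bm_integrable {f} : bm f -> (Leb R).-integrable (Ihalf R) (EFin \o f).
Proof.
move=> [mf [M fM]]; apply: measurable_bounded_integrable => //.
- exact: measurable_Ihalf.
- by have := @ltry R 1; rewrite -Leb_Ihalf.
- exists M; split; first exact: num_real.
  by move=> y My x Ix /=; apply: (le_trans (fM x Ix)); exact: ltW.
Qed.

Lemma eq_bm f g : (forall x, Ihalf R x -> f x = g x) -> bm f -> bm g.
Proof.
move=> fg [mf [M fM]]; split.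
  by apply: (eq_measurable_fun f) => // x; rewrite inE; exact: fg.
by exists M => x Ix; rewrite -fg//; exact: fM.
Qed.

Lemma bm_cst c : bm (fun=> c).
Proof. by split; [exact: measurable_cst|exists `|c|]. Qed.

Lemma bmD f g : bm f -> bm g -> bm (fun x => f x + g x).
Proof.
move=> [mf [M fM]] [mg [N gN]]; split; first exact: measurable_funD.
exists (M + N) => x Ix; apply: (le_trans (ler_normD _ _)).
by apply: lerD; [exact: fM|exact: gN].
Qed.

Lemma bmN f : bm f -> bm (fun x => - f x).
Proof.
move=> [mf [M fM]]; split; last by exists M => x Ix; rewrite normrN fM.
by apply: measurableT_comp.
Qed.

Lemma bmB f g : bm f -> bm g -> bm (fun x => f x - g x).
Proof. by move=> bf bg; apply: bmD => //; exact: bmN. Qed.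

Lemma bmM f g : bm f -> bm g -> bm (fun x => f x * g x).
Proof.
move=> [mf [M fM]] [mg [N gN]]; split; first exact: measurable_funM.
exists (M * N) => x Ix; rewrite normrM.
by apply: ler_pM => //; [exact: fM|exact: gN].
Qed.

Lemma bmX f n : bm f -> bm (fun x => f x ^+ n).
Proof.
move=> bf; elim: n => [|n IH]; first exact: bm_cst.
by under eq_fun do rewrite exprS; exact: bmM.
Qed.

Lemma bm_norm f : bm f -> bm (fun x => `|f x|).
Proof.
move=> [mf [M fM]]; split; last by exists M => x Ix; rewrite normr_id fM.
by apply: measurableT_comp.
Qed.

Lemma bm_cts f : continuous f -> bm f.
Proof.
move=> cf; split.
  by apply: measurable_funTS; exact: continuous_measurable_fun.
have cK : compact (Ihalf R) by exact: segment_compact.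
have cfI : {within Ihalf R, continuous f} by exact: continuous_subspaceT.
have := continuous_compact cfI cK.
move=> /compact_bounded [M [_ HM]]; exists (M + 1) => x Ix.
by apply: HM; [rewrite ltrDl|exists x].
Qed.

Lemma bm_comp f (h : R -> R) : continuous h -> bm f -> bm (fun x => h (f x)).
Proof.
move=> ch [mf [M fM]]; split.
  apply: measurableT_comp => //; exact: continuous_measurable_fun.
have cK : compact `[- M, M]%classic by exact: segment_compact.
have chI : {within `[- M, M]%classic, continuous h} by exact: continuous_subspaceT.
have := continuous_compact chI cK.
move=> /compact_bounded [N [_ HN]]; exists (N + 1) => x Ix.
apply: HN; first by rewrite ltrDl.
by exists (f x) => //=; rewrite in_itv/= -ler_norml fM.
Qed.

Lemma bm_indic (A : set R) : measurable A -> bm (\1_A : R -> R).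
Proof.
move=> mA; split; first exact/measurable_funTS/measurable_indic.
by exists 1 => x _; rewrite indicE ger0_norm ?ler0n// lern1; case: (_ \in _).
Qed.

Lemma ID f g : bm f -> bm g -> I (fun x => f x + g x) = I f + I g.
Proof. by move=> bf bg; apply: RintegralD; [exact: measurable_Ihalf|exact: bm_integrable|exact: bm_integrable]. Qed.

Lemma IB f g : bm f -> bm g -> I (fun x => f x - g x) = I f - I g.
Proof. by move=> bf bg; apply: RintegralB; [exact: measurable_Ihalf|exact: bm_integrable|exact: bm_integrable]. Qed.

Lemma IZ c f : bm f -> I (fun x => c * f x) = c * I f.
Proof. by move=> bf; apply: RintegralZl; [exact: measurable_Ihalf|exact: bm_integrable]. Qed.

Lemma IN f : bm f -> I (fun x => - f x) = - I f.
Proof. by move=> bf; rewrite -mulN1r -IZ//; apply: eq_Rintegral => x _; rewrite mulN1r. Qed.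

Lemma I_cst c : I (fun=> c) = c.
Proof. rewrite /I Rintegral_cst; last exact: measurable_Ihalf.
have := @Leb_Ihalf; rewrite /= => E; by rewrite [X in fine X]E mulr1. Qed.

Lemma eq_I f g : (forall x, Ihalf R x -> f x = g x) -> I f = I g.
Proof. by move=> fg; apply: eq_Rintegral => x; rewrite inE; exact: fg. Qed.

Lemma I_ge0 f : (forall x, Ihalf R x -> 0 <= f x) -> 0 <= I f.
Proof. by move=> f0; apply: Rintegral_ge0. Qed.

Lemma le_I f g : bm f -> bm g -> (forall x, Ihalf R x -> f x <= g x) -> I f <= I g.
Proof.
by move=> bf bg fg; apply: le_Rintegral => //;
  [exact: measurable_Ihalf|exact: bm_integrable|exact: bm_integrable].
Qed.

Lemma I_norm f : bm f -> `|I f| <= I (fun x => `|f x|).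
Proof. by move=> bf; apply: le_normr_Rintegral; [exact: measurable_Ihalf|exact: bm_integrable]. Qed.

Lemma EFin_I f : bm f -> (\int[Leb R]_(x in Ihalf R) (f x)%:E)%E = (I f)%:E.
Proof.
move=> bf; rewrite /I /Rintegral fineK//.
by apply: integrable_fin_num; [exact: measurable_Ihalf|exact: bm_integrable].
Qed.

Local Notation mu := (lebesgue_measure : {measure set (measurableTypeR R) -> \bar R}).

Definition aeI (P : R -> Prop) := {ae Leb R, forall x, Ihalf R x -> P x}.

Lemma Leb_ae_filter : Filter (almost_everywhere (Leb R)).
Proof. exact: (ae_filter_ringOfSetsType mu). Qed.

Lemma aeI_imp (P Q : R -> Prop) : (forall x, Ihalf R x -> P x -> Q x) -> aeI P -> aeI Q.
Proof.
have F := Leb_ae_filter; rewrite /aeI => PQ; apply: filterS => x Px Ix.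
by apply: PQ => //; exact: Px.
Qed.

Lemma aeI_and (P Q : R -> Prop) : aeI P -> aeI Q -> aeI (fun x => P x /\ Q x).
Proof.
by have F := Leb_ae_filter; rewrite /aeI; apply: filterS2 => x Px Qx Ix; split; [exact: Px|exact: Qx].
Qed.

Lemma aeI_T (P : R -> Prop) : (forall x, Ihalf R x -> P x) -> aeI P.
Proof. by have F := Leb_ae_filter; rewrite /aeI => h; exact: nearW. Qed.

Lemma ae_aeI (P : R -> Prop) : {ae Leb R, forall x, P x} -> aeI P.
Proof. by have F := Leb_ae_filter; rewrite /aeI; apply: filterS => x Px _. Qed.

Lemma aeI_neq (a : R) : aeI (fun x => x != a).
Proof.
exists [set a]; split => //; first exact: lebesgue_measure_set1.
by move=> x /=; apply: contra_notP => /eqP xa _.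
Qed.

Lemma eq_I_ae f g : bm f -> bm g -> aeI (fun x => f x = g x) -> I f = I g.
Proof.
have F := Leb_ae_filter.
move=> bf bg fg; rewrite /I /Rintegral; congr fine.
apply: (@ae_eq_integral _ _ R mu) => //; [exact: measurable_Ihalf|..].
- by case: bf => /measurable_EFinP.
- by case: bg => /measurable_EFinP.
- by move: fg; rewrite /aeI /ae_eq; apply: filterS => x fg Ix; rewrite fg.
Qed.

Lemma I_dct (F : nat -> R -> R) f M : (forall n, bm (F n)) -> bm f ->
  (forall n x, Ihalf R x -> `|F n x| <= M) ->
  aeI (fun x => F n x @[n --> \oo] --> f x) ->
  I (F n) @[n --> \oo] --> I f.
Proof.
move=> bF bf FM Ff; have Fi := Leb_ae_filter.
have := @dominated_convergence _ _ R mu (Ihalf R) measurable_Ihalf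
  (fun n x => (F n x)%:E) (fun x => (f x)%:E) (fun=> M%:E).
case.
- by move=> n; case: (bF n) => /measurable_EFinP.
- by case: bf => /measurable_EFinP.
- by move: Ff; rewrite /aeI; apply: filterS => x Ff Ix; apply: cvg_EFin (Ff Ix); exact: nearW.
- exact: (@bm_integrable (fun=> M) (bm_cst M)).
- by apply: nearW => x n Ix; rewrite lee_fin; exact: FM.
move=> _ _; rewrite (EFin_I _ bf) => h.
exact: (fine_cvg h).
Qed.

End BoundedMeasurable.

(** * Complex integrals, the Cauchy-Schwarz inequality and the L^2 norm *)

Section ComplexIntegral.
Context {R : realType}.
Notation C := R[i].
Implicit Types (z w : C) (f g h : R -> C).
Notation Re := complex.Re.
Notation Im := complex.Im.

Lemma cReD z w : Re (z + w) = Re z + Re w. Proof. by case: z; case: w. Qed.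
Lemma cImD z w : Im (z + w) = Im z + Im w. Proof. by case: z; case: w. Qed.
Lemma cReN z : Re (- z) = - Re z. Proof. by case: z. Qed.
Lemma cImN z : Im (- z) = - Im z. Proof. by case: z. Qed.
Lemma cReM z w : Re (z * w) = Re z * Re w - Im z * Im w. Proof. by case: z; case: w. Qed.
Lemma cImM z w : Im (z * w) = Re z * Im w + Im z * Re w. Proof. by case: z; case: w. Qed.
Lemma Re_conj z : Re z^~* = Re z. Proof. by case: z. Qed.
Lemma Im_conj z : Im z^~* = - Im z. Proof. by case: z. Qed.
Lemma Re_rc (a : R) : Re a%:C = a. Proof. by []. Qed.
Lemma Im_rc (a : R) : Im a%:C = 0. Proof. by []. Qed.
Definition ReImE := (cReD, cImD, cReN, cImN, cReM, cImM, Re_conj, Im_conj, Re_rc, Im_rc).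

Lemma complexP z w : Re z = Re w -> Im z = Im w -> z = w.
Proof. by case: z; case: w => ? ? ? ? /= -> ->. Qed.

Lemma conjcD z w : (z + w)^~* = z^~* + w^~*. Proof. exact: rmorphD. Qed.
Lemma conjcB z w : (z - w)^~* = z^~* - w^~*. Proof. exact: rmorphB. Qed.
Lemma conjcM z w : (z * w)^~* = z^~* * w^~*. Proof. exact: rmorphM. Qed.
Lemma conjcX z n : (z ^+ n)^~* = z^~* ^+ n. Proof. exact: rmorphXn. Qed.

Lemma csq_ge0 z : 0 <= csq z. Proof. by rewrite addr_ge0 ?sqr_ge0. Qed.
Lemma csqE z : (csq z)%:C = z * z^~*.
Proof. by apply: complexP; rewrite /csq !ReImE; ring. Qed.
Lemma csqM z w : csq (z * w) = csq z * csq w.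
Proof. by rewrite /csq !ReImE; ring. Qed.
Lemma csq_conj z : csq z^~* = csq z. Proof. by rewrite /csq !ReImE; ring. Qed.
Lemma csqN z : csq (- z) = csq z. Proof. by rewrite /csq !ReImE; ring. Qed.
Lemma csq_rc (a : R) : csq a%:C = a ^+ 2. Proof. by rewrite /csq !ReImE; ring. Qed.
Lemma csq0 : csq (0 : C) = 0. Proof. by rewrite csq_rc expr0n. Qed.
Lemma csq1 : csq (1 : C) = 1. Proof. by rewrite csq_rc expr1n. Qed.
Lemma csqX z n : csq (z ^+ n) = csq z ^+ n.
Proof. by elim: n => [|n IH]; rewrite ?csq1// !exprS csqM IH. Qed.
Lemma csq_eq0 z : (csq z == 0) = (z == 0).
Proof.
apply/eqP/eqP => [h|->]; last exact: csq0.
have h1 := sqr_ge0 (Re z); have h2 := sqr_ge0 (Im z); move: h; rewrite /csq => h.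
by apply: complexP; apply/eqP; rewrite -sqrf_eq0; apply/eqP => /=; lra.
Qed.
Lemma csq_gt0 z : (0 < csq z) = (z != 0).
Proof. by rewrite lt_def csq_eq0 csq_ge0 andbT. Qed.
Lemma csqV z : csq z^-1 = (csq z)^-1.
Proof.
have [->|z0] := eqVneq z 0; first by rewrite invr0 csq0 invr0.
have c0 : csq z != 0 by rewrite csq_eq0.
by apply: (mulfI c0); rewrite -csqM !divff// csq1.
Qed.
Lemma le_csqD z w : csq (z + w) <= 2 * csq z + 2 * csq w.
Proof.
rewrite /csq !ReImE; have := sqr_ge0 (Re z - Re w); have := sqr_ge0 (Im z - Im w).
by nra.
Qed.

Lemma cabs_ge0 z : 0 <= cabs z. Proof. exact: sqrtr_ge0. Qed.
Lemma sqr_cabs z : cabs z ^+ 2 = csq z. Proof. by rewrite sqr_sqrtr// csq_ge0. Qed.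
Lemma cabsM z w : cabs (z * w) = cabs z * cabs w.
Proof. by rewrite /cabs csqM sqrtrM// csq_ge0. Qed.
Lemma cabs_conj z : cabs z^~* = cabs z. Proof. by rewrite /cabs csq_conj. Qed.
Lemma cabsN z : cabs (- z) = cabs z. Proof. by rewrite /cabs csqN. Qed.
Lemma cabs_rc (a : R) : cabs a%:C = `|a|. Proof. by rewrite /cabs csq_rc sqrtr_sqr. Qed.
Lemma cabs0 : cabs (0 : C) = 0. Proof. by rewrite cabs_rc normr0. Qed.
Lemma cabs1 : cabs (1 : C) = 1. Proof. by rewrite cabs_rc normr1. Qed.
Lemma cabsX z n : cabs (z ^+ n) = cabs z ^+ n.
Proof. by elim: n => [|n IH]; rewrite ?cabs1// !exprS cabsM IH. Qed.
Lemma cabs_eq0 z : (cabs z == 0) = (z == 0).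
Proof. by rewrite -sqrf_eq0 sqr_cabs csq_eq0. Qed.
Lemma cabs_gt0 z : (0 < cabs z) = (z != 0).
Proof. by rewrite lt_def cabs_eq0 cabs_ge0 andbT. Qed.
Lemma cabsV z : cabs z^-1 = (cabs z)^-1.
Proof. by rewrite /cabs csqV sqrtrV// csq_ge0. Qed.
Lemma cabs_le z (a : R) : 0 <= a -> (cabs z <= a) = (csq z <= a ^+ 2).
Proof. by move=> a0; rewrite -sqr_cabs ler_sqr// nnegrE// cabs_ge0. Qed.
Lemma Re_le_cabs z : `|Re z| <= cabs z.
Proof. by rewrite -sqrtr_sqr ler_sqrt ?csq_ge0// /csq lerDl sqr_ge0. Qed.
Lemma Im_le_cabs z : `|Im z| <= cabs z.
Proof. by rewrite -sqrtr_sqr ler_sqrt ?csq_ge0// /csq lerDr sqr_ge0. Qed.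
Lemma Re_le z : Re z <= cabs z. Proof. by apply: le_trans (Re_le_cabs z); exact: ler_norm. Qed.
Lemma cabs_le_ReIm z : cabs z <= `|Re z| + `|Im z|.
Proof.
rewrite cabs_le ?addr_ge0// /csq -(real_normK (num_real (Re z))) -(real_normK (num_real (Im z))).
by have := normr_ge0 (Re z); have := normr_ge0 (Im z); nra.
Qed.
Lemma cabsD z w : cabs (z + w) <= cabs z + cabs w.
Proof.
rewrite cabs_le ?addr_ge0 ?cabs_ge0// sqrrD !sqr_cabs.
have := Re_le (z * w^~*); rewrite cabsM cabs_conj /csq !ReImE.
by lra.
Qed.
Lemma cabsB z w : cabs (z - w) <= cabs z + cabs w.
Proof. by rewrite -(cabsN w); exact: cabsD. Qed.
Lemma cabs_lerB z w : cabs z - cabs w <= cabs (z - w).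
Proof. by rewrite lerBlDr; apply: le_trans (cabsD _ _); rewrite subrK. Qed.
Lemma cabs_distC z w : cabs (z - w) = cabs (w - z).
Proof. by rewrite -cabsN opprB. Qed.
Lemma cabs_sum {J : Type} (s : seq J) (P : pred J) (F : J -> C) :
  cabs (\sum_(j <- s | P j) F j) <= \sum_(j <- s | P j) cabs (F j).
Proof.
elim/big_ind2: _ => //; first by rewrite cabs0.
by move=> a b c d h1 h2; apply: (le_trans (cabsD _ _)); exact: lerD.
Qed.

Definition cbm f := bm (fun x => Re (f x)) /\ bm (fun x => Im (f x)).
Definition CI f : C := Complex (I (fun x => Re (f x))) (I (fun x => Im (f x))).

Lemma eq_cbm f g : (forall x, Ihalf R x -> f x = g x) -> cbm f -> cbm g.
Proof. by move=> fg [rf jf]; split; [apply: eq_bm rf|apply: eq_bm jf] => x Ix; rewrite fg. Qed.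
Lemma cbm_cst z : cbm (fun=> z). Proof. by split; exact: bm_cst. Qed.
Lemma cbmD f g : cbm f -> cbm g -> cbm (fun x => f x + g x).
Proof.
by move=> [? ?] [? ?]; split; under eq_fun do rewrite ReImE; exact: bmD.
Qed.
Lemma cbmN f : cbm f -> cbm (fun x => - f x).
Proof. by move=> [? ?]; split; under eq_fun do rewrite ReImE; exact: bmN. Qed.
Lemma cbmB f g : cbm f -> cbm g -> cbm (fun x => f x - g x).
Proof. by move=> bf bg; apply: cbmD => //; exact: cbmN. Qed.
Lemma cbmM f g : cbm f -> cbm g -> cbm (fun x => f x * g x).
Proof.
move=> [? ?] [? ?]; split; under eq_fun do rewrite ReImE.
  by apply: bmB; exact: bmM.
by apply: bmD; exact: bmM.
Qed.
Lemma cbmX f n : cbm f -> cbm (fun x => f x ^+ n).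
Proof.
move=> bf; elim: n => [|n IH]; first exact: cbm_cst.
by under eq_fun do rewrite exprS; exact: cbmM.
Qed.
Lemma cbm_conj f : cbm f -> cbm (fun x => (f x)^~*).
Proof.
move=> [? ?]; split; first by under eq_fun do rewrite ReImE.
by under eq_fun do rewrite ReImE; exact: bmN.
Qed.
Lemma cbm_rc (f : R -> R) : bm f -> cbm (fun x => (f x)%:C).
Proof. by move=> bf; split => //; exact: bm_cst. Qed.
Lemma cbm_sum {J : Type} (s : seq J) (P : pred J) (F : J -> R -> C) :
  (forall j, cbm (F j)) -> cbm (fun x => \sum_(j <- s | P j) F j x).
Proof.
move=> bF; elim: s => [|j s IH].
  by under eq_fun do rewrite big_nil; exact: cbm_cst.
by under eq_fun do rewrite big_cons; case: (P j) => //; exact: cbmD.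
Qed.
Lemma bm_csq f : cbm f -> bm (fun x => csq (f x)).
Proof. by move=> [? ?]; apply: bmD; exact: bmX. Qed.
Lemma bm_cabs f : cbm f -> bm (fun x => cabs (f x)).
Proof. by move=> bf; apply: (bm_comp _ _ (@sqrt_continuous R)); exact: bm_csq. Qed.
Lemma cbm_bounded f : cbm f -> exists2 M, 0 <= M & forall x, Ihalf R x -> cabs (f x) <= M.
Proof.
move=> /bm_cabs[_ [M hM]]; exists `|M| => // x Ix.
by apply: le_trans (le_trans (hM x Ix) (ler_norm _)); exact: ler_norm.
Qed.
Lemma cbmI f (M : R) : measurable_fun (Ihalf R) (fun x => Re (f x)) ->
  measurable_fun (Ihalf R) (fun x => Im (f x)) ->
  (forall x, Ihalf R x -> cabs (f x) <= M) -> cbm f.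
Proof.
move=> mr mi fM; split; split => //; exists M => x Ix; apply: le_trans (fM x Ix).
  exact: Re_le_cabs.
exact: Im_le_cabs.
Qed.

Lemma Re_CI f : Re (CI f) = I (fun x => Re (f x)). Proof. by []. Qed.
Lemma Im_CI f : Im (CI f) = I (fun x => Im (f x)). Proof. by []. Qed.
Lemma eq_CI f g : (forall x, Ihalf R x -> f x = g x) -> CI f = CI g.
Proof. by move=> fg; congr Complex; apply: eq_I => x Ix; rewrite fg. Qed.
Lemma CI_cst z : CI (fun=> z) = z.
Proof. by apply: complexP; rewrite /= I_cst. Qed.
Lemma CID f g : cbm f -> cbm g -> CI (fun x => f x + g x) = CI f + CI g.
Proof.
move=> [? ?] [? ?]; apply: complexP; rewrite !ReImE /= -ID//;
  by apply: eq_I => x _; rewrite ReImE.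
Qed.
Lemma CIN f : cbm f -> CI (fun x => - f x) = - CI f.
Proof.
move=> [? ?]; apply: complexP; rewrite !ReImE /= -IN//;
  by apply: eq_I => x _; rewrite ReImE.
Qed.
Lemma CIB f g : cbm f -> cbm g -> CI (fun x => f x - g x) = CI f - CI g.
Proof. by move=> bf bg; rewrite -CIN// -CID//; exact: cbmN. Qed.
Lemma CIZ z f : cbm f -> CI (fun x => z * f x) = z * CI f.
Proof.
move=> [? ?]; apply: complexP; rewrite !ReImE /= -!IZ//.
  rewrite -IB; [|exact: bmM (bm_cst _) _|exact: bmM (bm_cst _) _].
  by apply: eq_I => x _; rewrite ReImE.
rewrite -ID; [|exact: bmM (bm_cst _) _|exact: bmM (bm_cst _) _].
by apply: eq_I => x _; rewrite ReImE.
Qed.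
Lemma CI_conj f : cbm f -> CI (fun x => (f x)^~*) = (CI f)^~*.
Proof.
move=> [? ?]; apply: complexP; rewrite !ReImE /= -?IN//;
  by apply: eq_I => x _; rewrite ReImE.
Qed.
Lemma CI_sum {J : Type} (s : seq J) (P : pred J) (F : J -> R -> C) :
  (forall j, cbm (F j)) ->
  CI (fun x => \sum_(j <- s | P j) F j x) = \sum_(j <- s | P j) CI (F j).
Proof.
move=> bF; elim: s => [|j s IH].
  by rewrite big_nil -[RHS](CI_cst 0); apply: eq_CI => x _; rewrite big_nil.
rewrite big_cons -IH; case: ifP => Pj.
  rewrite -CID//; last exact: cbm_sum.
  by apply: eq_CI => x _; rewrite big_cons Pj.
by apply: eq_CI => x _; rewrite big_cons Pj.
Qed.
Lemma CI_rc (f : R -> R) : CI (fun x => (f x)%:C) = (I f)%:C.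
Proof. by apply: complexP => //=; rewrite I_cst. Qed.
Lemma eq_CI_ae f g : cbm f -> cbm g -> aeI (fun x => f x = g x) -> CI f = CI g.
Proof.
move=> [? ?] [? ?] fg; congr Complex; apply: eq_I_ae => //; apply: aeI_imp fg => x _ -> //.
Qed.

(** Multiplying f by the conjugate of its integral rotates the integral onto the positive axis,
    where Re z <= |z| can be integrated. *)
Lemma CI_cabs f : cbm f -> cabs (CI f) <= I (fun x => cabs (f x)).
Proof.
move=> bf; have [->|w0] := eqVneq (CI f) 0.
  by rewrite cabs0; apply: I_ge0 => x _; exact: cabs_ge0.
have c0 : 0 < cabs (CI f) by rewrite cabs_gt0.
rewrite -(ler_pM2l c0) -expr2 sqr_cabs.
have bz : cbm (fun x => (CI f)^~* * f x) by apply: cbmM => //; exact: cbm_cst.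
have -> : csq (CI f) = Re (CI (fun x => (CI f)^~* * f x)).
  by rewrite CIZ// mulrC -csqE.
rewrite Re_CI -IZ; last exact: bm_cabs.
apply: le_I => [|| x _]; first by case: bz.
  by apply: bmM (bm_cst _) _; exact: bm_cabs.
by apply: (le_trans (Re_le _)); rewrite cabsM cabs_conj.
Qed.
Lemma CI_bound f (M : R) : cbm f -> (forall x, Ihalf R x -> cabs (f x) <= M) -> cabs (CI f) <= M.
Proof.
move=> bf fM; apply: (le_trans (CI_cabs _ bf)); rewrite -[leRHS]I_cst.
by apply: le_I => //; [exact: bm_cabs|exact: bm_cst].
Qed.

(** The integral of |t conj(w) f - conj(g)|^2 is a nonnegative quadratic polynomial in the real t.
    It is minimal at t = 1/A; if A = 0, a large t forces w = 0. *)
Lemma CI_CS f g : cbm f -> cbm g ->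
  csq (CI (fun x => f x * g x)) <= I (fun x => csq (f x)) * I (fun x => csq (g x)).
Proof.
move=> bf bg; set w := CI _; set A := I _; set B := I _.
have A0 : 0 <= A by apply: I_ge0 => x _; exact: csq_ge0.
have key (t : R) : 0 <= t ^+ 2 * csq w * A - 2 * t * csq w + B.
  set q := fun x => Re (w^~* * (f x * g x)).
  have bq : bm q.
    suff [] : cbm (fun x => w^~* * (f x * g x)) by [].
    by apply: cbmM (cbm_cst _) _; exact: cbmM.
  have Ew : csq w = I q.
    have := csqE w; rewrite mulrC {2}/w -CIZ; last exact: cbmM.
    by move=> /(congr1 (@complex.Re R)).
  have -> : t ^+ 2 * csq w * A - 2 * t * csq w + B =
      I (fun x => csq (t%:C * w^~* * f x - (g x)^~*)).
    rewrite {2}Ew; transitivity (I (fun x => (t ^+ 2 * csq w) * csq (f x) +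
      ((- 2 * t) * q x + csq (g x)))).
      have b1 := bm_csq _ bf; have b2 := bm_csq _ bg.
      have b3 : bm (fun x => (- 2 * t) * q x) by apply: bmM (bm_cst _) _.
      rewrite ID; [|by apply: bmM (bm_cst _) _|exact: bmD].
      by rewrite ID// !IZ// -/A -/B; ring.
    by apply: eq_I => x _; rewrite /q /csq !ReImE; ring.
  by apply: I_ge0 => x _; exact: csq_ge0.
have B0 : 0 <= B by apply: I_ge0 => x _; exact: csq_ge0.
have w0 := csq_ge0 w.
have [A00|A1] := eqVneq A 0.
  rewrite A00 mul0r; have [//|wp] := leP (csq w) 0.
  have := key ((B + 1) / (2 * csq w)).
  rewrite A00 mulr0 add0r (_ : 2 * _ * csq w = B + 1); last by field; rewrite gt_eqF.
  by lra.
have Ap : 0 < A by rewrite lt_def A1.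
have := key A^-1.
rewrite (_ : _ + B = (A * B - csq w) / A); last by field.
by rewrite pmulr_lge0 ?invr_gt0// subr_ge0.
Qed.

Definition nrm f : R := Num.sqrt (I (fun x => csq (f x))).

Lemma I_csq_ge0 f : 0 <= I (fun x => csq (f x)).
Proof. by apply: I_ge0 => x _; exact: csq_ge0. Qed.
Lemma nrm_ge0 f : 0 <= nrm f. Proof. exact: sqrtr_ge0. Qed.
Lemma sqr_nrm f : nrm f ^+ 2 = I (fun x => csq (f x)).
Proof. by rewrite sqr_sqrtr// I_csq_ge0. Qed.
Lemma eq_nrm f g : (forall x, Ihalf R x -> f x = g x) -> nrm f = nrm g.
Proof. by move=> fg; congr Num.sqrt; apply: eq_I => x Ix; rewrite fg. Qed.
Lemma nrm_CS f g : cbm f -> cbm g -> cabs (CI (fun x => f x * g x)) <= nrm f * nrm g.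
Proof.
move=> bf bg; rewrite cabs_le ?mulr_ge0 ?nrm_ge0//.
by rewrite exprMn !sqr_nrm; exact: CI_CS.
Qed.
Lemma nrm_conj f : nrm (fun x => (f x)^~*) = nrm f.
Proof. by congr Num.sqrt; apply: eq_I => x _; rewrite csq_conj. Qed.
Lemma nrmN f : nrm (fun x => - f x) = nrm f.
Proof. by congr Num.sqrt; apply: eq_I => x _; rewrite csqN. Qed.
Lemma I_csqE f : cbm f -> I (fun x => csq (f x)) = Re (CI (fun x => f x * (f x)^~*)).
Proof. by move=> bf; rewrite Re_CI; apply: eq_I => x _; rewrite -csqE. Qed.
Lemma nrmD f g : cbm f -> cbm g -> nrm (fun x => f x + g x) <= nrm f + nrm g.
Proof.
move=> bf bg; rewrite -(ler_pXn2r (n:=2)) ?nnegrE ?addr_ge0 ?nrm_ge0//.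
rewrite sqrrD !sqr_nrm.
have bg' := cbm_conj _ bg.
have b3 : cbm (fun x => f x * (g x)^~*) by exact: cbmM.
have -> : I (fun x => csq (f x + g x)) =
  I (fun x => csq (f x)) + 2 * Re (CI (fun x => f x * (g x)^~*)) + I (fun x => csq (g x)).
  have b1 := bm_csq _ bf; have b2 := bm_csq _ bg; case: (b3) => b4 _.
  rewrite Re_CI -IZ// -!ID//; [|by apply: bmD => //; exact: bmM (bm_cst _) _|exact: bmM (bm_cst _) _].
  by apply: eq_I => x _; rewrite /csq !ReImE; ring.
have := le_trans (Re_le _) (nrm_CS _ _ bf bg'); rewrite nrm_conj.
by rewrite -mulr_natl; lra.
Qed.
Lemma nrmB f g : cbm f -> cbm g -> nrm (fun x => f x - g x) <= nrm f + nrm g.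
Proof. by move=> bf bg; rewrite -(nrmN g); apply: nrmD => //; exact: cbmN. Qed.
Lemma nrm_le f g (K : R) : 0 <= K -> cbm f -> cbm g ->
  (forall x, Ihalf R x -> cabs (f x) <= K * cabs (g x)) -> nrm f <= K * nrm g.
Proof.
move=> K0 bf bg fg; rewrite -(ler_pXn2r (n:=2)) ?nnegrE ?mulr_ge0 ?nrm_ge0//.
rewrite exprMn !sqr_nrm -IZ; last exact: bm_csq.
apply: le_I => [||x Ix]; [exact: bm_csq|by apply: bmM (bm_cst _) _; exact: bm_csq|].
rewrite -!sqr_cabs -exprMn ler_pXn2r// ?nnegrE ?mulr_ge0 ?cabs_ge0//; exact: fg.
Qed.
Lemma nrm_bound f (K : R) : 0 <= K -> cbm f ->
  (forall x, Ihalf R x -> cabs (f x) <= K) -> nrm f <= K.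
Proof.
move=> K0 bf fK; have := nrm_le f (fun=> 1) K K0 bf (cbm_cst 1).
have -> : nrm (fun=> 1 : C) = 1.
  by rewrite /nrm (eq_I _ (fun=> 1)) ?I_cst ?sqrtr1// => x _; rewrite csq1.
by rewrite mulr1; apply => x Ix; rewrite cabs1 mulr1; exact: fK.
Qed.
Lemma nrmZ z f : cbm f -> nrm (fun x => z * f x) = cabs z * nrm f.
Proof.
move=> bf; rewrite /nrm /cabs -sqrtrM ?csq_ge0// -IZ; last exact: bm_csq.
by congr Num.sqrt; apply: eq_I => x _; rewrite csqM.
Qed.

Lemma nrm_dct (F : nat -> R -> C) f (M : R) : (forall n, cbm (F n)) -> cbm f ->
  (forall n x, Ihalf R x -> cabs (F n x) <= M) ->
  aeI (fun x => cabs (F n x - f x) @[n --> \oo] --> 0) ->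
  nrm (fun x => F n x - f x) @[n --> \oo] --> 0.
Proof.
move=> bF bf FM Ff; have [N N0 fN] := cbm_bounded _ bf.
have b n : cbm (fun x => F n x - f x) by exact: cbmB.
have -> : 0 = Num.sqrt (I (fun=> (0:R))) by rewrite I_cst sqrtr0.
apply: continuous_cvg; first exact: sqrt_continuous.
apply: (I_dct _ _ ((M + N) ^+ 2)) => [n|| n x Ix|].
- exact: bm_csq.
- exact: bm_cst.
- rewrite ger0_norm ?csq_ge0// -sqr_cabs ler_sqr ?nnegrE ?cabs_ge0//.
    by apply: (le_trans (cabsB _ _)); apply: lerD; [exact: FM|exact: fN].
  by apply: addr_ge0 => //; apply: le_trans (FM n x Ix); exact: cabs_ge0.
apply: aeI_imp Ff => x Ix h.
have -> : 0 = 0 ^+ 2 :> R by rewrite expr0n.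
rewrite (_ : (fun n => csq _) = (fun n => cabs (F n x - f x) * cabs (F n x - f x))).
  by rewrite expr2; exact: cvgM.
by apply/funext => n; rewrite -sqr_cabs expr2.
Qed.

End ComplexIntegral.

(** * Change of variables in periodic convolutions *)

Section PeriodicConvolution.
Context {R : realType}.
Implicit Types (u k : R -> R).
Local Notation mu := (lebesgue_measure : {measure set (measurableTypeR R) -> \bar R}).

Definition reflect (y : R) : measurableTypeR R -> measurableTypeR R := fun t => (y - t)%R.

Lemma lebesgue_measure_reflect (y : R) (A : set R) : measurable A ->
  pushforward mu (reflect y) A = mu A.
Proof.
have mphi : measurable_fun setT (reflect y).
  exact: measurable_funB.
move=> mA; apply/esym.
pose nu := pushforward mu (reflect y).
apply: (@lebesgue_measure_unique R nu) => //= _ [[a b]] _ <-.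
rewrite /nu /pushforward /=.
rewrite (_ : _ @^-1` _ = `[y - b, y - a[%classic); last first.
  by apply/seteqP; split => t /=; rewrite /reflect !in_itv/= => /andP[h1 h2]; apply/andP; split; lra.
rewrite !lebesgue_measure_itv/= !lte_fin.
rewrite ltrD2l ltrN2; case: ifP => // _.
by rewrite -!EFinD; congr (_%:E); ring.
Qed.

Lemma I_patch (f : R -> R) : (forall t, f t != 0 -> Ihalf R t) -> I f = Rintegral mu setT f.
Proof.
move=> sf; rewrite /I Rintegral_mkcond; apply: eq_Rintegral => t _.
rewrite patchE; case: ifPn => // tI; apply/esym/eqP/negPn/negP => /sf It.
by move/negP: tI; apply; rewrite inE.
Qed.

Lemma bm_patch (f : R -> R) : bm f -> (forall t, f t != 0 -> Ihalf R t) ->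
  mu.-integrable setT (EFin \o f).
Proof.
move=> bf sf.
have -> : (EFin \o f) = ((EFin \o f) \_ (Ihalf R)).
  apply/funext => t; rewrite patchE; case: ifPn => // tI /=; congr (_%:E).
  apply/eqP/negPn/negP => /sf It.
  by move/negP: tI; apply; rewrite inE.
by apply/integrable_restrict => //; rewrite ?setTI; [exact: measurable_Ihalf|exact: bm_integrable].
Qed.

(** The support conditions allow both integrals to be taken over the whole line, where t -> y - t
    preserves Lebesgue measure. *)
Lemma I_reflect (f : R -> R) (y : R) : measurable_fun setT f ->
  (exists M : R, forall t, `|f t| <= M) ->
  (forall t, f t != 0 -> Ihalf R t) -> (forall s, f (y - s) != 0 -> Ihalf R s) ->
  I f = I (fun s => f (y - s)).
Proof.
move=> mf [M fM] sf sf'; rewrite I_patch// I_patch// /Rintegral; congr fine.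
have mphi : measurable_fun setT (reflect y).
  exact: measurable_funB.
have mf' : measurable_fun setT (fun s : R => f (y - s)).
  exact: (measurableT_comp mf).
transitivity (\int[pushforward mu (reflect y)]_(x in setT) (f x)%:E)%E.
  by apply: eq_measure_integral => /= A mA _; apply/esym/lebesgue_measure_reflect.
rewrite integral_pushforward//=; first exact/measurable_EFinP.
apply: (@bm_patch (fun s => f (y - s))) => //.
by split; [exact: measurable_funTS|exists M => x _].
Qed.

(** Extension by zero from a half-open period. For |s| < 1 the periodic extension is then a sum of
    three translates of [base u], each of which can be reflected on the whole line. *)
Definition base u : R -> R := u \_ (`[- 2^-1, 2^-1[%classic).

Lemma baseE u t : - 2^-1 <= t -> t < 2^-1 -> base u t = u t.
Proof. by move=> h1 h2; rewrite /base patchE mem_set//= in_itv/= h1. Qed.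

Lemma base0 u t : (t < - 2^-1) || (2^-1 <= t) -> base u t = 0.
Proof.
move=> h; rewrite /base patchE memNset//= in_itv/=; apply/negP.
by case/orP: h => h; rewrite negb_and -?leNgt -?ltNge h ?orbT.
Qed.

Lemma measurable_base u : bm u -> measurable_fun setT (base u).
Proof.
move=> [mu_ _]; apply/(measurable_restrictT _ (measurable_itv _)).
apply: measurable_funS mu_; first exact: measurable_Ihalf.
by move=> t /=; rewrite /Ihalf /= !in_itv/= => /andP[-> /ltW ->].
Qed.

Lemma base_bounded u : bm u -> exists M : R, forall t, `|base u t| <= M.
Proof.
move=> [_ [M uM]]; exists `|M| => t; rewrite /base patchE.
case: ifPn => [|_]; last by rewrite normr0.
rewrite inE /= in_itv/= => /andP[h1 h2]; apply: le_trans (ler_norm _); apply: uM.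
by rewrite /Ihalf /= in_itv/= h1 ltW.
Qed.

Lemma per_base u s : -1 < s < 1 -> per u s = base u s + base u (s + 1) + base u (s - 1).
Proof.
move=> /andP[h1 h2]; rewrite /per.
have [ha|ha] := ltP s (- 2^-1).
  rewrite (@floor_def _ _ (-1)); last by rewrite mulrNz /= mulr1z; lra.
  rewrite (base0 u s) ?ha// (base0 u (s - 1)); last by apply/orP; left; lra.
  by rewrite baseE; [rewrite add0r addr0 mulrNz opprK mulr1z|lra|lra].
have [hb|hb] := ltP s 2^-1.
  rewrite (@floor_def _ _ 0); last by rewrite /= mulr1z mulr0z; lra.
  rewrite (base0 u (s + 1)) ?(base0 u (s - 1)); [|by apply/orP; left; lra|by apply/orP; right; lra].
  by rewrite baseE ?ha// mulr0z subr0 !addr0.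
rewrite (@floor_def _ _ 1); last by rewrite (_ : (1 + 1)%:~R = 2)// mulr1z; lra.
rewrite (base0 u s) ?hb ?orbT// (base0 u (s + 1)); last by apply/orP; right; lra.
by rewrite baseE; [rewrite !add0r mulr1z|lra|lra].
Qed.

Lemma bm_base_refl u y : bm u -> bm (fun t => base u (y - t)).
Proof.
move=> bu; have [M uM] := base_bounded _ bu; split; last by exists M => x _.
apply: measurable_funTS; apply: (measurableT_comp (measurable_base _ bu)).
exact: measurable_funB.
Qed.

Lemma Ihalf_itv (t : R) : Ihalf R t <-> - 2^-1 <= t <= 2^-1.
Proof. by rewrite /Ihalf /= in_itv. Qed.

Lemma eq_per_refl u x t : - 2^-1 < x < 2^-1 -> Ihalf R t ->
  per u (x - t) = base u (x - t) + base u (x + 1 - t) + base u (x - 1 - t).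
Proof.
move=> /andP[h1 h2] /Ihalf_itv/andP[h3 h4]; rewrite per_base; last by apply/andP; split; lra.
by congr (_ + base u _ + base u _); ring.
Qed.

Lemma bm_per_refl u x : - 2^-1 < x < 2^-1 -> bm u -> bm (fun t => per u (x - t)).
Proof.
move=> hx bu.
apply: (eq_bm (fun t => base u (x - t) + base u (x + 1 - t) + base u (x - 1 - t))).
  by move=> t It; rewrite -eq_per_refl.
by apply: bmD; [apply: bmD|]; exact: bm_base_refl.
Qed.

Definition ind (t : R) : R := \1_(Ihalf R) t.

Lemma indE t : ind t = if - 2^-1 <= t <= 2^-1 then 1 else 0.
Proof.
rewrite /ind indicE; case: ifPn => h; first by rewrite mem_set//; apply/Ihalf_itv.
by rewrite memNset// => /Ihalf_itv; exact/negP.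
Qed.

Lemma measurable_ind : measurable_fun setT ind.
Proof. by apply: measurable_indic; exact: measurable_Ihalf. Qed.

Lemma I_base_refl u k y : bm u -> measurable_fun setT k ->
  (exists M : R, forall t, `|k t| <= M) ->
  I (fun t => base u (y - t) * k t) = I (fun s => base u s * (ind (y - s) * k (y - s))).
Proof.
move=> bu mk [M kM]; have [N uN] := base_bounded _ bu.
have mb : measurable_fun setT (fun t : R => base u (y - t)).
  by apply: (measurableT_comp (measurable_base _ bu)); exact: measurable_funB.
transitivity (I (fun t => base u (y - t) * (ind t * k t))).
  by apply: eq_I => t /Ihalf_itv It; rewrite indE It mul1r.
rewrite (I_reflect _ y).
- by apply: eq_I => s _; rewrite opprB addrC subrK.
- by apply: measurable_funM => //; apply: measurable_funM => //; exact: measurable_ind.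
- exists (N * M) => t; rewrite normrM ler_pM// normrM indE.
  by case: ifP => _; rewrite ?normr1 ?normr0 ?mul1r// mul0r; apply: le_trans (kM 0).
- move=> t; apply: contra_neqP => /Ihalf_itv/negP/negbTE h.
  by rewrite indE h mul0r mulr0.
- move=> s; apply: contra_neqP => /Ihalf_itv/negP; rewrite opprB addrC subrK => h.
  by rewrite base0 ?mul0r//; move: h; rewrite negb_and -!ltNge => /orP[->//|/ltW ->]; rewrite orbT.
Qed.

(** The three translates of [base u] are reflected separately. Periodicity of k turns the three
    kernels into k (x - s), and the three indicators that remain add up to 1 on the interval. *)
Lemma per_conv u k x : bm u -> - 2^-1 < x < 2^-1 -> continuous k ->
  (forall t, k (t + 1) = k t) ->
  I (fun t => per u (x - t) * k t) = I (fun s => u s * k (x - s)).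
Proof.
move=> bu hx CauchyK pk.
have mk : measurable_fun setT k by exact: continuous_measurable_fun.
have [M kM0] : exists M : R, forall t, - 2^-1 <= t <= 2^-1 -> `|k t| <= M.
  by have [_ [M kM]] := bm_cts _ CauchyK; exists M => t /Ihalf_itv; exact: kM.
have [m Hm] : exists M : R, forall t, `|k t| <= M.
  have pkn (n : nat) t : k (t + n%:R) = k t.
    by elim: n => [|n IH]; rewrite ?addr0// -natr1 addrA pk.
  have pkz (n : int) t : k (t + n%:~R) = k t.
    case: n => n; first exact: pkn.
    by rewrite NegzE mulrNz -(pkn n.+1 (t - _)) subrK.
  exists M => t; rewrite -(pkz (- Num.floor (t + 2^-1)) t); apply: kM0.
  have := floor_itv (t + 2^-1); rewrite mulrNz intrD mulr1z => /andP[h1 h2].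
  by apply/andP; split; lra.
have bk : bm k by exact: bm_cts.
have bp := bm_base_refl u.
transitivity (I (fun t => base u (x - t) * k t + (base u (x + 1 - t) * k t
   + base u (x - 1 - t) * k t))).
  by apply: eq_I => t It; rewrite eq_per_refl//; ring.
have bpk y : bm (fun t => base u (y - t) * k t) by apply: bmM => //; exact: bp.
rewrite ID//; last exact: bmD.
rewrite ID//.
rewrite !I_base_refl//; [|by exists m..].
have bb : bm (base u).
  split; first exact: (measurable_funTS (measurable_base _ bu)).
  by have [N uN] := base_bounded _ bu; exists N => t _.
have bi y : bm (fun s => base u s * (ind (y - s) * k (y - s))).
  apply: bmM => //; split.
    apply: measurable_funTS; apply: measurable_funM.
      by apply: (measurableT_comp measurable_ind); exact: measurable_funB.
    by apply: (measurableT_comp mk); exact: measurable_funB.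
  exists m => t _; rewrite normrM indE.
  by case: ifP => _; rewrite ?normr1 ?normr0 ?mul1r// mul0r; apply: le_trans (Hm 0).
rewrite -!ID//; [|exact: bmD].
apply: eq_I_ae.
- by apply: bmD => //; exact: bmD.
- apply: bmM => //; apply: bm_cts => t.
  apply: (@continuous_comp _ _ _ (fun t => x - t) k); last exact: CauchyK.
  by apply: cvgB; [exact: cvg_cst|exact: cvg_id].
(* At 1/2 the half-open extension drops the value of u, and at x - 1/2 and x + 1/2 two of the closed
   indicators overlap; these three points are discarded. *)
have h1 := aeI_neq (2^-1 : R); have h2 := aeI_neq (x - 2^-1); have h3 := aeI_neq (x + 2^-1).
apply: aeI_imp (aeI_and _ _ h1 (aeI_and _ _ h2 h3)) => s /Ihalf_itv/andP[s1 s2] [n1 [n2 n3]].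
have s2' : s < 2^-1 by rewrite lt_neqAle n1.
rewrite baseE//.
have -> : k (x + 1 - s) = k (x - s) by rewrite -(pk (x - s)); congr k; ring.
have -> : k (x - 1 - s) = k (x - s) by rewrite -(pk (x - 1 - s)); congr k; ring.
rewrite -!mulrDr -!mulrDl !indE; congr (_ * _).
rewrite -[RHS]mul1r; congr (_ * _).
case/andP: hx => x1 x2.
have F (a b c : R) : (c < a) || (b < c) -> (a <= c <= b) = false.
  by move=> h; apply/negbTE/negP => /andP[? ?]; case/orP: h => ?; lra.
have [l1|l1] := ltP s (x - 2^-1).
  rewrite (F _ _ (x - s)) ?(F _ _ (x + 1 - s)) ?ifT; [ring|lra|apply/orP; right; lra|apply/orP; right; lra].
have l1' : x - 2^-1 < s by rewrite lt_neqAle eq_sym n2.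
have [l2|l2] := ltP s (x + 2^-1).
  rewrite (F _ _ (x - 1 - s)) ?(F _ _ (x + 1 - s)) ?ifT; [ring|lra|apply/orP; right; lra|apply/orP; left; lra].
have l2' : x + 2^-1 < s by rewrite lt_neqAle eq_sym n3.
rewrite (F _ _ (x - s)) ?(F _ _ (x - 1 - s)) ?ifT; [ring|lra|apply/orP; left; lra|apply/orP; left; lra].
Qed.

End PeriodicConvolution.

(** * Kernel estimates at Lebesgue points *)

Section LebesguePoints.
Context {R : realType}.
Implicit Types (u k phi : R -> R).
Local Notation mu := (lebesgue_measure : {measure set (measurableTypeR R) -> \bar R}).

Definition cut (rho t : R) : R := \1_(`]-rho, rho[%classic) t.

Lemma cutE rho t : cut rho t = if `|t| < rho then 1 else 0.
Proof.
rewrite /cut indicE ltr_norml; case: ifPn => h; first by rewrite mem_set//= in_itv.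
by rewrite memNset//= in_itv/=; exact/negP.
Qed.

Lemma bm_cut rho : bm (cut rho).
Proof. by apply: bm_indic; exact: measurable_itv. Qed.

Lemma cut_ge0 rho t : 0 <= cut rho t.
Proof. by rewrite cutE; case: ifP. Qed.

Lemma dyadic_bracket (d r : R) : 0 < d -> d <= r ->
  exists J : nat, 2 ^+ J * d <= r /\ r < 2 ^+ J.+1 * d.
Proof.
move=> d0 dr.
have ex : exists n, r < 2 ^+ n * d.
  exists (Num.bound (r / d)); rewrite -ltr_pdivrMr//.
  exact: upper_nthrootP.
case: (ex_minnP ex) => -[|J] hJ minJ; first by move: hJ; rewrite expr0 mul1r ltNge dr.
exists J; split => //; rewrite leNgt; apply/negP => /minJ; by rewrite ltnn.
Qed.

(** The integral is cut into |t| < d, the annuli 2^J d <= |t| < 2^(J+1) d and a remote part. On an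
    annulus |k| <= 1/(4^J d), while phi has mass at most 2^(J+2) d e there, so the contributions 4
    e/2^J form a geometric series. On the remote part |t| >= r/2, and only the decay d/t^2 of k is
    used. *)
Lemma dyadic_estimate phi k (r d e B : R) : bm phi -> bm k ->
  (forall t, Ihalf R t -> 0 <= phi t <= B) -> 0 <= e -> 0 < d -> d <= r ->
  (forall rho, 0 < rho -> rho <= r -> I (fun t => phi t * cut rho t) <= 2 * rho * e) ->
  (forall t, Ihalf R t -> `|k t| <= d^-1) ->
  (forall t, Ihalf R t -> `|k t| * t ^+ 2 <= d) ->
  I (fun t => phi t * `|k t|) <= 10 * e + 4 * B * d / r ^+ 2.
Proof.
move=> bphi bk phiB e0 d0 dr hnear k1 k2.
have bpk : bm (fun t => phi t * `|k t|) by apply: bmM => //; exact: bm_norm.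
have bpc rho : bm (fun t => phi t * cut rho t) by apply: bmM => //; exact: bm_cut.
have bpkc rho : bm (fun t => phi t * `|k t| * cut rho t) by apply: bmM => //; exact: bm_cut.
(* The factor 10 - 8/2^J starts at 2, the share of |t| < d, and grows by 4/2^J with each annulus. *)
have claim J : 2 ^+ J * d <= r ->
    I (fun t => phi t * `|k t| * cut (2 ^+ J * d) t) <= e * (10 - 8 / 2 ^+ J).
  elim: J => [|J IH] hJ.
    rewrite expr0 mul1r in hJ *; apply: (@le_trans _ _ (d^-1 * I (fun t => phi t * cut d t))).
      rewrite -IZ//; apply: le_I => //; first by apply: bmM (bm_cst _) _.
      move=> t It; have /andP[p0 _] := phiB t It.
      rewrite (_ : _ * cut d t = `|k t| * (phi t * cut d t)); last by ring.
      by rewrite ler_wpM2r ?k1// mulr_ge0 ?cut_ge0.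
    rewrite mulrC ler_pdivrMr//; apply: (le_trans (hnear _ d0 hJ)).
    by rewrite divr1; lra.
  have p2 : 0 < 2 ^+ J :> R by apply: exprn_gt0.
  have hJ' : 2 ^+ J * d <= r by apply: le_trans hJ; rewrite exprS; nra.
  have q0 : 0 < 2 ^+ J * d by exact: mulr_gt0.
  set c := (4 ^+ J * d)^-1.
  have p4 : 4 ^+ J = 2 ^+ J * 2 ^+ J :> R by rewrite -exprMn; congr (_ ^+ _); ring.
  have c0 : 0 < c by rewrite invr_gt0 p4 mulr_gt0// mulr_gt0.
  apply: (@le_trans _ _ (I (fun t => phi t * `|k t| * cut (2 ^+ J * d) t) +
      c * I (fun t => phi t * cut (2 ^+ J.+1 * d) t))).
    rewrite -IZ// -ID//; last by apply: bmM (bm_cst _) _.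
    apply: le_I => //; first by apply: bmD => //; apply: bmM (bm_cst _) _.
    move=> t It; have /andP[p0 _] := phiB t It; rewrite !cutE.
    case: (ltP `|t| (2 ^+ J * d)) => h1.
      rewrite ifT; last by apply: lt_le_trans h1 _; rewrite exprS; nra.
      by rewrite lerDl mulr_ge0 ?(ltW c0)// mulr1.
    case: ifP => _; last by rewrite !mulr0 addr0.
    rewrite !mulr1 mulr0 add0r mulrC ler_wpM2r//.
    have t2 : (2 ^+ J * d) ^+ 2 <= t ^+ 2.
      by rewrite -[leRHS]real_normK ?num_real// ler_sqr ?nnegrE ?(ltW q0).
    have tp : 0 < t ^+ 2 by apply: lt_le_trans t2; rewrite exprn_gt0.
    apply: (@le_trans _ _ (d / t ^+ 2)); first by rewrite ler_pdivlMr//; exact: k2.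
    rewrite ler_pdivrMr// /c p4.
    apply: (@le_trans _ _ ((2 ^+ J * 2 ^+ J * d)^-1 * (2 ^+ J * d) ^+ 2)).
      by rewrite le_eqVlt; apply/orP; left; apply/eqP; field; rewrite !gt_eqF.
    by apply: ler_wpM2l => //; rewrite -p4; exact: ltW.
  apply: (le_trans (lerD (IH hJ') (ler_wpM2l (ltW c0) (hnear _ (mulr_gt0 (exprn_gt0 _ _) d0) hJ)))) => //.
  rewrite /c p4 exprS le_eqVlt; apply/orP; left; apply/eqP; field.
  by rewrite !gt_eqF.
have [J [J1 J2]] := dyadic_bracket _ _ d0 dr.
have r0 : 0 < r by exact: lt_le_trans d0 dr.
have B0 : 0 <= B.
  have I0 : Ihalf R 0 by apply/Ihalf_itv/andP; split; lra.
  by have /andP[] := phiB 0 I0; exact: le_trans.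
apply: (@le_trans _ _ (I (fun t => phi t * `|k t| * cut (2 ^+ J * d) t + 4 * B * d / r ^+ 2))).
  apply: le_I => //; first by apply: bmD => //; exact: bm_cst.
  move=> t It; have /andP[p0 pB] := phiB t It; rewrite cutE.
  case: ifPn => [_|]; first by rewrite mulr1 lerDl divr_ge0 ?exprn_ge0 ?mulr_ge0 ?(ltW r0) ?(ltW d0).
  rewrite -leNgt mulr0 add0r => h1.
  have q0 : 0 < 2 ^+ J * d by rewrite mulr_gt0// exprn_gt0.
  have h2 : r / 2 <= `|t| by apply: le_trans h1; move: J2; rewrite exprS; lra.
  have t2 : (r / 2) ^+ 2 <= t ^+ 2.
    by rewrite -[leRHS]real_normK ?num_real// ler_sqr ?nnegrE ?divr_ge0// ltW.
  have tp : 0 < t ^+ 2 by apply: lt_le_trans t2; rewrite exprn_gt0// divr_gt0.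
  have kk : `|k t| <= 4 * d / r ^+ 2.
    rewrite -(ler_pM2r tp); apply: (le_trans (k2 t It)).
    have -> : 4 * d / r ^+ 2 * t ^+ 2 = d * (t ^+ 2 / (r / 2) ^+ 2) by field; rewrite gt_eqF.
    by rewrite ler_peMr ?(ltW d0)// ler_pdivlMr ?mul1r// exprn_gt0// divr_gt0.
  apply: (le_trans (ler_pM _ _ pB kk)) => //.
  by rewrite le_eqVlt; apply/orP; left; apply/eqP; ring.
rewrite ID ?I_cst//; last exact: bm_cst.
rewrite lerD2r; apply: (le_trans (claim _ J1)).
rewrite mulrC ler_wpM2r// gerBl divr_ge0// exprn_ge0//.
Qed.

Definition leb_pt u x := - 2^-1 < x < 2^-1 /\ lebesgue_pt (base u) x.

Lemma leb_pt_ae u : bm u -> aeI (leb_pt u).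
Proof.
move=> bu.
have h : locally_integrable setT (base u).
  apply: integrable_locally_restrict; first exact: measurable_itv.
  have := bm_integrable bu; apply: integrableS.
  - exact: measurable_Ihalf.
  - exact: measurable_itv.
  - by move=> t /=; rewrite /Ihalf /= !in_itv/= => /andP[-> /ltW ->].
have h1 := aeI_neq (2^-1 : R); have h2 := aeI_neq (- 2^-1 : R).
apply: aeI_imp (aeI_and _ _ (ae_aeI _ (lebesgue_differentiation h)) (aeI_and _ _ h1 h2)).
move=> x /Ihalf_itv/andP[x1 x2] [lp [n1 n2]]; split => //.
by rewrite !lt_neqAle x1 x2 n1 eq_sym n2.
Qed.

Lemma leb_pt_near u x : bm u -> leb_pt u x -> forall e : R, 0 < e ->
  exists2 r : R, 0 < r & forall rho, 0 < rho -> rho <= r ->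
    I (fun t => `|per u (x - t) - u x| * cut rho t) <= 2 * rho * e.
Proof.
move=> bu [/andP[x1 x2] lp] e e0.
move: lp => /fine_cvgP[fin /cvgrPdist_le /(_ e e0) lp].
have [r0 /= r00 H0] := fin; have [r1 /= r10 H1] := lp.
(* Up to this radius the averages are finite and at most e, and the ball around x stays inside the
   interval; halving makes the inequalities strict. *)
pose r := Num.min (Num.min (r0 / 2) (r1 / 2)) (Num.min ((x + 2^-1) / 2) ((2^-1 - x) / 2)).
have rp : 0 < r by rewrite !lt_min !divr_gt0//; lra.
exists r => // rho rho0 rhor.
have : [/\ rho < r0, rho < r1, rho < x + 2^-1 & rho < 2^-1 - x].
  move: rhor; rewrite !le_min => /andP[/andP[? ?] /andP[? ?]]; split; lra.
move=> [c0 c1 c2 c3].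
have := H0 rho; have := H1 rho; rewrite /= sub0r !normrN gtr0_norm// => /(_ c1 rho0) h1 /(_ c0 rho0) h0.
move: h1; rewrite sub0r normrN ger0_norm; last by apply: fine_ge0; exact: davg_ge0.
rewrite -lee_fin fineK// /davg /iavg lebesgue_measure_ball; last exact: ltW.
have rho2 : rho *+ 2 = 2 * rho by rewrite mulr_natl.
rewrite inver ifF; last by rewrite rho2 gt_eqF// mulr_gt0.
rewrite lee_pdivrMl; last by rewrite rho2 mulr_gt0.
pose f y := `|base u y - base u x| * cut rho (x - y).
have [M uM] := base_bounded _ bu.
have mf : measurable_fun setT f.
  apply: measurable_funM.
    apply: measurableT_comp => //; apply: measurable_funB => //; exact: measurable_base.
  apply: (@measurableT_comp _ _ _ _ _ _ (cut rho)); first by apply: measurable_indic; exact: measurable_itv.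
  exact: measurable_funB.
have fM t : `|f t| <= M + M.
  rewrite /f normrM cutE normr_id; case: ifP => _; last first.
    by rewrite normr0 mulr0; apply: le_trans (lerD (uM t) (uM t)); rewrite addr_ge0.
  by rewrite normr1 mulr1; apply: (le_trans (ler_normB _ _)); exact: lerD.
have sf t : f t != 0 -> Ihalf R t.
  apply: contra_neqP => /Ihalf_itv/negP h; rewrite /f cutE ifF ?mulr0//.
  apply/negbTE; rewrite -leNgt ler_normr.
  by move: h; rewrite negb_and -!ltNge => /orP[h|h]; apply/orP; [left|right]; lra.
have bf : bm f by split; [exact: measurable_funTS|exists (M + M) => t _].
have -> : (\int[Leb R]_(y in ball x rho) `|((center (base u x) \o base u) y)%:E|)%E = (I f)%:E.
  rewrite -(EFin_I _ bf) [LHS]integral_mkcond [RHS]integral_mkcond; apply: eq_integral => t _.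
  have [h|h] := ltP `|x - t| rho.
    have ft : f t = `|base u t - base u x| by rewrite /f cutE h mulr1.
    rewrite !patchE ifT; last by rewrite inE.
    rewrite ifT ?ft//; rewrite mem_set//; apply/Ihalf_itv.
    by move: h; rewrite ltr_norml => /andP[? ?]; apply/andP; split; lra.
  rewrite !patchE ifF; last first.
    by apply/negbTE; rewrite notin_setE => h'; move: h; rewrite leNgt => /negP; apply.
  by case: ifP => // _; rewrite /f cutE ifF ?mulr0//; apply/negbTE; rewrite -leNgt.
rewrite -EFinM lee_fin rho2; apply: le_trans; rewrite le_eqVlt; apply/orP; left; apply/eqP.
rewrite [RHS](I_reflect _ x)//; last 2 first.
- by exists (M + M).
- move=> s; apply: contra_neqP => /Ihalf_itv/negP h; rewrite /f cutE ifF ?mulr0//.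
  apply/negbTE; rewrite -leNgt ler_normr opprB addrC subrK.
  by move: h; rewrite negb_and -!ltNge => /orP[h|h]; apply/orP; [right|left]; lra.
apply: eq_I => t It; rewrite /f (_ : x - (x - t) = t); last by ring.
rewrite !cutE; case: ifPn => h; last by rewrite !mulr0.
rewrite !mulr1; move: h; rewrite ltr_norml => /andP[? ?].
rewrite (baseE u x) ?(ltW x1)// per_base; last by apply/andP; split; lra.
rewrite (base0 u (_ + 1)) ?(base0 u (_ - 1)) ?addr0//; [by apply/orP; left; lra|by apply/orP; right; lra].
Qed.

(** The common tool for the Poisson kernel, for the truncated cotangent minus the conjugate Poisson
    kernel, and for the Fejer kernel with d = 1/N. *)
Lemma leb_pt_kernel u x (C : R) : bm u -> leb_pt u x -> 0 < C -> forall e : R, 0 < e ->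
  exists2 d0 : R, 0 < d0 & forall (d : R) k, 0 < d -> d < d0 -> bm k ->
    (forall t, Ihalf R t -> `|k t| <= C / d) ->
    (forall t, Ihalf R t -> `|k t| * t ^+ 2 <= C * d) ->
    I (fun t => `|per u (x - t) - u x| * `|k t|) <= e.
Proof.
move=> bu lp C0 e e0.
have x12 : - 2^-1 < x < 2^-1 by case: lp.
(* After division by C the near part costs 10 e1, which is half of e/C; the choice of [d0] below
   keeps the remote part within the other half. *)
pose e1 := e / C / 20.
have e10 : 0 < e1 by rewrite !divr_gt0.
have [r r0 hr] := leb_pt_near _ _ bu lp _ e10.
have bp : bm (fun t => `|per u (x - t) - u x|).
  apply: bm_norm; apply: bmB; [exact: bm_per_refl|exact: bm_cst].
have [_ [B hB]] := bp.
have B0 : 0 <= `|B| by [].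
pose d0 := Num.min r (e * r ^+ 2 / (8 * C * (`|B| + 1))).
have q0 : 0 < 8 * C * (`|B| + 1) by rewrite !mulr_gt0// ltr_wpDl.
exists d0; first by rewrite lt_min r0 divr_gt0// mulr_gt0// exprn_gt0.
move=> d k dp; rewrite lt_min => /andP[dr dd] bk k1 k2.
pose k' := fun t => C^-1 * k t.
have bk' : bm k' by apply: bmM (bm_cst _) _.
have ek' t : `|k' t| = C^-1 * `|k t| by rewrite /k' normrM gtr0_norm// invr_gt0.
have E : I (fun t => `|per u (x - t) - u x| * `|k t|) =
    C * I (fun t => `|per u (x - t) - u x| * `|k' t|).
  rewrite -IZ; last by apply: bmM => //; exact: bm_norm.
  by apply: eq_I => t _; rewrite ek'; field; rewrite gt_eqF.
rewrite E mulrC -ler_pdivlMr//.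
have := dyadic_estimate _ _ r d e1 `|B| bp bk' _ (ltW e10) dp (ltW dr) hr.
move=> h; apply: le_trans (h _ _ _) _.
- move=> t It; rewrite normr_ge0 /=; apply: le_trans (ler_norm B).
  by apply: le_trans (hB t It); rewrite normr_id.
- by move=> t It; rewrite ek' mulrC ler_pdivrMr// mulrC; exact: k1.
- by move=> t It; rewrite ek' -mulrA ler_pdivrMl//; exact: k2.
have -> : e / C = 10 * e1 + e / C / 2 by rewrite /e1; field; rewrite gt_eqF.
rewrite lerD2l ler_pdivrMr ?exprn_gt0//.
have -> : e / C / 2 * r ^+ 2 = 4 * (`|B| + 1) * (e * r ^+ 2 / (8 * C * (`|B| + 1))).
  by field; rewrite gt_eqF//= gt_eqF// ltr_wpDl.
apply: ler_pM; rewrite ?mulr_ge0 ?(ltW dp) ?(ltW dd)//.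
by rewrite ler_pM2l// lerDl.
Qed.

End LebesguePoints.

(** * Polynomials on the circle, Cauchy integrals and functions analytic in the disc *)

Section Circle.
Context {R : realType}.
Notation C := R[i].
Implicit Types (z w : C) (f g h : R -> C) (p q c : {poly C}).

Lemma expiD (s t : R) : expi (s + t) = expi s * expi t.
Proof. by apply: complexP; rewrite !ReImE /= ?cosD ?sinD//; ring. Qed.
Lemma expi0 : expi (0 : R) = 1. Proof. by rewrite /expi cos0 sin0. Qed.
Lemma expiN (t : R) : expi (- t) = (expi t)^~*.
Proof. by rewrite /expi cosN sinN. Qed.
Lemma csq_expi (t : R) : csq (expi t) = 1.
Proof. by rewrite /csq /= cos2Dsin2. Qed.
Lemma cabs_expi (t : R) : cabs (expi t) = 1.
Proof. by rewrite /cabs csq_expi sqrtr1. Qed.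
Lemma expi_conjM (t : R) : expi t * (expi t)^~* = 1.
Proof. by rewrite -csqE csq_expi. Qed.
Definition cir (x : R) : C := expi (2 * pi * x).

Lemma cirD x y : cir (x + y) = cir x * cir y. Proof. by rewrite /cir mulrDr expiD. Qed.
Lemma cir0 : cir 0 = 1. Proof. by rewrite /cir mulr0 expi0. Qed.
Lemma cirN x : cir (- x) = (cir x)^~*. Proof. by rewrite /cir mulrN expiN. Qed.
Lemma cabs_cir x : cabs (cir x) = 1. Proof. exact: cabs_expi. Qed.
Lemma csq_cir x : csq (cir x) = 1. Proof. exact: csq_expi. Qed.
Lemma cir_conjM x : cir x * (cir x)^~* = 1. Proof. exact: expi_conjM. Qed.
Lemma cir_conjMX x n : cir x ^+ n * (cir x)^~* ^+ n = 1.
Proof. by rewrite -exprMn cir_conjM expr1n. Qed.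
Lemma cir1 : cir 1 = 1.
Proof. by rewrite /cir mulr1 mulr_natl /expi cos2pi sin2pi. Qed.
Lemma cir_periodic x : cir (x + 1) = cir x. Proof. by rewrite cirD cir1 mulr1. Qed.
Lemma cirX x n : cir x ^+ n = cir (n%:R * x).
Proof.
elim: n => [|n IH]; first by rewrite mul0r cir0.
by rewrite exprS IH -cirD; congr cir; rewrite -natr1; ring.
Qed.

Lemma cts_scale (a : R) : continuous (fun x : R => a * x).
Proof. by move=> x; apply: cvgM; [exact: cvg_cst|exact: cvg_id]. Qed.

Lemma cts_Re_cir : continuous (fun x => complex.Re (cir x)).
Proof. move=> x; apply: continuous_comp; [exact: cts_scale|exact: continuous_cos]. Qed.
Lemma cts_Im_cir : continuous (fun x => complex.Im (cir x)).
Proof. move=> x; apply: continuous_comp; [exact: cts_scale|exact: continuous_sin]. Qed.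

Lemma cbm_cir : cbm cir.
Proof. by split; apply: bm_cts; [exact: cts_Re_cir|exact: cts_Im_cir]. Qed.

Definition ev p (x : R) : C := p.[cir x].

Lemma cbm_horner p f : cbm f -> cbm (fun x => p.[f x]).
Proof.
move=> bf; under eq_fun do rewrite horner_coef.
by apply: cbm_sum => i; apply: cbmM (cbm_cst _) _; exact: cbmX.
Qed.

Lemma cbm_ev p : cbm (ev p). Proof. by apply: cbm_horner; exact: cbm_cir. Qed.

Lemma bmV (f : R -> R) (a : R) : bm f -> 0 < a -> (forall x, Ihalf R x -> a <= f x) ->
  bm (fun x => (f x)^-1).
Proof.
move=> bf a0 af.
(* The maximum does not change f on the interval and makes the reciprocal a continuous function of
   the value on the whole line. *)
apply: (eq_bm (fun x => (Num.max a (f x))^-1)).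
  by move=> x Ix; rewrite maxEle af.
apply: (bm_comp _ (fun y => (Num.max a y)^-1)) => // y.
apply: cvgV; first by rewrite gt_eqF// lt_max a0.
by apply: continuous_max; [exact: cvg_cst|exact: cvg_id].
Qed.

Lemma cbmV f (a : R) : cbm f -> 0 < a -> (forall x, Ihalf R x -> a <= csq (f x)) ->
  cbm (fun x => (f x)^-1).
Proof.
move=> bf a0 af.
apply: (eq_cbm (fun x => ((csq (f x))^-1)%:C * (f x)^~*)).
  move=> x Ix; have c0 : csq (f x) != 0 by rewrite gt_eqF// (lt_le_trans a0)// af.
  have f0 : f x != 0 by rewrite -csq_eq0.
  apply: (mulfI f0); rewrite divff// mulrCA -csqE -rmorphM mulVf//.
apply: cbmM; last exact: cbm_conj.
by apply: cbm_rc; apply: bmV a0 af; exact: bm_csq.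
Qed.

Lemma bm_reflect_cts (k : R -> R) (x : R) : continuous k -> bm (fun s => k (x - s)).
Proof.
move=> CauchyK; apply: bm_cts => t.
apply: (@continuous_comp _ _ _ (fun t : R => x - t) k); last exact: CauchyK.
by apply: cvgB; [exact: cvg_cst|exact: cvg_id].
Qed.

Lemma I_periodic (k : R -> R) (x : R) : - 2^-1 < x < 2^-1 -> continuous k ->
  (forall t, k (t + 1) = k t) -> I (fun s => k (x - s)) = I k.
Proof.
move=> hx CauchyK pk; have := per_conv (fun=> 1) k x (bm_cst 1) hx CauchyK pk.
rewrite /per => E; transitivity (I (fun s => 1 * k (x - s))).
  by apply: eq_I => s _; rewrite mul1r.
by rewrite -E; apply: eq_I => s _; rewrite mul1r.
Qed.

(** For a positive power, translation invariance gives z(x)^(n+1) conj(c) = c for the integral c. At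
    x = 0 this says that c is real, and at x = 1/(4(n+1)) that i c = c. *)
Lemma CI_cirX n : CI (fun x => cir x ^+ n) = (n == 0%N)%:R.
Proof.
case: n => [|n]; first by rewrite -[RHS](CI_cst 1).
set c := CI _; have bf : cbm (fun x => cir x ^+ n.+1) by apply: cbmX; exact: cbm_cir.
have n0 : (0 : R) < n.+1%:R by [].
have cR : continuous (fun x => complex.Re (cir x ^+ n.+1)).
  under eq_fun do rewrite cirX; move=> x.
  apply: (@continuous_comp _ _ _ (fun x : R => n.+1%:R * x) (fun x => complex.Re (cir x))).
    exact: cts_scale.
  exact: cts_Re_cir.
have cI : continuous (fun x => complex.Im (cir x ^+ n.+1)).
  under eq_fun do rewrite cirX; move=> x.
  apply: (@continuous_comp _ _ _ (fun x : R => n.+1%:R * x) (fun x => complex.Im (cir x))).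
    exact: cts_scale.
  exact: cts_Im_cir.
have key x : - 2^-1 < x < 2^-1 -> cir x ^+ n.+1 * c^~* = c.
  move=> hx; transitivity (cir x ^+ n.+1 * CI (fun x => (cir x ^+ n.+1)^~*)).
    by rewrite CI_conj.
  rewrite -CIZ; last exact: cbm_conj.
  transitivity (CI (fun s => cir (x - s) ^+ n.+1)).
    by apply: eq_CI => s _; rewrite cirD cirN exprMn conjcX.
  apply: complexP.
    by apply: (I_periodic (fun x => complex.Re (cir x ^+ n.+1)) _ hx cR) => t; rewrite cir_periodic.
  by apply: (I_periodic (fun x => complex.Im (cir x ^+ n.+1)) _ hx cI) => t; rewrite cir_periodic.
have c1 : c^~* = c.
  by have := key 0; rewrite cir0 expr1n mul1r; apply; rewrite oppr_lt0 invr_gt0 ltr0n.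
apply/eqP/negPn/negP => cn0.
have h := key ((4 * n.+1%:R)^-1); rewrite c1 cirX in h.
have : cir (n.+1%:R * (4 * n.+1%:R)^-1) * c = 1 * c.
  rewrite mul1r; apply: h; rewrite (@lt_trans _ _ 0) ?oppr_lt0 ?invr_gt0 ?mulr_gt0 ?ltr0n//=.
  rewrite ltf_pV2 ?posrE ?mulr_gt0 ?ltr0n//.
  by have h1 : 1 <= n.+1%:R :> R by [rewrite ler1n]; lra.
move/(mulIf cn0).
rewrite (_ : n.+1%:R * _ = 4^-1 :> R); last by field; rewrite gt_eqF.
rewrite /cir (_ : 2 * pi * _ = pi / 2 :> R); last by field.
by rewrite /expi cos_pihalf sin_pihalf => /(congr1 (@complex.Re R)) /= /esym/eqP; rewrite oner_eq0.
Qed.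

Lemma CI_ev p : CI (ev p) = p`_0.
Proof.
rewrite (eq_CI _ (fun x => \sum_(i < size p) p`_i * cir x ^+ i)); last first.
  by move=> x _; rewrite /ev horner_coef.
rewrite CI_sum; last by move=> i; apply: cbmM (cbm_cst _) _; apply: cbmX; exact: cbm_cir.
rewrite (eq_bigr (fun i : 'I_(size p) => p`_i * (i == 0%N :> nat)%:R)); last first.
  by move=> i _; rewrite CIZ ?CI_cirX//; apply: cbmX; exact: cbm_cir.
have [->|p0] := eqVneq p 0; first by rewrite size_poly0 big_ord0 coef0.
have := size_poly_gt0 p; rewrite p0; case E : (size p) => [//|n] _; rewrite big_ord_recl/= mulr1 big1 ?addr0// => i _.
by rewrite mulr0.
Qed.

Lemma CI_cir_ev p : CI (fun x => cir x * ev p x) = 0.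
Proof.
rewrite (eq_CI _ (ev ('X * p))); first by rewrite CI_ev coefXM.
by move=> x _; rewrite /ev hornerM hornerX.
Qed.

Lemma CI_ev_conjX p n : CI (fun x => ev p x * (cir x)^~* ^+ n) = p`_n.
Proof.
elim: n p => [|n IH] p.
  by rewrite -CI_ev; apply: eq_CI => x _; rewrite expr0 mulr1.
have [q [a ->]] : exists q a, p = q * 'X + a%:P.
  by elim/poly_ind: p => [|q a _]; [exists 0, 0; rewrite mul0r add0r|exists q, a].
rewrite coefD coefMX coefC /= addr0.
have bc k : cbm (fun x => (cir x)^~* ^+ k) by apply: cbmX; apply: cbm_conj; exact: cbm_cir.
transitivity (CI (fun x => ev q x * (cir x)^~* ^+ n + a * (cir x)^~* ^+ n.+1)).
  apply: eq_CI => x _; rewrite /ev hornerMXaddC exprS.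
  have aux (y z zb b : C) : z * zb = 1 ->
    (y * z + b) * (zb * zb ^+ n) = y * zb ^+ n + b * (zb * zb ^+ n).
    by move=> E; rewrite mulrDl; congr (_ + _); rewrite -mulrA [z * _]mulrA E mul1r.
  exact: aux (cir_conjM x).
rewrite CID; [|by apply: cbmM => //; exact: cbm_ev|exact: cbmM (cbm_cst _) _].
rewrite IH CIZ// (eq_CI _ (fun x => (cir x ^+ n.+1)^~*)); last by move=> x _; rewrite conjcX.
rewrite CI_conj; last by apply: cbmX; exact: cbm_cir.
have -> : CI (fun x => cir x ^+ n.+1) = 0 by rewrite CI_cirX.
by rewrite conjc0 mulr0 addr0.
Qed.

Lemma Parseval p : I (fun x => csq (ev p x)) = \sum_(i < size p) csq p`_i.
Proof.
rewrite I_csqE; last exact: cbm_ev.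
rewrite (eq_CI _ (fun x => \sum_(i < size p) (p`_i)^~* * (ev p x * (cir x)^~* ^+ i))); last first.
  move=> x _; rewrite {2}/ev horner_coef rmorph_sum /= mulr_sumr; apply: eq_bigr => i _.
  by rewrite conjcM conjcX; ring.
have b i : cbm (fun x => ev p x * (cir x)^~* ^+ i).
  by apply: cbmM; [exact: cbm_ev|apply: cbmX; apply: cbm_conj; exact: cbm_cir].
rewrite CI_sum; last by move=> i; exact: cbmM (cbm_cst _) _.
rewrite raddf_sum; apply: eq_bigr => i _.
by rewrite CIZ// CI_ev_conjX mulrC -csqE.
Qed.

(** With zeta = [cir t] this is zeta/(zeta - w), and dt is d zeta/(2 pi i zeta); so [CauchyT] is the
    Cauchy integral over the unit circle. *)
Definition CauchyK w (t : R) : C := (1 - w * (cir t)^~*)^-1.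
Definition CauchyT (u : R -> C) w : C := CI (fun t => u t * CauchyK w t).

Lemma cabs_wcir w t : cabs (w * (cir t)^~*) = cabs w.
Proof. by rewrite cabsM cabs_conj cabs_cir mulr1. Qed.

Lemma ck_den w t : 1 - cabs w <= cabs (1 - w * (cir t)^~*).
Proof. by rewrite -{1}(cabs_wcir w t) -[X in X - _]cabs1; exact: cabs_lerB. Qed.

Lemma ck_neq0 w t : cabs w < 1 -> 1 - w * (cir t)^~* != 0.
Proof. by move=> w1; rewrite -cabs_gt0; apply: lt_le_trans (ck_den _ _); rewrite subr_gt0. Qed.

Lemma cabs_ck w t : cabs w < 1 -> cabs (CauchyK w t) <= (1 - cabs w)^-1.
Proof.
move=> w1; rewrite /CauchyK cabsV lef_pV2 ?posrE ?subr_gt0//; first exact: ck_den.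
by rewrite cabs_gt0 ck_neq0.
Qed.

Lemma cbm_ck w : cabs w < 1 -> cbm (CauchyK w).
Proof.
move=> w1; apply: (cbmV _ ((1 - cabs w) ^+ 2)).
- by apply: cbmB (cbm_cst _) _; apply: cbmM (cbm_cst _) _; apply: cbm_conj; exact: cbm_cir.
- by rewrite exprn_gt0// subr_gt0.
- by move=> x _; rewrite -sqr_cabs ler_sqr ?nnegrE ?cabs_ge0 ?subr_ge0 ?(ltW w1)//; exact: ck_den.
Qed.

Lemma ck_geom w t n : cabs w < 1 ->
  CauchyK w t - \sum_(i < n) (w * (cir t)^~*) ^+ i = (w * (cir t)^~*) ^+ n * CauchyK w t.
Proof.
move=> w1; have d0 := ck_neq0 _ t w1; apply: (mulfI d0).
rewrite mulrBr /CauchyK divff// mulrCA divff// mulr1.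
by rewrite -(subrK 1 ((w * (cir t)^~*) ^+ n)) subrX1; ring.
Qed.

Lemma ck_geom_le w (r : R) t n : cabs w <= r -> r < 1 ->
  cabs (CauchyK w t - \sum_(i < n) (w * (cir t)^~*) ^+ i) <= r ^+ n / (1 - r).
Proof.
move=> wr r1; have w1 : cabs w < 1 by exact: le_lt_trans r1.
rewrite ck_geom// cabsM cabsX cabs_wcir.
apply: ler_pM; rewrite ?exprn_ge0 ?cabs_ge0//.
  by apply: lerXn2r => //; rewrite nnegrE ?cabs_ge0// (le_trans _ wr)// cabs_ge0.
apply: (le_trans (cabs_ck _ _ w1)); rewrite lef_pV2 ?posrE ?subr_gt0//.
by rewrite lerD2l lerN2.
Qed.

Lemma small_pow (r e : R) : 0 <= r -> r < 1 -> 0 < e -> exists n, r ^+ n <= e.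
Proof.
move=> r0 r1 e0.
have h : r ^+ n @[n --> \oo] --> (0 : R) by apply: cvg_expr; rewrite ger0_norm.
have /cvgrPdist_le /(_ e e0) [N _ hN] := h.
by exists N; have := hN N (leqnn N); rewrite /= sub0r normrN ger0_norm// exprn_ge0.
Qed.

(** Holomorphy in the unit disc expressed through polynomial approximation on smaller discs. The
    class is stable under products, exponentials and locally uniform limits, and identities pass to
    it from polynomials without power series or complex derivatives. *)
Definition analytic (F : C -> C) := forall (r e : R), 0 <= r -> r < 1 -> 0 < e ->
  exists p, forall w, cabs w <= r -> cabs (F w - p.[w]) <= e.

(** Integrating the partial sums of the geometric series of the kernel against u gives the
    approximating polynomials. *)
Lemma analytic_CT u : cbm u -> analytic (CauchyT u).
Proof.
move=> bu r e r0 r1 e0; have [M M0 uM] := cbm_bounded _ bu.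
have q0 : 0 < e * (1 - r) / (M + 1) by rewrite divr_gt0 ?mulr_gt0 ?subr_gt0// ltr_wpDl.
have [n pnorm2] := small_pow _ _ r0 r1 q0.
have bc i : cbm (fun t => u t * (cir t)^~* ^+ i).
  by apply: cbmM => //; apply: cbmX; apply: cbm_conj; exact: cbm_cir.
exists (\poly_(i < n) CI (fun t => u t * (cir t)^~* ^+ i)) => w wr.
have w1 : cabs w < 1 by exact: le_lt_trans r1.
rewrite horner_poly (eq_bigr (fun i : 'I_n => CI (fun t => w ^+ i * (u t * (cir t)^~* ^+ i)))); last first.
  by move=> i _; rewrite CIZ// mulrC.
rewrite -CI_sum; last by move=> i; exact: cbmM (cbm_cst _) _.
have b1 := cbm_ck _ w1.
rewrite /CauchyT -CIB; [|exact: cbmM|by apply: cbm_sum => i; exact: cbmM (cbm_cst _) _].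
apply: CI_bound.
  by apply: cbmB; [exact: cbmM|apply: cbm_sum => i; exact: cbmM (cbm_cst _) _].
move=> t It; rewrite (_ : _ - _ = u t * (CauchyK w t - \sum_(i < n) (w * (cir t)^~*) ^+ i)); last first.
  rewrite mulrBr; congr (_ - _); rewrite mulr_sumr; apply: eq_bigr => i _.
  by rewrite exprMn; ring.
rewrite cabsM; apply: (@le_trans _ _ ((M + 1) * (r ^+ n / (1 - r)))).
  apply: ler_pM; rewrite ?cabs_ge0//; last exact: ck_geom_le.
  by apply: (le_trans (uM t It)); rewrite lerDl.
rewrite mulrA ler_pdivrMr ?subr_gt0// mulrC -ler_pdivlMr//; last by rewrite ltr_wpDl.
Qed.

Lemma analytic_bounded F r : analytic F -> 0 <= r -> r < 1 ->
  exists2 M : R, 0 <= M & forall w, cabs w <= r -> cabs (F w) <= M.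
Proof.
move=> aF r0 r1; have [p hp] := aF r 1 r0 r1 ltr01.
exists (1 + \sum_(i < size p) cabs p`_i).
  by rewrite addr_ge0// sumr_ge0// => i _; exact: cabs_ge0.
move=> w wr; rewrite -[F w](subrK p.[w]); apply: (le_trans (cabsD _ _)).
apply: lerD; first exact: hp.
rewrite horner_coef; apply: (le_trans (cabs_sum _ _ _)).
apply: ler_sum => i _; rewrite cabsM ler_piMr ?cabs_ge0// cabsX exprn_ile1 ?cabs_ge0//.
by apply: (le_trans wr); exact: ltW.
Qed.

Lemma analytic_cst z : analytic (fun=> z).
Proof. by move=> r e _ _ e0; exists z%:P => w _; rewrite hornerC subrr cabs0 ltW. Qed.

Lemma analytic_horner p : analytic (fun w => p.[w]).
Proof. by move=> r e _ _ e0; exists p => w _; rewrite subrr cabs0 ltW. Qed.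

Lemma eq_analytic F G : (forall w, cabs w < 1 -> F w = G w) -> analytic F -> analytic G.
Proof.
move=> FG aF r e r0 r1 e0; have [p hp] := aF r e r0 r1 e0.
by exists p => w wr; rewrite -FG; [exact: hp|exact: le_lt_trans r1].
Qed.

Lemma analyticD F G : analytic F -> analytic G -> analytic (fun w => F w + G w).
Proof.
move=> aF aG r e r0 r1 e0; have e2 : 0 < e / 2 by rewrite divr_gt0.
have [p hp] := aF r _ r0 r1 e2; have [q hq] := aG r _ r0 r1 e2.
exists (p + q) => w wr; rewrite hornerD opprD addrACA.
by apply: (le_trans (cabsD _ _)); rewrite [e]splitr; apply: lerD; [exact: hp|exact: hq].
Qed.

Lemma analyticM F G : analytic F -> analytic G -> analytic (fun w => F w * G w).
Proof.
move=> aF aG r e r0 r1 e0.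
have [M M0 hM] := analytic_bounded _ _ aG r0 r1.
have e2 : 0 < e / 2 / (M + 1) by rewrite !divr_gt0// ltr_wpDl.
have [p hp] := aF r _ r0 r1 e2.
(* The tolerance for q depends on a bound of p, so q is chosen after p. *)
have [N N0 hN] := analytic_bounded _ _ (analytic_horner p) r0 r1.
have e3 : 0 < e / 2 / (N + 1) by rewrite !divr_gt0// ltr_wpDl.
have [q hq] := aG r _ r0 r1 e3.
exists (p * q) => w wr; rewrite hornerM.
rewrite (_ : _ - _ = (F w - p.[w]) * G w + p.[w] * (G w - q.[w])); last by ring.
apply: (le_trans (cabsD _ _)); rewrite [e]splitr !cabsM; apply: lerD.
  apply: (@le_trans _ _ (e / 2 / (M + 1) * (M + 1))).
    apply: ler_pM; rewrite ?cabs_ge0 ?hp//; apply: (le_trans (hM w wr)); rewrite lerDl//.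
  by rewrite divfK// gt_eqF// ltr_wpDl.
apply: (@le_trans _ _ ((N + 1) * (e / 2 / (N + 1)))).
  apply: ler_pM; rewrite ?cabs_ge0 ?hq//; apply: (le_trans (hN w wr)); rewrite lerDl//.
by rewrite mulrC divfK// gt_eqF// ltr_wpDl.
Qed.

Lemma analyticX F n : analytic F -> analytic (fun w => F w ^+ n).
Proof.
move=> aF; elim: n => [|n IH]; first exact: analytic_cst.
by apply: eq_analytic (analyticM _ _ aF IH) => w _; rewrite exprS.
Qed.

Lemma analytic_unif F : (forall (r e : R), 0 <= r -> r < 1 -> 0 < e ->
  exists2 G, analytic G & forall w, cabs w <= r -> cabs (F w - G w) <= e) -> analytic F.
Proof.
move=> H r e r0 r1 e0; have e2 : 0 < e / 2 by rewrite divr_gt0.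
have [G aG FG] := H r _ r0 r1 e2; have [p hp] := aG r _ r0 r1 e2.
exists p => w wr; rewrite -[F w](subrK (G w)) -addrA.
by apply: (le_trans (cabsD _ _)); rewrite [e]splitr; apply: lerD; [exact: FG|exact: hp].
Qed.

(** This is how an analytic function restricted to a circle is seen to be bounded and measurable: it
    is a uniform limit of polynomials there. *)
Lemma cbm_unif f : (forall e : R, 0 < e ->
  exists2 h, cbm h & forall x, Ihalf R x -> cabs (f x - h x) <= e) -> cbm f.
Proof.
move=> H.
have /choice [h hh] : forall n : nat, exists h, cbm h /\
    forall x, Ihalf R x -> cabs (f x - h x) <= n.+1%:R^-1.
  by move=> n; have [h ? ?] := H n.+1%:R^-1 (ltac:(by [])); exists h.
have cv x : Ihalf R x -> cabs (f x - h n x) @[n --> \oo] --> 0.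
  move=> Ix; apply: (@squeeze_cvgr _ _ _ _ (fun=> 0) (fun n => n.+1%:R^-1)).
  - by apply: nearW => n; rewrite cabs_ge0 (hh n).2.
  - exact: cvg_cst.
  - exact: cvg_harmonic.
have [h0 b0 hb0] := H 1 ltr01; have [M M0 hM] := cbm_bounded _ b0.
have cvr (P : C -> R) : (forall z, `|P z| <= cabs z) -> (forall z w, P (z - w) = P z - P w) ->
    forall x, Ihalf R x -> P (h n x) @[n --> \oo] --> P (f x).
  move=> Pc PB x Ix; apply/cvgrPdist_le => e e0.
  have /cvgrPdist_le /(_ e e0) := cv x Ix; apply: filterS => n.
  rewrite sub0r normrN ger0_norm ?cabs_ge0// => he.
  by rewrite -PB; apply: le_trans he.
apply: (cbmI _ (1 + M)).
- apply: (measurable_fun_cvg (h := fun n x => complex.Re (h n x))).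
    by move=> n; case: (hh n) => -[[]].
  by apply: cvr => [z|z w]; [exact: Re_le_cabs|rewrite !ReImE].
- apply: (measurable_fun_cvg (h := fun n x => complex.Im (h n x))).
    by move=> n; case: (hh n) => -[_ []].
  by apply: cvr => [z|z w]; [exact: Im_le_cabs|rewrite !ReImE].
- move=> x Ix; rewrite -[f x](subrK (h0 x)); apply: (le_trans (cabsD _ _)).
  by apply: lerD; [exact: hb0|exact: hM].
Qed.

Lemma cabs_rcir r x : 0 <= r -> cabs (r%:C * cir x) = r.
Proof. by move=> r0; rewrite cabsM cabs_cir cabs_rc mulr1 ger0_norm. Qed.

Lemma cbm_analytic F r : analytic F -> 0 <= r -> r < 1 -> cbm (fun x => F (r%:C * cir x)).
Proof.
move=> aF r0 r1; apply: cbm_unif => e e0; have [p hp] := aF r e r0 r1 e0.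
exists (fun x => p.[r%:C * cir x]).
  by apply: cbm_horner; apply: cbmM (cbm_cst _) _; exact: cbm_cir.
by move=> x _; apply: hp; rewrite cabs_rcir.
Qed.

Lemma horner_rcir p (r : R) x : p.[r%:C * cir x] = ev (p \Po (r%:C *: 'X)) x.
Proof. by rewrite /ev horner_comp hornerZ hornerX. Qed.

Lemma small_eq0 z (K : R) : (forall e : R, 0 < e -> cabs z <= K * e) -> z = 0.
Proof.
move=> H; apply/eqP; rewrite -cabs_eq0; apply/eqP/le_anti; rewrite cabs_ge0 andbT.
apply/ler_addgt0Pl => e e0; rewrite addr0.
have K0 : 0 <= K by have := le_trans (cabs_ge0 z) (H 1 ltr01); rewrite mulr1.
have e1 : 0 < e / (K + 1) by rewrite divr_gt0// ltr_wpDl.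
apply: (le_trans (H _ e1)); rewrite mulrCA ler_piMr ?(ltW e0)//.
by rewrite ler_pdivrMr ?mul1r ?lerDl// ltr_wpDl.
Qed.

(* An identity between integrals over a circle that holds for polynomials passes
   to analytic functions. *)
Lemma analytic_CI F r (k : R -> C) z0 : analytic F -> 0 <= r -> r < 1 -> cbm k ->
  (forall p (e : R), 0 < e -> (forall w, cabs w <= r -> cabs (F w - p.[w]) <= e) ->
     cabs (CI (fun x => p.[r%:C * cir x] * k x) - z0) <= e) ->
  CI (fun x => F (r%:C * cir x) * k x) = z0.
Proof.
move=> aF r0 r1 bk H; have [M M0 kM] := cbm_bounded _ bk.
apply/eqP; rewrite -subr_eq0; apply/eqP; apply: (small_eq0 _ (M + 1)) => e e0.
have [p hp] := aF r e r0 r1 e0.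
have bF := cbm_analytic _ _ aF r0 r1.
have bp : cbm (fun x => p.[r%:C * cir x]).
  by apply: cbm_horner; apply: cbmM (cbm_cst _) _; exact: cbm_cir.
rewrite -[X in X - _](subrK (CI (fun x => p.[r%:C * cir x] * k x))) -addrA.
apply: (le_trans (cabsD _ _)); rewrite mulrDl mul1r; apply: lerD; last exact: H.
rewrite -CIB; [|exact: cbmM|exact: cbmM].
apply: CI_bound => [|x Ix]; first by apply: cbmB; exact: cbmM.
rewrite -mulrBl cabsM mulrC; apply: ler_pM; rewrite ?cabs_ge0 ?kM//.
by apply: hp; rewrite cabs_rcir.
Qed.

Lemma analytic_orth F r c : analytic F -> 0 <= r -> r < 1 ->
  CI (fun x => F (r%:C * cir x) * (cir x * ev c x)) = 0.
Proof.
move=> aF r0 r1; apply: analytic_CI => //.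
  by apply: cbmM; [exact: cbm_cir|exact: cbm_ev].
move=> p e e0 _; rewrite subr0 (eq_CI _ (fun x => cir x * ev ((p \Po (r%:C *: 'X)) * c) x)).
  by rewrite CI_cir_ev cabs0 ltW.
by move=> x _; rewrite horner_rcir /ev hornerM mulrCA.
Qed.

(** For analytic F this is r^n times the n-th Taylor coefficient; keeping r in the definition avoids
    introducing Taylor coefficients. *)
Definition coefc F (r : R) n := CI (fun x => F (r%:C * cir x) * (cir x)^~* ^+ n).

Lemma coefc_horner p r n : coefc (fun w => p.[w]) r n = p`_n * r%:C ^+ n.
Proof.
rewrite /coefc (eq_CI _ (fun x => ev (p \Po (r%:C *: 'X)) x * (cir x)^~* ^+ n)); last first.
  by move=> x _; rewrite horner_rcir.
rewrite CI_ev_conjX; elim/poly_ind: p n => [|p a IH] n; first by rewrite comp_poly0 !coef0 mul0r.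
rewrite comp_polyD comp_polyM comp_polyX comp_polyC !coefD !coefC -scalerAr coefZ !coefMX.
by case: n => [|n] /=; [rewrite mulr0 !add0r mulr1|rewrite !addr0 IH exprS; ring].
Qed.

(** Both sides are (r s)^n times the n-th Taylor coefficient. One polynomial, close to F on the disc
    of radius max(r, s), serves both circles. *)
Lemma coefc_scale F r s n : analytic F -> 0 <= r -> r < 1 -> 0 <= s -> s < 1 ->
  coefc F r n * s%:C ^+ n = coefc F s n * r%:C ^+ n.
Proof.
move=> aF r0 r1 s0 s1.
have bX : cbm (fun x => (cir x)^~* ^+ n) by apply: cbmX; apply: cbm_conj; exact: cbm_cir.
apply/eqP; rewrite -subr_eq0; apply/eqP; apply: (small_eq0 _ 2) => e e0.
pose m := Num.max r s.
have m0 : 0 <= m by rewrite le_max r0.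
have m1 : m < 1 by rewrite gt_max r1.
have [p hp] := aF m e m0 m1 e0.
have app (q : R) : 0 <= q -> q <= m -> cabs (coefc F q n - p`_n * q%:C ^+ n) <= e.
  move=> q0 qm; have q1 : q < 1 by exact: le_lt_trans m1.
  rewrite -coefc_horner /coefc -CIB; first last.
  - apply: cbmM => //; apply: (cbm_horner p); apply: cbmM (cbm_cst _) _; exact: cbm_cir.
  - by apply: cbmM => //; exact: cbm_analytic.
  apply: CI_bound.
    apply: cbmB; apply: cbmM => //; first exact: cbm_analytic.
    by apply: (cbm_horner p); apply: cbmM (cbm_cst _) _; exact: cbm_cir.
  move=> x _; rewrite -mulrBl cabsM cabsX cabs_conj cabs_cir expr1n mulr1.
  by apply: hp; rewrite cabs_rcir.
rewrite (_ : _ - _ = (coefc F r n - p`_n * r%:C ^+ n) * s%:C ^+ n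
  - (coefc F s n - p`_n * s%:C ^+ n) * r%:C ^+ n); last by ring.
have tri (a b : C) : cabs (a * s%:C ^+ n - b * r%:C ^+ n) <= cabs a * s ^+ n + cabs b * r ^+ n.
  by apply: (le_trans (cabsB _ _)); rewrite !cabsM !cabsX !cabs_rc !ger0_norm.
apply: (le_trans (tri _ _)).
rewrite (_ : 2 * e = e * 1 + e * 1); last by ring.
apply: lerD; apply: ler_pM; rewrite ?cabs_ge0 ?exprn_ge0 ?app ?le_max ?lexx ?orbT//.
  by apply: exprn_ile1 => //; exact: ltW.
by apply: exprn_ile1 => //; exact: ltW.
Qed.

Lemma Cauchy_poly p w : cabs w < 1 -> CauchyT (ev p) w = p.[w].
Proof.
move=> w1; pose n := (size p).
apply/eqP; rewrite -subr_eq0; apply/eqP.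
have [M M0 pM] := cbm_bounded _ (cbm_ev p).
apply: (small_eq0 _ M) => e e0.
have q0 : 0 < e * (1 - cabs w) by rewrite mulr_gt0 ?subr_gt0.
have [N hN] := small_pow _ _ (cabs_ge0 w) w1 q0.
(* From the degree of p on, the truncated kernel reproduces p exactly; from N on, it is close to the
   full kernel. *)
pose L := (maxn N (size p)).
have bc i : cbm (fun t => ev p t * (cir t)^~* ^+ i).
  by apply: cbmM; [exact: cbm_ev|apply: cbmX; apply: cbm_conj; exact: cbm_cir].
have -> : p.[w] = CI (fun t => \sum_(i < L) w ^+ i * (ev p t * (cir t)^~* ^+ i)).
  rewrite CI_sum; last by move=> i; exact: cbmM (cbm_cst _) _.
  rewrite (horner_coef_wide _ (leq_maxr N (size p))); apply: eq_bigr => i _.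
  by rewrite CIZ// CI_ev_conjX mulrC.
have b1 := cbm_ck _ w1.
rewrite /CauchyT -CIB; [|by apply: cbmM => //; exact: cbm_ev|by apply: cbm_sum => i; exact: cbmM (cbm_cst _) _].
apply: CI_bound.
  apply: cbmB; [by apply: cbmM => //; exact: cbm_ev|].
  by apply: cbm_sum => i; exact: cbmM (cbm_cst _) _.
move=> t It; rewrite (_ : _ - _ = ev p t * (CauchyK w t - \sum_(i < L) (w * (cir t)^~*) ^+ i)); last first.
  rewrite mulrBr; congr (_ - _); rewrite mulr_sumr; apply: eq_bigr => i _.
  by rewrite exprMn; ring.
rewrite cabsM; apply: ler_pM; rewrite ?cabs_ge0 ?pM//.
apply: (le_trans (ck_geom_le _ _ _ _ (lexx _) w1)).
rewrite ler_pdivrMr ?subr_gt0//; apply: le_trans hN.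
apply: ler_wiXn2l; rewrite ?cabs_ge0 ?(ltW w1)//; exact: leq_maxl.
Qed.

Lemma analytic_Cauchy F r w : analytic F -> 0 < r -> r < 1 -> cabs w < r ->
  F w = CauchyT (fun x => F (r%:C * cir x)) (w / r%:C).
Proof.
move=> aF r0 r1 wr; have r0' := ltW r0.
have rC : r%:C != 0 :> C by rewrite -cabs_eq0 cabs_rc normr_eq0 gt_eqF.
have wr1 : cabs (w / r%:C) < 1.
  by rewrite cabsM cabsV cabs_rc gtr0_norm// ltr_pdivrMr// mul1r.
apply/esym; apply: analytic_CI => //; first exact: cbm_ck.
move=> p e e0 hp.
have -> : CI (fun x => p.[r%:C * cir x] * CauchyK (w / r%:C) x) = p.[w].
  have := Cauchy_poly (p \Po (r%:C *: 'X)) _ wr1.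
  have E : r%:C * (w / r%:C) = w by rewrite mulrC divfK.
  rewrite horner_comp hornerZ hornerX E => <-.
  by apply: eq_CI => x _; rewrite horner_rcir.
by rewrite cabs_distC; apply: hp; exact: ltW.
Qed.

(** In the Cauchy formula on the circle of radius r, only the zeroth term of the geometric series of
    the kernel survives. *)
Lemma analytic_constant F r : analytic F -> 0 < r -> r < 1 ->
  (forall n, (0 < n)%N -> coefc F r n = 0) -> forall w, cabs w < r -> F w = F 0.
Proof.
move=> aF r0 r1 Hn; have r0' := ltW r0.
suff H w : cabs w < r -> F w = coefc F r 0 by move=> w wr; rewrite !H// cabs0.
move=> wr; rewrite (analytic_Cauchy _ _ _ aF r0 r1 wr); set q := w / _.
have q1 : cabs q < 1.
  by rewrite cabsM cabsV cabs_rc gtr0_norm// ltr_pdivrMr// mul1r.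
have bF := cbm_analytic _ _ aF r0' r1.
apply/eqP; rewrite -subr_eq0; apply/eqP.
have [M M0 pM] := cbm_bounded _ bF.
apply: (small_eq0 _ M) => e e0.
have q0 : 0 < e * (1 - cabs q) by rewrite mulr_gt0 ?subr_gt0.
have [N hN] := small_pow _ _ (cabs_ge0 q) q1 q0.
have bc i : cbm (fun t => F (r%:C * cir t) * (cir t)^~* ^+ i).
  by apply: cbmM => //; apply: cbmX; apply: cbm_conj; exact: cbm_cir.
have -> : coefc F r 0 = CI (fun t => \sum_(i < N.+1) q ^+ i * (F (r%:C * cir t) * (cir t)^~* ^+ i)).
  rewrite CI_sum; last by move=> i; exact: cbmM (cbm_cst _) _.
  rewrite big_ord_recl big1 ?addr0 => [|i _].
    by rewrite CIZ// expr0 mul1r.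
  by rewrite CIZ// -/(coefc _ _ _) Hn// mulr0.
have b1 := cbm_ck _ q1.
rewrite /CauchyT -CIB; [|exact: cbmM|by apply: cbm_sum => i; exact: cbmM (cbm_cst _) _].
apply: CI_bound.
  by apply: cbmB; [exact: cbmM|apply: cbm_sum => i; exact: cbmM (cbm_cst _) _].
move=> t It.
rewrite (_ : _ - _ = F (r%:C * cir t) * (CauchyK q t - \sum_(i < N.+1) (q * (cir t)^~*) ^+ i)); last first.
  rewrite mulrBr; congr (_ - _); rewrite mulr_sumr; apply: eq_bigr => i _.
  by rewrite [(q * _) ^+ i]exprMn; ring.
rewrite cabsM; apply: ler_pM; rewrite ?cabs_ge0 ?pM//.
apply: (le_trans (ck_geom_le _ _ _ _ (lexx _) q1)).
rewrite ler_pdivrMr ?subr_gt0//; apply: le_trans hN.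
by apply: ler_wiXn2l; rewrite ?cabs_ge0 ?(ltW q1).
Qed.

End Circle.

(** * Poisson, conjugate Poisson and truncated cotangent kernels *)

Section Kernels.
Context {R : realType}.
Notation C := R[i].
Implicit Types (u k : R -> R).

Lemma le_sin_id (y : R) : 0 <= y -> sin y <= y.
Proof.
rewrite le_eqVlt => /predU1P[<-|y0]; first by rewrite sin0.
have [c _] : exists2 c, c \in `]0, y[%R & sin y - sin 0 = cos c * (y - 0).
  apply: MVT => //; apply: continuous_subspaceT; exact: continuous_sin.
by rewrite sin0 !subr0 => ->; rewrite ler_piMl ?(ltW y0)// cos_le1.
Qed.

Lemma norm_sin_le (y : R) : `|sin y| <= `|y|.
Proof.
suff H (z : R) : 0 <= z -> `|sin z| <= z.
  have [y0|y0] := leP 0 y; first by rewrite (ger0_norm y0) H.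
  have ny : 0 <= - y by rewrite oppr_ge0 ltW.
  by have := H _ ny; rewrite sinN normrN -[`|y|]normrN (ger0_norm ny).
move=> z0; rewrite ler_norml le_sin_id// andbT.
have [z1|z1] := leP z 1; last by rewrite (le_trans _ (sin_geN1 _))// lerN2 ltW.
apply: (@le_trans _ _ 0); first by rewrite oppr_le0.
by apply: sin_ge0_pi; rewrite z0 (le_trans z1)// (le_trans _ (pi_ge2 R))// ler1n.
Qed.

(** A weak Jordan inequality: sin x = 2 sin(x/2) cos(x/2), the mean value theorem gives sin(x/2) >=
    (x/2) cos(x/2), and 2 cos(x/2)^2 = 1 + cos x >= 1. *)
Lemma le_half_sin (x : R) : 0 <= x <= pi / 2 -> x / 2 <= sin x.
Proof.
move=> /andP[x0 xpi].
have cx : 0 <= cos x by apply: cos_ge0_pihalf; rewrite xpi andbT (le_trans _ x0)// oppr_le0 divr_ge0// pi_ge0.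
have [x00|xp] : x = 0 \/ 0 < x by move: x0; rewrite le_eqVlt => /predU1P[<-|]; [left|right].
  by rewrite x00 sin0 mul0r.
have x2 : 0 < x / 2 by rewrite divr_gt0.
have [c] : exists2 c, c \in `]0, x / 2[%R & sin (x / 2) - sin 0 = cos c * (x / 2 - 0).
  apply: MVT => //; apply: continuous_subspaceT; exact: continuous_sin.
rewrite in_itv/= => /andP[c0 cx2]; rewrite sin0 !subr0 => sE.
have pi2 := pi_ge2 R.
have cc : cos (x / 2) <= cos c.
  by rewrite ltW// ltr_cos// in_itv/=; apply/andP; split; lra.
have cp : 0 <= cos (x / 2) by apply: cos_ge0_pihalf; apply/andP; split; lra.
have Ex : x = (x / 2) *+ 2 by rewrite -mulr_natr divfK.
have c2 : 2^-1 <= cos (x / 2) ^+ 2.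
  by move: cx; rewrite {1}Ex cos_mulr2n -mulr_natr; lra.
have -> : sin x = cos (x / 2) * (cos c * (x / 2)) * 2.
  by rewrite -sE {1}Ex sin_mulr2n mulr_natr.
apply: (@le_trans _ _ (cos (x / 2) * (cos (x / 2) * (x / 2)) * 2)).
  by have := ltW x2; move: c2; rewrite expr2; nra.
rewrite ler_pM2r//; apply: ler_wpM2l => //; apply: ler_wpM2r => //; exact: ltW.
Qed.

Lemma sin_pi_ge (t : R) : - 2^-1 <= t <= 2^-1 -> `|t| <= `|sin (pi * t)|.
Proof.
suff H (s : R) : 0 <= s <= 2^-1 -> s <= sin (pi * s).
  move=> /andP[t1 t2]; have [t0|t0] := leP 0 t.
    by rewrite ger0_norm// (le_trans (H t _)) ?t0// ler_norm.
  rewrite -normrN -[in leRHS]normrN -sinN -mulrN ger0_norm ?oppr_ge0 ?(ltW t0)//.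
  by apply: le_trans (H _ _) (ler_norm _); apply/andP; split; lra.
move=> /andP[s0 s1]; have p2 := pi_ge2 R.
apply: le_trans (le_half_sin _ _); first by nra.
by rewrite mulr_ge0 ?pi_ge0//=; nra.
Qed.

(** This denominator is |1 - r e^(2 pi i s)|^2. *)
Definition PoissonD (r s : R) := 1 - 2 * r * cos (2 * pi * s) + r ^+ 2.
Definition PoissonK (r s : R) := (1 - r ^+ 2) / PoissonD r s.
Definition conjPoissonK (r s : R) := 2 * r * sin (2 * pi * s) / PoissonD r s.

Lemma PDE (r s : R) : PoissonD r s = (1 - r) ^+ 2 + 4 * r * sin (pi * s) ^+ 2.
Proof.
rewrite /PoissonD (_ : 2 * pi * s = (pi * s) *+ 2); last by rewrite -mulr_natr; ring.
by rewrite cos_mulr2n cos2sin2 -mulr_natr; ring.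
Qed.

Lemma PD_ge (r s : R) : 0 <= r -> (1 - r) ^+ 2 <= PoissonD r s.
Proof. by move=> r0; rewrite PDE lerDl; apply: mulr_ge0; [exact: mulr_ge0|exact: sqr_ge0]. Qed.

Lemma PD_gt0 (r s : R) : 0 <= r -> r < 1 -> 0 < PoissonD r s.
Proof.
by move=> r0 r1; apply: lt_le_trans (PD_ge _ _ r0); rewrite exprn_gt0// subr_gt0.
Qed.

Lemma cts_cos2pi : continuous (fun s : R => cos (2 * pi * s)).
Proof. exact: cts_Re_cir. Qed.
Lemma cts_sin2pi : continuous (fun s : R => sin (2 * pi * s)).
Proof. exact: cts_Im_cir. Qed.

Lemma cts_PD r : continuous (PoissonD r).
Proof.
move=> s; apply: cvgD; last exact: cvg_cst.
apply: cvgB; first exact: cvg_cst.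
by apply: cvgM; [exact: cvg_cst|exact: cts_cos2pi].
Qed.

Lemma cts_PK r : 0 <= r -> r < 1 -> continuous (PoissonK r).
Proof.
move=> r0 r1 s; apply: cvgM; first exact: cvg_cst.
by apply: cvgV; [rewrite gt_eqF ?PD_gt0|exact: cts_PD].
Qed.

Lemma cts_QK r : 0 <= r -> r < 1 -> continuous (conjPoissonK r).
Proof.
move=> r0 r1 s; apply: cvgM; last first.
  by apply: cvgV; [rewrite gt_eqF ?PD_gt0|exact: cts_PD].
by apply: cvgM; [exact: cvg_cst|exact: cts_sin2pi].
Qed.

Lemma cos2pi_periodic (s : R) : cos (2 * pi * (s + 1)) = cos (2 * pi * s).
Proof. by have := congr1 (@complex.Re R) (cir_periodic s). Qed.
Lemma sin2pi_periodic (s : R) : sin (2 * pi * (s + 1)) = sin (2 * pi * s).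
Proof. by have := congr1 (@complex.Im R) (cir_periodic s). Qed.
Lemma PK_periodic r s : PoissonK r (s + 1) = PoissonK r s.
Proof. by rewrite /PoissonK /PoissonD cos2pi_periodic. Qed.
Lemma QK_periodic r s : conjPoissonK r (s + 1) = conjPoissonK r s.
Proof. by rewrite /conjPoissonK /PoissonD cos2pi_periodic sin2pi_periodic. Qed.

Lemma herglotz_aux (r c s A B : R) : 1 - 2 * r * c + r ^+ 2 != 0 ->
  s ^+ 2 = 1 - c ^+ 2 ->
  A * (1 - 2 * r * c + r ^+ 2) = 1 - r ^+ 2 -> B * (1 - 2 * r * c + r ^+ 2) = 2 * r * s ->
  2 - (1 - r%:C * Complex c s) = (1 - r%:C * Complex c s) * Complex A B.
Proof.
move=> d1 s2 hA hB; apply: complexP; rewrite !ReImE /=; apply: (mulIf d1).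
  transitivity ((1 - r * c) * (1 - r ^+ 2) + r * s * (2 * r * s)); last by rewrite -hA -hB; ring.
  by transitivity ((1 - r * c) * (1 - r ^+ 2) + 2 * r ^+ 2 * s ^+ 2); [rewrite s2; ring|ring].
by transitivity ((1 - r * c) * (2 * r * s) - r * s * (1 - r ^+ 2)); [ring|rewrite -hA -hB; ring].
Qed.

Lemma mul_rc (a A B : R) : a%:C * Complex A B = Complex (a * A) (a * B).
Proof.
by rewrite -[LHS]/(Complex (a * A - 0 * B) (a * B + 0 * A)); congr Complex; ring.
Qed.

(** With z = e^(2 pi i (x - t)) the left side is (1 + r z)/(1 - r z), the Herglotz kernel. *)
Lemma ckE (r x t : R) : 0 <= r -> r < 1 ->
  2 * CauchyK (r%:C * cir x) t - 1 = Complex (PoissonK r (x - t)) (conjPoissonK r (x - t)).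
Proof.
move=> r0 r1; have d0 := PD_gt0 _ (x - t) r0 r1.
have w1 : cabs (r%:C * cir x) < 1 by rewrite cabs_rcir.
have n0 := ck_neq0 _ t w1; rewrite /CauchyK.
have E : r%:C * cir x * (cir t)^~* = r%:C * cir (x - t) by rewrite -mulrA cirD cirN.
rewrite E in n0 *; apply: (mulfI n0); rewrite mulrBr mulrCA divff// !mulr1.
have cs := cos2Dsin2 (2 * pi * (x - t)).
rewrite /PoissonK /conjPoissonK; move: d0; rewrite /PoissonD /cir /expi.
move: (cos _) (sin _) cs => c s cs d0.
have d1 : 1 - 2 * r * c + r ^+ 2 != 0 by rewrite gt_eqF.
have s2 : s ^+ 2 = 1 - c ^+ 2 by lra.
apply: (herglotz_aux _ _ _ _ _ d1) => //; by rewrite divfK.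
Qed.

(* The boundary values are [u + i u^h], see [Poisson_cvg] and [conj_cvg]. *)
Definition Herglotz u (w : C) : C := 2 * CauchyT (fun t => (u t)%:C) w - (I u)%:C.

Lemma FuE u r x : bm u -> 0 <= r -> r < 1 ->
  Herglotz u (r%:C * cir x) =
  Complex (I (fun t => u t * PoissonK r (x - t))) (I (fun t => u t * conjPoissonK r (x - t))).
Proof.
move=> bu r0 r1; have w1 : cabs (r%:C * cir x) < 1 by rewrite cabs_rcir.
have bk := cbm_ck _ w1; have bc := cbm_rc _ bu.
rewrite /Herglotz /CauchyT -CIZ; last exact: cbmM.
rewrite -CI_rc -CIB//; last by apply: cbmM (cbm_cst _) _; exact: cbmM.
rewrite (eq_CI _ (fun t => (u t)%:C * (2 * CauchyK (r%:C * cir x) t - 1))); last by move=> t _; ring.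
rewrite (eq_CI _ (fun t => Complex (u t * PoissonK r (x - t)) (u t * conjPoissonK r (x - t)))) // => t _.
by rewrite ckE// mul_rc.
Qed.

Lemma I_PK r : 0 <= r -> r < 1 -> I (PoissonK r) = 1.
Proof.
move=> r0 r1.
have x0 : - 2^-1 < (0 : R) < 2^-1 by lra.
rewrite -(I_periodic _ _ x0 (cts_PK _ r0 r1) (PK_periodic r)).
have := FuE (fun=> 1) r 0 (bm_cst 1) r0 r1.
rewrite /Herglotz I_cst; have -> : CauchyT (fun=> 1%:C) (r%:C * cir 0) = 1.
  have := Cauchy_poly (1 : {poly C}) (r%:C * cir 0); rewrite cabs_rcir// => /(_ r1).
  rewrite hornerC => <-; rewrite /CauchyT; apply: eq_CI => t _; by rewrite /ev hornerC.
move=> /(congr1 (@complex.Re R)) /=; rewrite mulr1 => h.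
transitivity (I (fun t => 1 * PoissonK r (0 - t))); first by apply: eq_I => t _; rewrite mul1r.
by rewrite -h; ring.
Qed.

Lemma Re_Fu u r x : bm u -> - 2^-1 < x < 2^-1 -> 0 <= r -> r < 1 ->
  complex.Re (Herglotz u (r%:C * cir x)) = I (fun t => per u (x - t) * PoissonK r t).
Proof.
move=> bu hx r0 r1; rewrite FuE//= per_conv//; [exact: cts_PK|exact: PK_periodic].
Qed.

Lemma Im_Fu u r x : bm u -> - 2^-1 < x < 2^-1 -> 0 <= r -> r < 1 ->
  complex.Im (Herglotz u (r%:C * cir x)) = I (fun t => per u (x - t) * conjPoissonK r t).
Proof.
move=> bu hx r0 r1; rewrite FuE//= per_conv//; [exact: cts_QK|exact: QK_periodic].
Qed.

Lemma PK_ge0 r s : 0 <= r -> r < 1 -> 0 <= PoissonK r s.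
Proof.
move=> r0 r1; rewrite divr_ge0 ?(ltW (PD_gt0 _ _ r0 r1))// subr_ge0.
by apply: exprn_ile1 => //; exact: ltW.
Qed.

Lemma PD_ge_sq (d t : R) : d <= 2^-1 -> Ihalf R t -> 2 * t ^+ 2 <= PoissonD (1 - d) t.
Proof.
move=> d2 /Ihalf_itv/sin_pi_ge h; rewrite PDE.
have h2 : t ^+ 2 <= sin (pi * t) ^+ 2.
  by rewrite -(real_normK (num_real t)) -(real_normK (num_real (sin _))) ler_sqr ?nnegrE.
have := sqr_ge0 (1 - (1 - d)); have := sqr_ge0 t; have := sqr_ge0 (sin (pi * t)); nra.
Qed.

Lemma PK_bounds (d t : R) : 0 < d -> d <= 2^-1 -> Ihalf R t ->
  `|PoissonK (1 - d) t| <= 2 / d /\ `|PoissonK (1 - d) t| * t ^+ 2 <= 2 * d.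
Proof.
move=> d0 d2 It; have r0 : 0 <= 1 - d by lra.
have r1 : 1 - d < 1 by lra.
have D0 := PD_gt0 _ t r0 r1; rewrite ger0_norm ?PK_ge0//.
have Dd := PD_ge _ t r0; rewrite opprB addrC subrK in Dd.
have Dt := PD_ge_sq _ _ d2 It.
split; rewrite /PoissonK.
  rewrite ler_pdivrMr// mulrAC ler_pdivlMr//; nra.
rewrite mulrAC ler_pdivrMr//; have := sqr_ge0 t; nra.
Qed.

Lemma I_per_sub u k x : bm u -> - 2^-1 < x < 2^-1 -> bm k ->
  `|I (fun t => per u (x - t) * k t) - u x * I k| <= I (fun t => `|per u (x - t) - u x| * `|k t|).
Proof.
move=> bu hx bk; have bp := bm_per_refl _ _ hx bu.
have b1 : bm (fun t => u x * k t) by apply: bmM (bm_cst _) _.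
have b2 : bm (fun t => per u (x - t) - u x) by apply: bmB => //; exact: bm_cst.
rewrite -IZ// -IB//; last exact: bmM.
apply: (@le_trans _ _ (I (fun t => `|(per u (x - t) - u x) * k t|))).
  rewrite (eq_I _ (fun t => (per u (x - t) - u x) * k t)); last by move=> t _; ring.
  by apply: I_norm; exact: bmM.
apply: le_I => [||t _]; last by rewrite normrM.
  by apply: bm_norm; exact: bmM.
by apply: bmM; exact: bm_norm.
Qed.

Lemma Poisson_cvg u x : bm u -> leb_pt u x -> forall e : R, 0 < e ->
  exists2 d0 : R, 0 < d0 & forall d : R, 0 < d -> d < d0 -> d <= 2^-1 /\
    `|complex.Re (Herglotz u ((1 - d)%:C * cir x)) - u x| <= e.
Proof.
move=> bu lp e e0; have hx : - 2^-1 < x < 2^-1 by case: lp.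
have [d0 d00 H] := leb_pt_kernel _ _ 2 bu lp (ltr0Sn _ 1) _ e0.
exists (Num.min d0 2^-1); first by rewrite lt_min d00/= invr_gt0 ltr0n.
move=> d dp; rewrite lt_min => /andP[dd /ltW d2]; split => //.
have r0 : 0 <= 1 - d by lra.
have r1 : 1 - d < 1 by lra.
have bk : bm (PoissonK (1 - d)) by apply: bm_cts; exact: cts_PK.
rewrite Re_Fu//; apply: le_trans (H d _ dp dd bk _ _).
- by have := I_per_sub _ _ _ bu hx bk; rewrite I_PK// mulr1.
- by move=> t It; have [] := PK_bounds _ _ dp d2 It.
- by move=> t It; have [] := PK_bounds _ _ dp d2 It.
Qed.

(** Extending the truncated cotangent by zero turns the integral in [conj_trunc] into one over the
    whole interval. *)
Definition cotk (d t : R) : R := if d <= `|t| then cos (pi * t) / sin (pi * t) else 0.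

Lemma cts_sinpi : continuous (fun t : R => sin (pi * t)).
Proof. by move=> t; apply: continuous_comp; [exact: cts_scale|exact: continuous_sin]. Qed.
Lemma cts_cospi : continuous (fun t : R => cos (pi * t)).
Proof. by move=> t; apply: continuous_comp; [exact: cts_scale|exact: continuous_cos]. Qed.

Lemma bm_cotk (d : R) : 0 < d -> bm (cotk d).
Proof.
move=> d0.
(* Where |t| >= d the maximum is sin(pi t)^2 because |sin(pi t)| >= |t|; elsewhere it keeps the
   reciprocal bounded. *)
pose F (t : R) : R := (1 - cut d t) * (cos (pi * t) * (sin (pi * t) *
   (Num.max (d ^+ 2) (sin (pi * t) ^+ 2))^-1)).
have EF t : Ihalf R t -> F t = cotk d t.
  rewrite /F => It; rewrite /cotk cutE; case: (ltP `|t| d) => h; first by rewrite subrr mul0r.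
  have h1 := sin_pi_ge _ ((Ihalf_itv t).1 It).
  have h2 : d ^+ 2 <= sin (pi * t) ^+ 2.
    by rewrite -(real_normK (num_real (sin _))) ler_sqr ?nnegrE ?(ltW d0)// (le_trans h).
  have s0 : sin (pi * t) != 0.
    by rewrite -normr_gt0; apply: lt_le_trans h1; apply: lt_le_trans h.
  by rewrite subr0 mul1r maxEle h2; field.
apply: (eq_bm _ _ EF); rewrite /F.
have bs : bm (fun t : R => sin (pi * t)) by apply: bm_cts; exact: cts_sinpi.
apply: bmM; first by apply: bmB; [exact: bm_cst|exact: bm_cut].
apply: bmM; first by apply: bm_cts; exact: cts_cospi.
apply: bmM => //; apply: (bmV _ (d ^+ 2)); last 2 first.
- by rewrite exprn_gt0.
- by move=> t _; rewrite le_max lexx.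
have [ms [M sM]] : bm (fun t : R => sin (pi * t) ^+ 2) by exact: bmX.
split; first by apply: measurable_maxr => //; exact: measurable_cst.
exists (d ^+ 2 + M) => t It; have := sM t It; rewrite !ger0_norm ?sqr_ge0//; last by rewrite le_max sqr_ge0.
by move=> h; have := sqr_ge0 d; have := sqr_ge0 (sin (pi * t)); rewrite maxEle; case: ifP => _ ? ?; lra.
Qed.

Lemma conj_truncE u x d : conj_trunc u x d = I (fun t => per u (x - t) * cotk d t).
Proof.
rewrite /conj_trunc /I.
have -> : [set t : R | d <= `|t| <= 2^-1] = Ihalf R `&` [set t : R | d <= `|t|].
  apply/seteqP; split => t /=.
    by move=> /andP[h1 h2]; split => //; apply/Ihalf_itv; rewrite -ler_norml.
  by move=> [/Ihalf_itv h1 h2]; rewrite h2 ler_norml.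
rewrite Rintegral_mkcondr; apply: eq_Rintegral => t _; rewrite patchE /cotk.
case: ifPn => h; first by rewrite inE /= in h; rewrite h.
by rewrite ifF ?mulr0//; apply/negbTE/negP => h'; move/negP: h; apply; rewrite inE.
Qed.

Lemma I_opp k : bm k -> I (fun t => k (- t)) = I k.
Proof.
move=> bk.
have mp : measurable_fun setT (k \_ (Ihalf R)).
  by apply/(measurable_restrictT _ measurable_Ihalf); case: bk.
have pE t : Ihalf R t -> (k \_ (Ihalf R)) t = k t by move=> It; rewrite patchE mem_set.
have p0 t : ~ Ihalf R t -> (k \_ (Ihalf R)) t = 0 by move=> It; rewrite patchE memNset.
have In t : Ihalf R (- t) <-> Ihalf R t.
  by split => /Ihalf_itv/andP[h1 h2]; apply/Ihalf_itv/andP; split; lra.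
transitivity (I (k \_ (Ihalf R))); last by apply: eq_I.
rewrite [RHS](I_reflect _ 0)//.
- by apply: eq_I => t It; rewrite sub0r pE//; apply/In.
- have [_ [M kM]] := bk; exists `|M| => t; have [It|It] := pselect (Ihalf R t).
    by rewrite pE//; apply: (le_trans (kM t It)); exact: ler_norm.
  by rewrite p0// normr0.
- by move=> t; apply: contra_neqP => It; exact: p0.
- by move=> t; rewrite sub0r; apply: contra_neqP => It; apply: p0 => /In.
Qed.

(** The difference K of the two kernels is odd, so its integral vanishes and u x may be subtracted
    for free; K also satisfies both size bounds of [leb_pt_kernel]. Neither kernel does so alone:
    away from 0 each decays only like 1/|t|. *)
Lemma conj_cvg u x : bm u -> leb_pt u x -> forall e : R, 0 < e ->
  exists2 d0 : R, 0 < d0 & forall d : R, 0 < d -> d < d0 -> d <= 2^-1 /\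
    `|conj_trunc u x d - complex.Im (Herglotz u ((1 - d)%:C * cir x))| <= e.
Proof.
move=> bu lp e e0; have hx : - 2^-1 < x < 2^-1 by case: lp.
have [d0 d00 H] := leb_pt_kernel _ _ 2 bu lp (ltr0Sn _ 1) _ e0.
exists (Num.min d0 2^-1); first by rewrite lt_min d00/= invr_gt0 ltr0n.
move=> d dp; rewrite lt_min => /andP[dd /ltW d2]; split => //.
have r0 : 0 <= 1 - d by lra.
have r1 : 1 - d < 1 by lra.
have bq : bm (conjPoissonK (1 - d)) by apply: bm_cts; exact: cts_QK.
have bc := bm_cotk _ dp.
have bp := bm_per_refl _ _ hx bu.
pose K t := cotk d t - conjPoissonK (1 - d) t.
have bK : bm K by exact: bmB.
have KN t : K (- t) = - K t.
  rewrite /K /cotk /conjPoissonK /PoissonD !mulrN !sinN !cosN normrN invrN; case: ifP => _; ring.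
have IK : I K = 0.
  have := I_opp _ bK; rewrite (eq_I _ (fun t => - K t)); last by move=> t _.
  by rewrite IN//; lra.
rewrite conj_truncE Im_Fu// -IB; [|exact: bmM|exact: bmM].
rewrite (eq_I _ (fun t => per u (x - t) * K t)); last by move=> t _; rewrite /K mulrBr.
suff HK t : Ihalf R t -> `|K t| <= 2 / d /\ `|K t| * t ^+ 2 <= 2 * d.
  apply: le_trans (H d K dp dd bK _ _).
  - by have := I_per_sub _ _ _ bu hx bK; rewrite IK mulr0 subr0.
  - by move=> t /HK [].
  - by move=> t /HK [].
move=> It; have D0 := PD_gt0 _ t r0 r1.
have DE : PoissonD (1 - d) t = d ^+ 2 + 4 * (1 - d) * sin (pi * t) ^+ 2 by rewrite PDE; ring.
have Dt := PD_ge_sq _ _ d2 It.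
have ht := sin_pi_ge _ ((Ihalf_itv t).1 It).
have t2 : t ^+ 2 = `|t| ^+ 2 by rewrite real_normK ?num_real.
have s2 : sin (pi * t) ^+ 2 = `|sin (pi * t)| ^+ 2 by rewrite real_normK ?num_real.
have s2E : sin (2 * pi * t) = 2 * cos (pi * t) * sin (pi * t).
  have -> : 2 * pi * t = (pi * t) *+ 2 by rewrite -mulr_natr; ring.
  by rewrite sin_mulr2n -mulr_natr; ring.
have c1 := cos_max (pi * t).
have n0 := normr_ge0 (sin (pi * t)); have nt := normr_ge0 t.
rewrite /K /cotk; case: (leP d `|t|) => h.
  have t0 : 0 < `|t| by exact: lt_le_trans h.
  have sp : 0 < `|sin (pi * t)| by exact: lt_le_trans ht.
  have s0 : sin (pi * t) != 0 by rewrite -normr_gt0.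
  (* The conjugate Poisson kernel is cot(pi t) times 4 (1 - d) sin(pi t)^2 / D, and D = d^2 + 4 (1 -
     d) sin(pi t)^2; the subtraction leaves the factor d^2/D. *)
  have KE : cos (pi * t) / sin (pi * t) - conjPoissonK (1 - d) t =
      cos (pi * t) / sin (pi * t) * (d ^+ 2 / PoissonD (1 - d) t).
    rewrite /conjPoissonK s2E; have D1 : PoissonD (1 - d) t != 0 by rewrite gt_eqF.
    have -> : d ^+ 2 = PoissonD (1 - d) t - 4 * (1 - d) * sin (pi * t) ^+ 2 by rewrite DE; ring.
    by field; rewrite s0 D1.
  have key : `|cos (pi * t) / sin (pi * t) - conjPoissonK (1 - d) t| * t ^+ 2 <= d.
    rewrite KE normrM normrM normfV (ger0_norm (divr_ge0 (sqr_ge0 d) (ltW D0))).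
    have e1 : `|cos (pi * t)| / `|sin (pi * t)| <= `|t|^-1.
      rewrite ler_pdivrMr//; apply: (le_trans c1).
      by rewrite mulrC ler_pdivlMr// mul1r.
    have e2 : d ^+ 2 / PoissonD (1 - d) t * t ^+ 2 <= d ^+ 2.
      rewrite mulrAC ler_pdivrMr// ler_wpM2l ?sqr_ge0//.
      by apply: le_trans Dt; have := sqr_ge0 t; lra.
    rewrite -[leLHS]mulrA; apply: (@le_trans _ _ (`|t|^-1 * d ^+ 2)).
      apply: ler_pM => //.
      by apply: mulr_ge0; [rewrite divr_ge0 ?sqr_ge0 ?(ltW D0)|exact: sqr_ge0].
    by rewrite mulrC ler_pdivrMr// expr2 ler_wpM2l// ltW.
  split; last by apply: (le_trans key); lra.
  have tt : 0 < t ^+ 2 by rewrite t2 exprn_gt0.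
  rewrite -(ler_pM2r tt); apply: (le_trans key).
  rewrite mulrAC ler_pdivlMr// t2.
  have : d * d <= `|t| ^+ 2 by rewrite expr2; apply: ler_pM => //; exact: ltW.
  by have := sqr_ge0 `|t|; lra.
(* With s = |sin(pi t)| and r = 1 - d this is 4 r s d <= d^2 + 4 r s^2, which follows from (d - 2 r
   s)^2 >= 0 and r <= 1. *)
have key : `|conjPoissonK (1 - d) t| <= d^-1.
  rewrite /conjPoissonK normrM normfV (gtr0_norm D0) ler_pdivrMr//.
  rewrite s2E !normrM (ger0_norm r0) !(ger0_norm (ler0n _ _)).
  rewrite ler_pdivlMl// DE s2.
  apply: (@le_trans _ _ (4 * (1 - d) * `|sin (pi * t)| * d)).
    have : `|cos (pi * t)| * `|sin (pi * t)| <= 1 * `|sin (pi * t)| by apply: ler_wpM2r.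
    by have := mulr_ge0 r0 (ltW dp); nra.
  by have := sqr_ge0 (d - 2 * (1 - d) * `|sin (pi * t)|); have := sqr_ge0 `|sin (pi * t)|; nra.
rewrite sub0r normrN; split.
  by have d1 : 0 < d^-1 by [rewrite invr_gt0]; apply: (le_trans key); lra.
apply: (@le_trans _ _ (d^-1 * d ^+ 2)).
  apply: ler_pM => //; first exact: sqr_ge0.
  by rewrite t2 ler_sqr ?nnegrE ?(ltW dp)// ltW.
by rewrite expr2 mulrA mulVf ?gt_eqF// mul1r; lra.
Qed.

End Kernels.

(** * The complex exponential and the choice of an argument along a radius *)

Section ComplexExponential.
Context {R : realType}.
Notation C := R[i].
Implicit Types (z w : C).

Definition cexp w : C := (expR (complex.Re w))%:C * expi (complex.Im w).

Lemma cexpD z w : cexp (z + w) = cexp z * cexp w.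
Proof. by rewrite /cexp !ReImE expRD expiD rmorphM /=; ring. Qed.
Lemma cexp0 : cexp 0 = 1. Proof. by rewrite /cexp /= expR0 expi0 mulr1. Qed.
Lemma cabs_cexp w : cabs (cexp w) = expR (complex.Re w).
Proof. by rewrite /cexp cabsM cabs_expi mulr1 cabs_rc ger0_norm// expR_ge0. Qed.
Lemma cexpNM w : cexp w * cexp (- w) = 1. Proof. by rewrite -cexpD subrr cexp0. Qed.
Lemma cexp_neq0 w : cexp w != 0.
Proof. by rewrite -cabs_eq0 cabs_cexp gt_eqF// expR_gt0. Qed.
Lemma cexpMn w n : cexp (w *+ n) = cexp w ^+ n.
Proof. by elim: n => [|n IH]; [rewrite cexp0|rewrite mulrS cexpD IH exprS]. Qed.

Lemma expR_quad (a : R) : `|a| <= 2^-1 -> `|expR a - 1 - a| <= 2 * a ^+ 2.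
Proof.
rewrite ler_norml => /andP[a1 a2]; have h1 := expR_ge1Dx a; have h2 := expR_ge1Dx (- a).
have e0 := expR_gt0 a; have e1 : expR a * expR (- a) = 1 by rewrite -expRD subrr expR0.
rewrite ger0_norm; last by lra.
have h3 : expR a * (1 - a) <= 1 by have := h2; rewrite -(ler_pM2l e0) e1.
have : expR a <= 2 by nra.
by have := sqr_ge0 a; nra.
Qed.

Lemma one_sub_cos (b : R) : `|cos b - 1| <= b ^+ 2.
Proof.
have Eb : b = (b / 2) *+ 2 by rewrite -mulr_natr divfK.
have cE : cos b = (1 - sin (b / 2) ^+ 2) * 2 - 1 by rewrite {1}Eb cos_mulr2n cos2sin2 mulr_natr.
have -> : cos b - 1 = - (2 * sin (b / 2) ^+ 2) by rewrite cE; ring.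
rewrite normrN ger0_norm; last by rewrite mulr_ge0// sqr_ge0.
have : sin (b / 2) ^+ 2 <= (b / 2) ^+ 2.
  by rewrite -(real_normK (num_real (sin _))) -(real_normK (num_real (b / 2))) ler_sqr ?nnegrE// norm_sin_le.
by have := sqr_ge0 (b / 2); rewrite exprMn; lra.
Qed.

Lemma sin_sub_id (b : R) : `|b| <= 1 -> `|sin b - b| <= b ^+ 2.
Proof.
suff H (y : R) : 0 < y -> y <= 1 -> `|sin y - y| <= y ^+ 2.
  move=> b1; have [b0|b0|->] := ltgtP b 0.
  - have := H (- b); rewrite oppr_gt0 b0 sqrrN sinN opprK => /(_ isT).
    rewrite addrC -normrN opprD opprK addrC; apply.
    by move: b1; rewrite ltr0_norm.
  - by apply: H => //; move: b1; rewrite gtr0_norm.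
  - by rewrite sin0 subrr normr0 expr0n.
move=> y0 y1.
have [c] : exists2 c, c \in `]0, y[%R & sin y - sin 0 = cos c * (y - 0).
  apply: MVT => //; apply: continuous_subspaceT; exact: continuous_sin.
rewrite in_itv/= => /andP[c0 cy]; rewrite sin0 !subr0 => ->.
rewrite -[X in _ - X]mul1r -mulrBl normrM (gtr0_norm y0) expr2 ler_wpM2r ?(ltW y0)//.
apply: (le_trans (one_sub_cos c)); rewrite expr2; nra.
Qed.

Lemma cexp_quad w : cabs w <= 2^-1 -> cabs (cexp w - (1 + w)) <= 8 * csq w.
Proof.
move=> w1; case: w w1 => a b w1.
have a1 : `|a| <= 2^-1 by apply: le_trans w1; exact: (Re_le_cabs (Complex a b)).
have b1 : `|b| <= 2^-1 by apply: le_trans w1; exact: (Im_le_cabs (Complex a b)).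
have hE := expR_quad _ a1; have hc := one_sub_cos b.
have b11 : `|b| <= 1 by lra.
have hs := sin_sub_id _ b11.
have e0 := expR_gt0 a.
apply: (le_trans (cabs_le_ReIm _)); rewrite /cexp !ReImE /csq /=.
have q1 : `|expR a| <= 2.
  rewrite gtr0_norm//; move: hE a1; rewrite !ler_norml => /andP[? ?] /andP[? ?].
  have : a ^+ 2 <= 4^-1 by rewrite expr2; nra.
  by lra.
have A1 : `|expR a * cos b - 0 * sin b - (1 + a)| <= 2 * a ^+ 2 + 2 * b ^+ 2.
  rewrite (_ : _ - (1 + a) = (expR a - 1 - a) + expR a * (cos b - 1)); last by ring.
  apply: (le_trans (ler_normD _ _)); apply: lerD => //.
  by rewrite normrM; apply: ler_pM.
have q2 : `|expR a - 1| <= 2 * `|a|.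
  rewrite -[expR a - 1](subrK a); apply: (le_trans (ler_normD _ _)).
  have : a ^+ 2 <= 2^-1 * `|a| by rewrite -(real_normK (num_real a)) expr2 ler_wpM2r.
  by lra.
have A2 : `|expR a * sin b + 0 * cos b - (0 + b)| <= 2 * (`|a| * `|b|) + b ^+ 2.
  rewrite (_ : _ - (0 + b) = (expR a - 1) * sin b + (sin b - b)); last by ring.
  apply: (le_trans (ler_normD _ _)); apply: lerD => //.
  by rewrite normrM mulrA; apply: ler_pM => //; exact: norm_sin_le.
apply: (le_trans (lerD A1 A2)).
rewrite -(real_normK (num_real a)) -(real_normK (num_real b)).
by have := sqr_ge0 (`|a| - `|b|); have := sqr_ge0 `|a|; have := sqr_ge0 `|b|; nra.
Qed.

Lemma cabs_subX z w (M : R) n : cabs z <= M -> cabs w <= M ->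
  cabs (z ^+ n.+1 - w ^+ n.+1) <= n.+1%:R * M ^+ n * cabs (z - w).
Proof.
move=> zM wM; rewrite subrXX cabsM mulrC ler_wpM2r ?cabs_ge0//.
apply: (le_trans (cabs_sum _ _ _)).
apply: (@le_trans _ _ (\sum_(i < n.+1) M ^+ n)).
  apply: ler_sum => i _; rewrite cabsM !cabsX.
  have M0 : 0 <= M by apply: le_trans zM; exact: cabs_ge0.
  rewrite (_ : M ^+ n = M ^+ (n - i) * M ^+ i); last by rewrite -exprD subnK// -ltnS.
  by apply: ler_pM; rewrite ?exprn_ge0 ?cabs_ge0//; apply: lerXn2r; rewrite ?nnegrE ?cabs_ge0.
by rewrite sumr_const card_ord mulr_natl.
Qed.

(** Euler's limit with a rate. With n + 1 factors, e^(w/(n+1)) and 1 + w/(n+1) are both bounded by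
    e^(B/(n+1)) and differ by O((n+1)^-2); taking powers costs a factor n + 1. This presents e^F as
    a limit of polynomials in F. *)
Lemma cexp_approx w (B : R) n : cabs w <= B -> 2 * B <= n.+1%:R ->
  cabs (cexp w - (1 + n.+1%:R^-1 * w) ^+ n.+1) <= 8 * B ^+ 2 * expR B / n.+1%:R.
Proof.
move=> wB Bn; have n0 : 0 < n.+1%:R :> R by [].
have B0 : 0 <= B by apply: le_trans wB; exact: cabs_ge0.
pose v : C := n.+1%:R^-1 * w.
have cn : cabs (n.+1%:R^-1 : C) = n.+1%:R^-1 :> R.
  by rewrite cabsV -(rmorph_nat (real_complex R)) cabs_rc ger0_norm.
have cv : cabs v <= B / n.+1%:R.
  by rewrite /v cabsM cn mulrC ler_wpM2r// invr_ge0.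
have Bn2 : B / n.+1%:R <= 2^-1 by rewrite ler_pdivrMr//; lra.
have E : w = v *+ n.+1 by rewrite /v -[RHS]mulr_natl mulrA divff ?mul1r// pnatr_eq0.
have eB : 1 <= expR (B / n.+1%:R) :> R.
  by apply: le_trans (expR_ge1Dx _); rewrite lerDl divr_ge0.
rewrite {1}E cexpMn; apply: (le_trans (cabs_subX _ _ (expR (B / n.+1%:R)) _ _ _)).
- by rewrite cabs_cexp ler_expR (le_trans (Re_le _)).
- apply: (le_trans (cabsD _ _)); rewrite cabs1; apply: le_trans (expR_ge1Dx _).
  by rewrite lerD2l.
have h1 : expR (B / n.+1%:R) ^+ n <= expR B :> R.
  rewrite -expRM_natr ler_expR -mulrA ler_piMr// mulrC ler_pdivrMr// mul1r ler_nat.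
  exact: leqnSn.
have h2 : cabs (cexp v - (1 + v)) <= 8 * (B / n.+1%:R) ^+ 2.
  apply: (le_trans (cexp_quad _ (le_trans cv Bn2))).
  rewrite ler_pM2l// -sqr_cabs ler_sqr ?nnegrE ?cabs_ge0// divr_ge0//.
rewrite (_ : 8 * B ^+ 2 * expR B / n.+1%:R = n.+1%:R * expR B * (8 * (B / n.+1%:R) ^+ 2)); last first.
  by field; rewrite gt_eqF.
apply: ler_pM => //; rewrite ?cabs_ge0 ?mulr_ge0 ?exprn_ge0 ?expR_ge0//.
by rewrite ler_pM2l.
Qed.

Lemma analytic_cexp F : analytic F -> analytic (fun w => cexp (F w)).
Proof.
move=> aF; apply: analytic_unif => r e r0 r1 e0.
have [B B0 hB] := analytic_bounded _ _ aF r0 r1.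
pose K := 8 * B ^+ 2 * expR B.
have K0 : 0 <= K by rewrite !mulr_ge0 ?exprn_ge0 ?expR_ge0.
(* The first summand meets the size condition of [cexp_approx], the second makes its error at most
   e. *)
pose n := Num.bound (2 * B + K / e).
have Ke : 0 <= K / e by rewrite divr_ge0// ltW.
have pnorm2 : 2 * B + K / e < n.+1%:R.
  apply: (@lt_trans _ _ n%:R); last by rewrite ltr_nat.
  by apply: archi_boundP; rewrite addr_ge0// mulr_ge0.
exists (fun w => (1 + n.+1%:R^-1 * F w) ^+ n.+1).
  apply: analyticX; apply: analyticD; first exact: analytic_cst.
  by apply: analyticM => //; exact: analytic_cst.
move=> w wr; apply: (le_trans (cexp_approx _ _ _ (hB w wr) _)); first by lra.
rewrite -/K ler_pdivrMr// -ler_pdivrMl// mulrC.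
by apply: ltW; apply: le_lt_trans pnorm2; rewrite lerDr mulr_ge0.
Qed.

Lemma expi_surj z : csq z = 1 -> exists t : R, expi t = z.
Proof.
case: z => a b; rewrite /csq /= => ab.
have a1 : -1 <= a <= 1 by have := sqr_ge0 b; move=> ?; apply/andP; split; nra.
have sq : 1 - a ^+ 2 = b ^+ 2 by lra.
have ca : cos (acos a) = a by rewrite acosK// in_itv/=.
have [b0|b0] := leP 0 b.
  by exists (acos a); rewrite /expi ca sin_acos// sq sqrtr_sqr ger0_norm.
exists (- acos a); rewrite /expi cosN sinN ca sin_acos// sq sqrtr_sqr ltr0_norm// opprK//.
Qed.

Lemma expi_shift (t : R) (m : int) : expi (t + 2 * pi * m%:~R) = expi t.
Proof.
have H (n : nat) (s : R) : expi (s + 2 * pi * n%:R) = expi s.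
  have -> : 2 * pi * n%:R = n%:R * (2 * pi) :> R by ring.
  elim: n => [|n IH]; first by rewrite mul0r addr0.
  by rewrite -natr1 mulrDl mul1r addrA expiD IH [X in _ * X]/expi mulr_natl cos2pi sin2pi mulr1.
case: m => n; first exact: H.
rewrite NegzE mulrNz mulrN.
by rewrite -(H n.+1 (t - _)) subrK.
Qed.

(* Once [expi (theta d)] stays close to [z], the intermediate value theorem keeps the
   continuous function theta on a single branch of the argument. *)
Lemma arg_lift (theta : R -> R) (d0 : R) z : 0 < d0 -> csq z = 1 ->
  (forall d, 0 < d -> d < d0 -> {for d, continuous theta}) ->
  (forall e : R, 0 < e -> exists2 d1 : R, 0 < d1 & forall d, 0 < d -> d < d1 ->
     cabs (expi (theta d) - z) <= e) ->
  exists2 L : R, expi L = z & forall e : R, 0 < e -> exists2 d1 : R, 0 < d1 &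
    forall d, 0 < d -> d < d1 -> `|theta d - L| <= e.
Proof.
move=> d00 z1 ct H; have [t0 t0z] := expi_surj _ z1.
have [d1 d10 H1] := H 2^-1 (ltac:(by rewrite invr_gt0)).
pose d2 := Num.min d0 d1.
have d20 : 0 < d2 by rewrite lt_min d00.
pose a := d2 / 2.
have a0 : 0 < a by rewrite divr_gt0.
have a2 : a < d2 by rewrite /a; lra.
have pi0 : 0 < pi :> R by exact: pi_gt0.
(* Rounding selects the argument L of z nearest to theta a, so that |theta a - L| <= pi; positivity
   of the cosine improves this to less than pi/2. *)
pose m := Num.floor ((theta a - t0) / (2 * pi) + 2^-1).
pose L := t0 + 2 * pi * m%:~R.
have Lz : expi L = z by rewrite /L expi_shift.
have dist d : cabs (expi (theta d - L) - 1) = cabs (expi (theta d) - z).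
  rewrite -Lz -[RHS]mulr1 -(cabs_expi (- L)) -cabsM mulrBl -!expiD subrr expi0//.
have cosp d : 0 < d -> d < d2 -> 0 < cos (theta d - L).
  rewrite lt_min => dp /andP[_ dd]; have := H1 d dp dd; rewrite -dist => h.
  have := le_trans (Re_le_cabs _) h; rewrite !ReImE /= ler_norml => /andP[? _]; lra.
have abound : `|theta a - L| <= pi.
  have := floor_itv ((theta a - t0) / (2 * pi) + 2^-1); rewrite -/m intrD mulr1z => /andP[h1 h2].
  have h3 : (theta a - t0) / (2 * pi) * (2 * pi) = theta a - t0.
    by rewrite divfK// gt_eqF// mulr_gt0.
  set q := (theta a - t0) / (2 * pi) in h1 h2 h3 *.
  have -> : theta a - L = (q - m%:~R) * (2 * pi) by rewrite /L mulrBl h3; ring.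
  by rewrite ler_norml; apply/andP; split; nra.
have small d : `|theta d - L| <= pi -> 0 < cos (theta d - L) -> `|theta d - L| < pi / 2.
  move=> h; rewrite -cos_norm -(cos_pihalf R) ltr_cos// in_itv/= ?normr_ge0// ?h//.
  by apply/andP; split; lra.
have asmall := small a abound (cosp a a0 a2).
have all d : 0 < d -> d < d2 -> `|theta d - L| < pi / 2.
  move=> dp dd; rewrite ltNge; apply/negP => hbig.
  pose f (s : R) := `|theta s - L|.
  have cf s : 0 < s -> s < d2 -> {for s, continuous f}.
    move=> sp; rewrite lt_min => /andP[sd _].
    apply: continuous_comp; last exact: norm_continuous.
    by apply: cvgB; [exact: ct|exact: cvg_cst].
  have key (s t : R) : 0 < s -> s <= t -> t < d2 ->
      Num.min (f s) (f t) <= pi / 2 <= Num.max (f s) (f t) -> False.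
    move=> sp st td hv.
    have [|c] := IVT st _ hv.
      apply: continuous_in_subspaceT => x; rewrite inE /= in_itv/= => /andP[x1 x2].
      by apply: cf; [exact: lt_le_trans x1|exact: le_lt_trans td].
    rewrite in_itv/= => /andP[c1 c2] fc.
    have := cosp c (lt_le_trans sp c1) (le_lt_trans c2 td).
    by rewrite -cos_norm -/(f c) fc cos_pihalf ltxx.
  have [ad|da] := leP a d.
    by apply: (key a d a0 ad dd); rewrite ge_min le_max (ltW asmall) hbig orbT.
  by apply: (key d a dp (ltW da) a2); rewrite ge_min le_max (ltW asmall) hbig orbT.
exists L => // e e0.
have e2 : 0 < e / 2 by rewrite divr_gt0.
have [d3 d30 H3] := H _ e2.
exists (Num.min d2 d3); first by rewrite lt_min d20.
move=> d dp; rewrite lt_min => /andP[dd2 dd3].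
have h1 := all d dp dd2; have := H3 d dp dd3; rewrite -dist => h2.
have := le_trans (Im_le_cabs _) h2; rewrite !ReImE /= subr0 => h3.
have h4 : `|theta d - L| / 2 <= `|sin (theta d - L)|.
  have [p0|p0] := leP 0 (theta d - L).
    rewrite (ger0_norm p0) in h1 *; apply: le_trans (ler_norm _).
    by apply: le_half_sin; rewrite p0 ltW.
  rewrite -normrN -[in leRHS]normrN -sinN.
  have p1 : 0 <= - (theta d - L) by rewrite oppr_ge0 ltW.
  rewrite -normrN (ger0_norm p1) in h1; rewrite (ger0_norm p1).
  apply: le_trans (ler_norm _).
  by apply: le_half_sin; rewrite p1 ltW.
have := le_trans h4 h3; lra.
Qed.

Lemma CT_lip (u : R -> C) (M : R) z w : cbm u -> (forall t, Ihalf R t -> cabs (u t) <= M) ->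
  cabs z < 1 -> cabs w < 1 ->
  cabs (CauchyT u z - CauchyT u w) <= M * (cabs (z - w) / ((1 - cabs z) * (1 - cabs w))).
Proof.
move=> bu uM z1 w1; have bz := cbm_ck _ z1; have bw := cbm_ck _ w1.
rewrite /CauchyT -CIB; [|exact: cbmM|exact: cbmM].
apply: CI_bound; first by apply: cbmB; exact: cbmM.
move=> t It; rewrite -mulrBr cabsM; apply: ler_pM; rewrite ?cabs_ge0 ?uM//.
have -> : CauchyK z t - CauchyK w t = (z - w) * (cir t)^~* * (CauchyK z t * CauchyK w t).
  have z0 := ck_neq0 _ t z1; have w0 := ck_neq0 _ t w1; rewrite /CauchyK.
  by field; rewrite z0 w0.
rewrite cabsM cabs_wcir ler_wpM2l ?cabs_ge0// cabsM invfM.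
by apply: ler_pM; rewrite ?cabs_ge0// cabs_ck.
Qed.

Lemma cts_Im_Fu (u : R -> R) x d : bm u -> 0 < d -> d < 1 ->
  {for d, continuous (fun s : R => complex.Im (Herglotz u ((1 - s)%:C * cir x)))}.
Proof.
move=> bu d0 d1; have bc := cbm_rc _ bu; have [M M0 uM] := cbm_bounded _ bc.
have lip (s : R) : d / 2 < s -> s < 1 ->
   `|complex.Im (Herglotz u ((1 - d)%:C * cir x)) - complex.Im (Herglotz u ((1 - s)%:C * cir x))| <=
     (4 * M / d ^+ 2) * `|d - s|.
  move=> s0 s1; have sp : 0 < s by lra.
  have cc (q : R) : 0 < q -> q < 1 -> cabs ((1 - q)%:C * cir x) = 1 - q.
    by move=> q0 q1; rewrite cabs_rcir// subr_ge0 ltW.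
  have cd := cc d d0 d1; have cs := cc s sp s1.
  have ld : cabs ((1 - d)%:C * cir x) < 1 by rewrite cd; lra.
  have ls : cabs ((1 - s)%:C * cir x) < 1 by rewrite cs; lra.
  have := CT_lip _ _ _ _ bc uM ld ls; rewrite cd cs => h.
  rewrite (_ : _ - _ = complex.Im (2 * (CauchyT (fun t => (u t)%:C) ((1 - d)%:C * cir x)
     - CauchyT (fun t => (u t)%:C) ((1 - s)%:C * cir x)))); last first.
    by rewrite /Herglotz -!cImN -cImD; congr complex.Im; ring.
  apply: (le_trans (Im_le_cabs _)); rewrite cabsM.
  have -> : cabs (2 : C) = 2 by rewrite -(rmorph_nat (real_complex R)) cabs_rc ger0_norm.
  have e1 : cabs ((1 - d)%:C * cir x - (1 - s)%:C * cir x) = `|d - s|.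
    rewrite -mulrBl cabsM cabs_cir mulr1 -rmorphB cabs_rc -normrN; congr `|_|; ring.
  apply: (le_trans (ler_wpM2l (ler0n _ 2) h)).
  rewrite e1 !opprB ![1 + (_ - 1)]addrC !subrK.
  rewrite (_ : 4 * M / d ^+ 2 * `|d - s| = 2 * (M * (`|d - s| * (2 / d ^+ 2)))); last by ring.
  do 3![apply: ler_wpM2l => //].
  rewrite (_ : 2 / d ^+ 2 = (d * (d / 2))^-1); last by field; rewrite gt_eqF.
  by rewrite lef_pV2 ?posrE ?mulr_gt0 ?divr_gt0// ler_pM2l// ltW.
apply/cvgrPdist_le => e e0.
pose K := 4 * M / d ^+ 2 + 1.
have K0 : 0 < K by rewrite ltr_wpDl//; apply: divr_ge0; [exact: mulr_ge0|exact: sqr_ge0].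
near=> s.
apply: (le_trans (lip s _ _)).
- near: s; apply: lt_nbhsr; lra.
- by near: s; exact: lt_nbhsl.
apply: (@le_trans _ _ (K * `|d - s|)); first by rewrite ler_wpM2r// lerDl.
rewrite mulrC -ler_pdivlMr//.
near: s; have q0 : 0 < e / K by rewrite divr_gt0.
have /cvgrPdist_le /(_ _ q0) h : s @[s --> d] --> d by exact: cvg_id.
exact: h.
Unshelve. all: by end_near.
Qed.

End ComplexExponential.

(** * The Riesz basis property in terms of polynomials *)

Section PolynomialForm.
Context {R : realType}.
Notation C := R[i].
Implicit Types (f g h : R -> C) (p c : {poly C}).
Local Notation mu := (lebesgue_measure : {measure set (measurableTypeR R) -> \bar R}).

(* Finite combinations of [Fsys g]: the frequencies n < 0 are encoded as the conjugates
   of the polynomials [z c(z)]. *)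
Definition syn g p c (x : R) : C := ev p x + g x * (cir x * ev c x)^~*.
Definition pnorm2 p : R := I (fun x => csq (ev p x)).

Definition riesz_poly g :=
  (forall f, L2 f -> forall e : R, 0 < e -> exists p c, (L2dist2 f (syn g p c) < e%:E)%E) /\
  (exists A B : R, [/\ 0 < A, 0 < B & forall p c, A * (pnorm2 p + pnorm2 c) <= I (fun x => csq (syn g p c x)) /\
    I (fun x => csq (syn g p c x)) <= B * (pnorm2 p + pnorm2 c)]).

Lemma cbm_syn g p c : cbm g -> cbm (syn g p c).
Proof.
move=> bg; apply: cbmD; first exact: cbm_ev.
by apply: cbmM => //; apply: cbm_conj; apply: cbmM; [exact: cbm_cir|exact: cbm_ev].
Qed.

Lemma Parseval_wide p n : (size p <= n)%N -> pnorm2 p = \sum_(i < n) csq p`_i.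
Proof.
move=> pn; rewrite /pnorm2 Parseval (big_ord_widen n (fun i => csq p`_i) pn) [RHS](bigID (fun i : 'I_n => (i < size p)%N)) /=.
rewrite [X in _ = _ + X]big1 ?addr0// => i; rewrite -leqNgt => h.
by rewrite nth_default// csq0.
Qed.

Lemma sum_sym (V : zmodType) (G : int -> V) N :
  \sum_(k < (2 * N).+1) G (k%:Z - N%:Z)%R = \sum_(i < N.+1) G (Posz i) + \sum_(i < N) G (Negz i).
Proof.
rewrite -(big_mkord xpredT (fun k => G (k%:Z - N%:Z)%R)) (big_cat_nat (n := N)) //=; last first.
  by rewrite mul2n -addnn -addnS leq_addr.
rewrite addrC; congr (_ + _).
  rewrite -{1}[N]add0n big_addn mul2n -addnn -addSn addnK big_mkord.
  by apply: eq_bigr => i _; rewrite PoszD addrK.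
rewrite big_nat_rev big_mkord; apply: eq_bigr => i _; congr G.
by rewrite add0n NegzE -subzn ?ltn_ord// addrAC subrr add0r.
Qed.

Lemma expn_pos (k : nat) (x : R) : Defs.expn (Posz k) x = cir x ^+ k.
Proof. by rewrite cirX /Defs.expn /cir; congr expi; rewrite -mulrA. Qed.

Lemma expn_neg (k : nat) (x : R) : Defs.expn (Negz k) x = (cir x ^+ k.+1)^~*.
Proof. by rewrite cirX /Defs.expn /cir -expiN; congr expi; rewrite NegzE mulrNz; ring. Qed.

Lemma Fsys_pos g k x : Fsys g (Posz k) x = cir x ^+ k.
Proof. exact: expn_pos. Qed.
Lemma Fsys_neg g k x : Fsys g (Negz k) x = g x * (cir x ^+ k.+1)^~*.
Proof. by rewrite /Fsys /= expn_neg. Qed.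

Lemma lincomb_syn g N (a : int -> C) x :
  lincomb (Fsys g) N a x =
  syn g (\poly_(i < N.+1) a (Posz i)) (\poly_(i < N) (a (Negz i))^~*) x.
Proof.
rewrite /lincomb (sum_sym _ (fun j => a j * Fsys g j x)); congr (_ + _).
  by rewrite /ev horner_poly; apply: eq_bigr => i _; rewrite Fsys_pos.
rewrite /ev horner_poly !mulr_sumr rmorph_sum mulr_sumr /=.
apply: eq_bigr => i _; rewrite Fsys_neg exprS !conjcM conjcX conjcK; ring.
Qed.

Lemma coefsq_hn N (a : int -> C) :
  coefsq N a = pnorm2 (\poly_(i < N.+1) a (Posz i)) + pnorm2 (\poly_(i < N) (a (Negz i))^~*).
Proof.
rewrite /coefsq (sum_sym _ (fun j => csq (a j))).
rewrite (Parseval_wide _ _ (size_poly _ _)) (Parseval_wide _ _ (size_poly _ _)).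
by congr (_ + _); apply: eq_bigr => i _; rewrite coef_poly ltn_ord ?csq_conj.
Qed.

(** [Negz k] is the frequency -(k+1). It is matched with the k-th coefficient of c because of the
    extra factor z in [syn]. *)
Definition zip_coef p c (j : int) : C :=
  match j with Posz k => p`_k | Negz k => (c`_k)^~* end.

Lemma zip_coefK p c N : (size p <= N)%N -> (size c <= N)%N ->
  \poly_(i < N.+1) zip_coef p c (Posz i) = p /\ \poly_(i < N) (zip_coef p c (Negz i))^~* = c.
Proof.
move=> pN cN; split; apply/polyP => i; rewrite coef_poly /= ?conjcK; case: ltnP => // h;
  rewrite nth_default//; first by apply: leq_trans (ltnW h).
by apply: leq_trans h.
Qed.

Lemma cmeasurableM f g : cmeasurable f -> cmeasurable g -> cmeasurable (fun x => f x * g x).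
Proof.
move=> [? ?] [? ?]; split; under eq_fun do rewrite ReImE.
  by apply: measurable_funB; exact: measurable_funM.
by apply: measurable_funD; exact: measurable_funM.
Qed.
Lemma cmeasurableD f g : cmeasurable f -> cmeasurable g -> cmeasurable (fun x => f x + g x).
Proof. by move=> [? ?] [? ?]; split; under eq_fun do rewrite ReImE; exact: measurable_funD. Qed.
Lemma cmeasurableN f : cmeasurable f -> cmeasurable (fun x => - f x).
Proof.
by move=> [? ?]; split; under eq_fun do rewrite ReImE; exact: measurableT_comp.
Qed.
Lemma cbm_cmeasurable f : cbm f -> cmeasurable f.
Proof. by move=> [[? _] [? _]]. Qed.
Lemma measurable_csq f : cmeasurable f -> measurable_fun (Ihalf R) (fun x => csq (f x)).
Proof. by move=> [? ?]; apply: measurable_funD; exact: measurable_funX. Qed.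

Lemma cmeasurable_syn g p c : cmeasurable g -> cmeasurable (syn g p c).
Proof.
move=> mg; apply: cmeasurableD; first by apply: cbm_cmeasurable; exact: cbm_ev.
apply: cmeasurableM => //; apply: cbm_cmeasurable.
by apply: cbm_conj; apply: cbmM; [exact: cbm_cir|exact: cbm_ev].
Qed.

Lemma eq_integral_csq f h : cmeasurable f -> cmeasurable h -> aeI (fun x => f x = h x) ->
  (\int[Leb R]_(x in Ihalf R) (csq (f x))%:E = \int[Leb R]_(x in Ihalf R) (csq (h x))%:E)%E.
Proof.
move=> mf mh fh; have F := @Leb_ae_filter R.
apply: (@ae_eq_integral _ _ R mu) => //; [exact: measurable_Ihalf|..].
- by apply/measurable_EFinP; exact: measurable_csq.
- by apply/measurable_EFinP; exact: measurable_csq.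
- by move: fh; rewrite /aeI /ae_eq; apply: filterS => x fh Ix; rewrite fh.
Qed.

Lemma aeI_syn g g' p c : aeI (fun x => g x = g' x) -> aeI (fun x => syn g p c x = syn g' p c x).
Proof. by apply: aeI_imp => x _; rewrite /syn => ->. Qed.

Lemma L2_cbm f : cbm f -> L2 f.
Proof.
move=> bf; split; first exact: cbm_cmeasurable.
by rewrite EFin_I ?ltry//; exact: bm_csq.
Qed.

Lemma L2_ae f h : cmeasurable f -> cbm h -> aeI (fun x => f x = h x) -> L2 f.
Proof.
move=> mf bh fh; split => //.
by rewrite (eq_integral_csq _ h)//; [case: (L2_cbm _ bh)|exact: cbm_cmeasurable].
Qed.

Lemma L2_Fsys g g' n : cmeasurable g -> cbm g' -> aeI (fun x => g x = g' x) -> L2 (Fsys g n).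
Proof.
move=> mg bg' gg'.
have bX k : cbm (fun x : R => cir x ^+ k) by apply: cbmX; exact: cbm_cir.
case: n => k.
  have -> : Fsys g k = (fun x => cir x ^+ k) by apply/funext => x; exact: Fsys_pos.
  exact: L2_cbm.
have -> : Fsys g (Negz k) = (fun x => g x * (cir x ^+ k.+1)^~*).
  by apply/funext => x; exact: Fsys_neg.
apply: (L2_ae _ (fun x => g' x * (cir x ^+ k.+1)^~*)).
- by apply: cmeasurableM => //; apply: cbm_cmeasurable; exact: cbm_conj.
- by apply: cbmM => //; exact: cbm_conj.
- by apply: aeI_imp gg' => x _ ->.
Qed.

Lemma lincomb_fun g N (a : int -> C) :
  lincomb (Fsys g) N a = syn g (\poly_(i < N.+1) a (Posz i)) (\poly_(i < N) (a (Negz i))^~*).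
Proof. by apply/funext => x; exact: lincomb_syn. Qed.

(** All integrals depend only on the class of g almost everywhere, so g may be exchanged here for a
    representative that is bounded, and later bounded below, at every point. *)
Lemma riesz_polyP g g' : cmeasurable g -> cbm g' -> aeI (fun x => g x = g' x) ->
  riesz_basis (Fsys g) <-> riesz_poly g'.
Proof.
move=> mg bg gg'.
have E1 p c : (\int[Leb R]_(x in Ihalf R) (csq (syn g p c x))%:E = (I (fun x => csq (syn g' p c x)))%:E)%E.
  rewrite (eq_integral_csq _ (syn g' p c)).
  - by apply: EFin_I; apply: bm_csq; exact: cbm_syn.
  - exact: cmeasurable_syn.
  - by apply: cmeasurable_syn; exact: cbm_cmeasurable.
  - exact: aeI_syn.
have E2 f p c : cmeasurable f -> L2dist2 f (syn g p c) = L2dist2 f (syn g' p c).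
  move=> mf; apply: eq_integral_csq.
  - by apply: cmeasurableD => //; apply: cmeasurableN; exact: cmeasurable_syn.
  - by apply: cmeasurableD => //; apply: cmeasurableN; apply: cmeasurable_syn; exact: cbm_cmeasurable.
  - by apply: aeI_imp (aeI_syn _ _ p c gg') => x _ ->.
split.
  move=> [_ [dens [A [B [A0 [B0 AB]]]]]]; split.
    move=> f fL2 e e0; have [N [a ha]] := dens f fL2 e e0.
    rewrite lincomb_fun E2 in ha; last by case: fL2.
    by eexists; eexists; exact: ha.
  exists A, B; split => // p c.
  pose N := maxn (size p) (size c).
  have [pE cE] := zip_coefK _ _ _ (leq_maxl (size p) (size c)) (leq_maxr (size p) (size c)).
  have := AB N (zip_coef p c); rewrite lincomb_fun coefsq_hn pE cE E1 !lee_fin.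
  by case.
move=> [dens [A [B [A0 B0 AB]]]]; split; first by move=> n; exact: L2_Fsys bg gg'.
split.
  move=> f fL2 e e0; have [p [c hpc]] := dens f fL2 e e0.
  exists (maxn (size p) (size c)), (zip_coef p c).
  have [pE cE] := zip_coefK _ _ _ (leq_maxl (size p) (size c)) (leq_maxr (size p) (size c)).
  by rewrite lincomb_fun pE cE E2//; case: fL2.
exists A, B; split => //; split => // N a.
rewrite lincomb_fun coefsq_hn E1 !lee_fin; exact: AB.
Qed.

Lemma Linf_cbm g : Linf g -> exists2 g', cbm g' & aeI (fun x => g x = g' x).
Proof.
move=> [mg [M hM]].
have mq := measurable_csq _ mg.
pose A : set R := Ihalf R `&` (fun x => csq (g x)) @^-1` `]-oo, `|M| ^+ 2]%classic.
have mA : measurable A by apply: mq => //; exact: measurable_Ihalf.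
pose i (x : R) : C := (\1_A x)%:C.
have bi : cbm i by apply: cbm_rc; exact: bm_indic.
exists (fun x => g x * i x).
  have [mr mi] := cmeasurableM _ _ mg (cbm_cmeasurable _ bi).
  apply: (cbmI _ `|M|) => // x Ix; rewrite /i indicE.
  have [xA|xA] := boolP (x \in A); last by rewrite mulr0 cabs0.
  rewrite mulr1 cabs_le//; move: xA; rewrite inE /A /= => -[_].
  by rewrite in_itv.
apply: aeI_imp hM => x Ix gM; rewrite /i indicE mem_set ?mulr1//; split => //=.
rewrite in_itv/= -cabs_le//; exact: le_trans (ler_norm _).
Qed.

Lemma cmeasurable_Linf g : Linf g -> cmeasurable g. Proof. by case. Qed.

End PolynomialForm.

(** * Radial limits and approximation in the mean *)

Section Sufficiency.
Context {R : realType}.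
Notation C := R[i].
Implicit Types (f g h G : R -> C) (p c : {poly C}).
Local Notation mu := (lebesgue_measure : {measure set (measurableTypeR R) -> \bar R}).

Lemma I_PK_refl (r x : R) : 0 <= r -> r < 1 -> I (fun t => PoissonK r (x - t)) = 1.
Proof.
move=> r0 r1; have := FuE (fun=> 1) r x (bm_cst 1) r0 r1.
rewrite /Herglotz I_cst; have -> : CauchyT (fun=> 1%:C) (r%:C * cir x) = 1.
  have := Cauchy_poly (1 : {poly C}) (r%:C * cir x); rewrite cabs_rcir// => /(_ r1).
  rewrite hornerC => <-; rewrite /CauchyT; apply: eq_CI => t _; by rewrite /ev hornerC.
move=> /(congr1 (@complex.Re R)) /=; rewrite mulr1 => h.
transitivity (I (fun t => 1 * PoissonK r (x - t))); first by apply: eq_I => t _; rewrite mul1r.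
by rewrite -h; ring.
Qed.

Lemma Re_Fu_bound (u : R -> R) (B r x : R) : bm u -> (forall t, Ihalf R t -> `|u t| <= B) ->
  0 <= r -> r < 1 -> `|complex.Re (Herglotz u (r%:C * cir x))| <= B.
Proof.
move=> bu uB r0 r1; rewrite FuE//=.
have bk : bm (fun t => PoissonK r (x - t)) by apply: bm_reflect_cts; exact: cts_PK.
apply: (le_trans (I_norm _ (bmM _ _ bu bk))).
rewrite -[leRHS]mulr1 -(I_PK_refl r x r0 r1) -IZ//.
apply: le_I => [|| t It]; first by apply: bm_norm; exact: bmM.
  by apply: bmM => //; exact: bm_cst.
by rewrite normrM (ger0_norm (PK_ge0 _ _ r0 r1)) ler_wpM2r ?PK_ge0 ?uB.
Qed.

Lemma analytic_Fu (u : R -> R) : bm u -> analytic (Herglotz u).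
Proof.
move=> bu; apply: (eq_analytic (fun w => 2 * CauchyT (fun t => (u t)%:C) w + - (I u)%:C)) => //.
apply: analyticD; last exact: analytic_cst.
by apply: analyticM; [exact: analytic_cst|apply: analytic_CT; exact: cbm_rc].
Qed.

(* The circle is approached along the radii [1 - dk k]. *)
Definition dk (k : nat) : R := k.+2%:R^-1.

Lemma dk_gt0 k : 0 < dk k. Proof. by rewrite invr_gt0. Qed.
Lemma dk_le k : dk k <= 2^-1. Proof. by rewrite lef_pV2 ?posrE// ler_nat. Qed.
Lemma dk_lt1 k : dk k < 1. Proof. by have := dk_le k; lra. Qed.
Lemma rk_ge0 k : 0 <= 1 - dk k. Proof. by have := dk_lt1 k; lra. Qed.
Lemma rk_lt1 k : 1 - dk k < 1. Proof. by have := dk_gt0 k; lra. Qed.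

Lemma dk_small (d : R) : 0 < d -> exists N, forall k, (N <= k)%N -> dk k < d.
Proof.
move=> d0; exists (Num.bound d^-1) => k Nk.
rewrite /dk invf_plt ?posrE//; apply: lt_le_trans (archi_boundP _) _.
  by rewrite invr_ge0 ltW.
by rewrite ler_nat (leq_trans Nk)// -addn2 leq_addr.
Qed.

Lemma dk_cvg (q : R -> R) (l : R) :
  (forall e : R, 0 < e -> exists2 d0 : R, 0 < d0 & forall d, 0 < d -> d < d0 -> `|q d - l| <= e) ->
  q (dk k) @[k --> \oo] --> l.
Proof.
move=> H; apply/cvgrPdist_le => e e0; have [d0 d00 Hd] := H e e0.
have [N hN] := dk_small _ d00.
by exists N => // k /= Nk; rewrite distrC; apply: Hd; [exact: dk_gt0|exact: hN].
Qed.

Lemma cvg_cabs_ReIm (z : nat -> C) (w : C) :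
  complex.Re (z k) @[k --> \oo] --> complex.Re w ->
  complex.Im (z k) @[k --> \oo] --> complex.Im w -> cabs (z k - w) @[k --> \oo] --> 0.
Proof.
move=> hr hi; apply: (@squeeze_cvgr _ _ _ _ (fun=> 0)
  (fun k => `|complex.Re w - complex.Re (z k)| + `|complex.Im w - complex.Im (z k)|)).
- apply: nearW => k; rewrite cabs_ge0 cabs_distC; apply: (le_trans (cabs_le_ReIm _)).
  by rewrite !ReImE.
- exact: cvg_cst.
- have -> : 0 = `|complex.Re w - complex.Re w| + `|complex.Im w - complex.Im w|.
    by rewrite !subrr normr0 addr0.
  apply: cvgD; apply: cvg_norm; apply: cvgB => //; exact: cvg_cst.
Qed.

Lemma Poisson_dk (u : R -> R) : bm u ->
  aeI (fun x => complex.Re (Herglotz u ((1 - dk k)%:C * cir x)) @[k --> \oo] --> u x).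
Proof.
move=> bu; apply: aeI_imp (leb_pt_ae _ bu) => x _ lp.
apply: (dk_cvg (fun d => complex.Re (Herglotz u ((1 - d)%:C * cir x)))) => e e0.
have [d0 d00 H] := Poisson_cvg _ _ bu lp _ e0.
by exists d0 => // d dp dd; have [] := H d dp dd.
Qed.

Lemma Im_Fu_dk (u uh : R -> R) : bm u -> harmonic_conjugate u uh ->
  aeI (fun x => complex.Im (Herglotz u ((1 - dk k)%:C * cir x)) @[k --> \oo] --> uh x).
Proof.
move=> bu huh.
apply: aeI_imp (aeI_and _ _ (leb_pt_ae _ bu) huh) => x Ix [lp hx].
apply: (dk_cvg (fun d => complex.Im (Herglotz u ((1 - d)%:C * cir x)))) => e e0.
have e2 : 0 < e / 2 by rewrite divr_gt0.
have [d0 d00 H] := conj_cvg _ _ bu lp _ e2.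
have /cvgrPdist_le /(_ _ e2) [d1 /= d10 H1] := hx.
exists (Num.min d0 d1); first by rewrite lt_min d00.
move=> d dp; rewrite lt_min => /andP[dd0 dd1].
have [_ h0] := H d dp dd0.
have := H1 d; rewrite /= sub0r normrN gtr0_norm// => /(_ dd1 dp) h1.
rewrite distrC -[uh x](subrK (conj_trunc u x d)) -addrA.
by apply: (le_trans (ler_normD _ _)); rewrite [e]splitr; apply: lerD.
Qed.

Lemma eq0_of_cvg_bound (z : C) (a : nat -> R) : a k @[k --> \oo] --> 0 -> (forall k, cabs z <= a k) -> z = 0.
Proof.
move=> a0 za; apply/eqP; rewrite -cabs_eq0; apply/eqP/le_anti; rewrite cabs_ge0 andbT.
apply/ler_addgt0Pl => e e0; rewrite addr0.
have /cvgrPdist_le /(_ e e0) [N _ hN] := a0.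
have := hN N (leqnn N); rewrite /= sub0r normrN => h.
by apply: (le_trans (za N)); apply: le_trans h; exact: ler_norm.
Qed.

(** * Boundary values of the exponential of a Herglotz transform *)

Section OuterFunction.
Variables (u : R -> R) (B : R) (G : R -> C) (m : R).
Hypotheses (bu : bm u) (uB : forall t, Ihalf R t -> `|u t| <= B).
Hypotheses (bG : cbm G) (m0 : 0 < m) (mG : forall x, Ihalf R x -> m <= cabs (G x)).
Hypothesis GG : aeI (fun x => cabs (cexp (Herglotz u ((1 - dk k)%:C * cir x)) - G x) @[k --> \oo] --> 0).

Let Gk k x := cexp (Herglotz u ((1 - dk k)%:C * cir x)).
Let bGk k : cbm (Gk k).
Proof.
by apply: (cbm_analytic _ _ (analytic_cexp _ (analytic_Fu _ bu))); [exact: rk_ge0|exact: rk_lt1].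
Qed.

Let Gk_bound k x : cabs (Gk k x) <= expR B.
Proof.
rewrite cabs_cexp ler_expR; apply: le_trans (ler_norm _) _.
by apply: Re_Fu_bound => //; [exact: rk_ge0|exact: rk_lt1].
Qed.

(** Since |Re H| <= B, the functions e^H are uniformly bounded on all circles, so the radial
    convergence to G also holds in norm; on a fixed circle a polynomial is uniformly close to
    e^H. *)
Lemma outer_approx (e : R) : 0 < e -> exists p, nrm (fun x => ev p x - G x) <= e.
Proof.
move=> e0; have e2 : 0 < e / 2 by rewrite divr_gt0.
have h := nrm_dct Gk G (expR B) bGk bG (fun k x _ => Gk_bound k x) GG.
have /cvgrPdist_le /(_ _ e2) [N _ hN] := h.
have := hN N (leqnn N); rewrite /= sub0r normrN ger0_norm ?nrm_ge0// => hk.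
have [p hp] := analytic_cexp _ (analytic_Fu _ bu) _ _ (rk_ge0 N) (rk_lt1 N) e2.
exists (p \Po ((1 - dk N)%:C *: 'X)).
have bp := cbm_ev (p \Po ((1 - dk N)%:C *: 'X)).
rewrite (eq_nrm _ (fun x => (ev (p \Po ((1 - dk N)%:C *: 'X)) x - Gk N x) + (Gk N x - G x))).
  apply: (le_trans (nrmD _ _ _ _)); [exact: cbmB|exact: cbmB|].
  rewrite [e]splitr; apply: lerD => //.
  apply: nrm_bound => [||x Ix]; [exact: ltW|exact: cbmB|].
  by rewrite -horner_rcir cabs_distC; apply: hp; rewrite cabs_rcir ?rk_ge0.
by move=> x _; ring.
Qed.

Let bGV : cbm (fun x => (G x)^-1).
Proof.
apply: (cbmV _ (m ^+ 2) bG); first by rewrite exprn_gt0.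
by move=> x Ix; rewrite -sqr_cabs ler_sqr ?nnegrE ?cabs_ge0 ?(ltW m0)// mG.
Qed.

(** 1/G is likewise a radial limit of analytic functions, namely of e^(-H), and each of them is
    orthogonal to the conjugates of z c(z). *)
Lemma outer_orth c : CI (fun x => (G x)^-1 * (cir x * ev c x)) = 0.
Proof.
pose Hk k x := cexp (- Herglotz u ((1 - dk k)%:C * cir x)).
have aH : analytic (fun w => cexp (- Herglotz u w)).
  apply: analytic_cexp; apply: (eq_analytic (fun w => -1 * Herglotz u w)) => [w _|]; first by rewrite mulN1r.
  by apply: analyticM; [exact: analytic_cst|exact: analytic_Fu].
have bH k : cbm (Hk k) by apply: (cbm_analytic _ _ aH); [exact: rk_ge0|exact: rk_lt1].
have bc : cbm (fun x => cir x * ev c x) by apply: cbmM; [exact: cbm_cir|exact: cbm_ev].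
have HkE k x : Hk k x = (Gk k x)^-1.
  by apply: (mulfI (cexp_neq0 (Herglotz u ((1 - dk k)%:C * cir x)))); rewrite cexpNM divff// cexp_neq0.
have HB k x : cabs (Hk k x) <= expR B.
  rewrite cabs_cexp ler_expR ReImE; apply: le_trans (ler_norm _) _; rewrite normrN.
  by apply: Re_Fu_bound => //; [exact: rk_ge0|exact: rk_lt1].
have h : nrm (fun x => Hk k x - (G x)^-1) @[k --> \oo] --> 0.
  apply: (nrm_dct Hk (fun x => (G x)^-1) (expR B) bH bGV (fun k x _ => HB k x)).
  apply: aeI_imp GG => x Ix hx.
  apply: (@squeeze_cvgr _ _ _ _ (fun=> 0) (fun k => cabs (Gk k x - G x) * (expR B / m))).
  - apply: nearW => k; rewrite cabs_ge0 /= HkE.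
    have g0 : G x != 0 by rewrite -cabs_gt0 (lt_le_trans m0)// mG.
    have gk0 : Gk k x != 0 by exact: cexp_neq0.
    rewrite (_ : _ - _ = (G x - Gk k x) * (Hk k x * (G x)^-1)); last first.
      by rewrite HkE; field; rewrite g0 gk0.
    rewrite cabsM cabs_distC ler_wpM2l ?cabs_ge0// cabsM cabsV.
    apply: ler_pM; rewrite ?cabs_ge0 ?invr_ge0 ?cabs_ge0//.
    by rewrite lef_pV2 ?posrE ?mG// (lt_le_trans m0)// mG.
  - exact: cvg_cst.
  - by rewrite -[0](mul0r (expR B / m)); apply: cvgM => //; exact: cvg_cst.
apply: (eq0_of_cvg_bound _ (fun k => nrm (fun x => Hk k x - (G x)^-1) * nrm (fun x => cir x * ev c x))).
  by rewrite -[0](mul0r (nrm (fun x => cir x * ev c x))); apply: cvgM => //; exact: cvg_cst.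
move=> k; have bHG : cbm (fun x => Hk k x - (G x)^-1) by exact: cbmB.
have <- : cabs (CI (fun x => (Hk k x - (G x)^-1) * (cir x * ev c x))) =
     cabs (CI (fun x => (G x)^-1 * (cir x * ev c x))).
  rewrite (eq_CI _ (fun x => Hk k x * (cir x * ev c x) - (G x)^-1 * (cir x * ev c x))); last first.
    by move=> x _; ring.
  rewrite CIB; [|exact: cbmM|exact: cbmM].
  by rewrite (analytic_orth _ _ _ aH (rk_ge0 k) (rk_lt1 k)) sub0r cabsN.
exact: nrm_CS.
Qed.

End OuterFunction.

Lemma synD g p1 c1 p2 c2 x : syn g (p1 + p2) (c1 + c2) x = syn g p1 c1 x + syn g p2 c2 x.
Proof. by rewrite /syn /ev !hornerD mulrDr conjcD; ring. Qed.

(** The cross term is the integral of z p c, which contains only positive powers of z. *)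
Lemma trig_orth p c : I (fun x => csq (ev p x + (cir x * ev c x)^~*)) = pnorm2 p + pnorm2 c.
Proof.
have bp := cbm_ev p; have bq : cbm (fun x => cir x * ev c x) by apply: cbmM; [exact: cbm_cir|exact: cbm_ev].
have bpq : cbm (fun x => ev p x * (cir x * ev c x)) by exact: cbmM.
have b1 := bm_csq _ bp; have b2 := bm_csq _ (cbm_ev c).
have E : I (fun x => complex.Re (ev p x * (cir x * ev c x))) = 0.
  rewrite -Re_CI (eq_CI _ (fun x => cir x * ev (p * c) x)) ?CI_cir_ev//.
  by move=> x _; rewrite /ev hornerM; ring.
rewrite (eq_I _ (fun x => csq (ev p x) + csq (ev c x) + 2 * complex.Re (ev p x * (cir x * ev c x)))).
  case: bpq => b3 _; rewrite ID; [|exact: bmD|exact: bmM (bm_cst _) _].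
  by rewrite ID// IZ// E mulr0 addr0.
move=> x _; have -> : csq (ev c x) = csq (cir x * ev c x) by rewrite csqM csq_cir mul1r.
by rewrite /csq !ReImE; ring.
Qed.

Lemma conj_ev p x : (ev p x)^~* = (p`_0)^~* + (cir x * ev (\poly_(i < (size p).-1) p`_i.+1) x)^~*.
Proof.
rewrite -conjcD; congr conjc; rewrite /ev.
elim/poly_ind: p => [|p a _]; first by rewrite horner0 coef0 size_poly0 /= poly_def big_ord0 horner0 mulr0 addr0.
rewrite hornerMXaddC coefD coefMX coefC /= add0r addrC; congr (_ + _); rewrite mulrC; congr (_ * _).
have -> : \poly_(i < (size (p * 'X + a%:P)).-1) (p * 'X + a%:P)`_i.+1 = p; last by [].
apply/polyP => i; rewrite coef_poly coefD coefMX coefC /= addr0; case: ltnP => // h.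
rewrite nth_default//; apply: leq_trans h; rewrite size_MXaddC.
by case: ifP => // /andP[/eqP -> _]; rewrite size_poly0.
Qed.

(** Re p1 + i Re p2 = (p1 + i p2)/2 + conj((p1 - i p2)/2): a complex function whose two components
    are real parts of analytic functions is an analytic plus a conjugate analytic function. *)
Lemma average_conj (a1 b1 a2 b2 : R) :
  (2^-1)%:C * (Complex a1 b1 + Complex 0 1 * Complex a2 b2) +
  ((2^-1)%:C * (Complex a1 b1 - Complex 0 1 * Complex a2 b2))^~* = Complex a1 a2.
Proof.
have ReC (a b : R) : complex.Re (Complex a b) = a by [].
have ImC (a b : R) : complex.Im (Complex a b) = b by [].
have mE (a b c d : R) : Complex a b * Complex c d = Complex (a * c - b * d) (a * d + b * c) by [].
rewrite /real_complex_def !mE /=; by congr Complex; rewrite /=; field.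
Qed.

(** The Poisson means of Re f and Im f converge to f in norm, and each is the real part of a
    Herglotz transform, hence uniformly close to the real part of a polynomial. *)
Lemma trig_dense f (e : R) : cbm f -> 0 < e ->
  exists p c, nrm (fun x => f x - (ev p x + (cir x * ev c x)^~*)) <= e.
Proof.
move=> bf e0; have [bu1 bu2] := bf.
pose u1 x := complex.Re (f x); pose u2 x := complex.Im (f x).
pose P k x : C := Complex (complex.Re (Herglotz u1 ((1 - dk k)%:C * cir x))) (complex.Re (Herglotz u2 ((1 - dk k)%:C * cir x))).
have [M M0 fM] := cbm_bounded _ bf.
have uM1 t : Ihalf R t -> `|u1 t| <= M by move=> It; apply: le_trans (fM t It); exact: Re_le_cabs.
have uM2 t : Ihalf R t -> `|u2 t| <= M by move=> It; apply: le_trans (fM t It); exact: Im_le_cabs.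
have bP k : cbm (P k).
  by split => /=; [case: (cbm_analytic _ _ (analytic_Fu _ bu1) (rk_ge0 k) (rk_lt1 k))|
     case: (cbm_analytic _ _ (analytic_Fu _ bu2) (rk_ge0 k) (rk_lt1 k))].
have h : nrm (fun x => P k x - f x) @[k --> \oo] --> 0.
  apply: (nrm_dct P f (M + M)) => // [k x Ix|].
    apply: (le_trans (cabs_le_ReIm _)) => /=.
    by apply: lerD; apply: Re_Fu_bound => //; [exact: rk_ge0|exact: rk_lt1|exact: rk_ge0|exact: rk_lt1].
  apply: aeI_imp (aeI_and _ _ (Poisson_dk _ bu1) (Poisson_dk _ bu2)) => x Ix [h1 h2].
  exact: cvg_cabs_ReIm.
have e3 : 0 < e / 3 by rewrite divr_gt0.
have /cvgrPdist_le /(_ _ e3) [N _ hN] := h.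
have := hN N (leqnn N); rewrite /= sub0r normrN ger0_norm ?nrm_ge0// => hk.
have [q1 hq1] := analytic_Fu _ bu1 _ _ (rk_ge0 N) (rk_lt1 N) e3.
have [q2 hq2] := analytic_Fu _ bu2 _ _ (rk_ge0 N) (rk_lt1 N) e3.
pose i : C := Complex 0 1.
pose p1 := q1 \Po ((1 - dk N)%:C *: 'X); pose p2 := q2 \Po ((1 - dk N)%:C *: 'X).
pose a : {poly C} := (2^-1)%:C *: (p1 + i *: p2); pose b : {poly C} := (2^-1)%:C *: (p1 - i *: p2).
pose b' := \poly_(i < (size b).-1) b`_i.+1.
(* The conjugate part must be of the form conj(z c(z)), so the constant term of b moves to the
   analytic side. *)
exists (a + ((b`_0)^~*)%:P), b'.
have ba := cbm_ev a; have bb := cbm_ev b.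
have bab : cbm (fun x => ev a x + (ev b x)^~*) by apply: cbmD => //; exact: cbm_conj.
rewrite (eq_nrm _ (fun x => (f x - P N x) + (P N x - (ev a x + (ev b x)^~*)))); last first.
  by move=> x _; rewrite conj_ev {1}/ev hornerD hornerC; rewrite -/b' -/(ev a x); ring.
apply: (le_trans (nrmD _ _ _ _)); [exact: cbmB|exact: cbmB|].
rewrite (_ : e = e / 3 + (e / 3 + e / 3)); last by field.
apply: lerD.
  by rewrite -nrmN (eq_nrm _ (fun x => P N x - f x)) // => x _; rewrite opprB.
apply: nrm_bound => [||x Ix]; [by rewrite addr_ge0 ?ltW|exact: cbmB|].
have r0 := rk_ge0 N.
have h1 := hq1 _ (eq_ind_r (fun z => z <= 1 - dk N) (lexx _) (cabs_rcir (1 - dk N) x r0)).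
have h2 := hq2 _ (eq_ind_r (fun z => z <= 1 - dk N) (lexx _) (cabs_rcir (1 - dk N) x r0)).
rewrite !horner_rcir -/p1 -/p2 in h1 h2.
apply: (le_trans (cabs_le_ReIm _)).
have -> : ev a x + (ev b x)^~* = Complex (complex.Re (ev p1 x)) (complex.Re (ev p2 x)).
  rewrite /a /b /ev !hornerZ !hornerD !hornerN !hornerZ.
  move: (p1.[_]) (p2.[_]) => [a1 b1] [a2 b2].
  exact: average_conj.
rewrite !ReImE /=; apply: lerD.
  by apply: le_trans h1; apply: le_trans (Re_le_cabs _); rewrite !ReImE.
by apply: le_trans h2; apply: le_trans (Re_le_cabs _); rewrite !ReImE.
Qed.

(** * Riesz bounds and density when g/G and g conj(G) lie in a sector *)

Section Factorization.
Variables (g G : R -> C) (M K : R) (rho : C) (delta Y : R).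
Hypotheses (bg : cbm g) (M0 : 0 <= M) (gM : forall x, Ihalf R x -> cabs (g x) <= M).
Hypotheses (bG : cbm G) (K0 : 0 < K) (GK : forall x, Ihalf R x -> cabs ((G x)^-1) <= K).
Hypothesis bGV : cbm (fun x => (G x)^-1).
Hypotheses (rho1 : cabs rho = 1) (d0 : 0 < delta).
Hypothesis gGd : forall x, Ihalf R x -> delta <= complex.Re (rho * (g x * (G x)^-1)).
Hypothesis gGY : forall x, Ihalf R x -> delta <= complex.Re (rho * (g x * (G x)^~*)).
Hypothesis HY : forall x, Ihalf R x -> cabs (rho * (g x * (G x)^~*)) <= Y.
Hypothesis HG1 : forall e : R, 0 < e -> exists p, nrm (fun x => ev p x - G x) <= e.
Hypothesis HG2 : forall c, CI (fun x => (G x)^-1 * (cir x * ev c x)) = 0.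

Let bq c : cbm (fun x => cir x * ev c x).
Proof. by apply: cbmM; [exact: cbm_cir|exact: cbm_ev]. Qed.

Lemma sqr_nrm_ev p : nrm (ev p) ^+ 2 = pnorm2 p. Proof. exact: sqr_nrm. Qed.
Lemma nrm_cir_ev c : nrm (fun x => cir x * ev c x) = nrm (ev c).
Proof. by congr Num.sqrt; apply: eq_I => x _; rewrite csqM csq_cir mul1r. Qed.

(* Dividing by G and pairing with [z c(z)] annihilates the analytic part [p / G]. *)
Lemma factor_lower_c p c : delta * nrm (ev c) <= K * nrm (syn g p c).
Proof.
have bs := cbm_syn _ p c bg.
have bsG : cbm (fun x => syn g p c x * (G x)^-1) by exact: cbmM.
have h1 : cabs (CI (fun x => syn g p c x * (G x)^-1 * (cir x * ev c x))) <=
    K * nrm (syn g p c) * nrm (ev c).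
  apply: (le_trans (nrm_CS _ _ bsG (bq c))).
  rewrite nrm_cir_ev ler_wpM2r ?nrm_ge0//; apply: nrm_le => //; first exact: ltW.
  by move=> x Ix; rewrite cabsM mulrC ler_wpM2r ?cabs_ge0// GK.
have bgG : cbm (fun x => rho * (g x * (G x)^-1)) by apply: cbmM (cbm_cst _) _; exact: cbmM.
have h2 : delta * nrm (ev c) ^+ 2 <=
    complex.Re (rho * CI (fun x => syn g p c x * (G x)^-1 * (cir x * ev c x))).
  rewrite -CIZ; last by apply: cbmM => //.
  have bX : cbm (fun x => rho * (g x * (G x)^-1) * (csq (ev c x))%:C).
    by apply: cbmM => //; apply: cbm_rc; apply: bm_csq; exact: cbm_ev.
  rewrite (eq_CI _ (fun x => rho * ((G x)^-1 * (cir x * ev (p * c) x)) +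
     rho * (g x * (G x)^-1) * (csq (ev c x))%:C)); last first.
    move=> x _; have -> : (csq (ev c x))%:C = (cir x * ev c x)^~* * (cir x * ev c x).
      by rewrite [RHS]mulrC -csqE csqM csq_cir mul1r.
    by rewrite /syn /ev hornerM; ring.
  have bY : cbm (fun x => (G x)^-1 * (cir x * ev (p * c) x)) by exact: cbmM.
  rewrite CID//; last exact: cbmM (cbm_cst _) _.
  rewrite CIZ// HG2 mulr0 add0r Re_CI sqr_nrm -IZ; last by apply: bm_csq; exact: cbm_ev.
  apply: le_I => [|| x Ix].
  - by apply: bmM (bm_cst _) _; apply: bm_csq; exact: cbm_ev.
  - by case: bX.
  - by rewrite cReM Re_rc Im_rc mulr0 subr0 ler_wpM2r ?csq_ge0// gGd.
have h3 := le_trans h2 (Re_le _); rewrite cabsM rho1 mul1r in h3.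
have h4 := le_trans h3 h1; rewrite expr2 mulrA in h4.
have [c0|c0] : nrm (ev c) = 0 \/ 0 < nrm (ev c).
  by have := nrm_ge0 (ev c); rewrite le_eqVlt => /predU1P[<-|]; [left|right].
- by rewrite c0 mulr0 mulr_ge0 ?nrm_ge0 ?ltW.
- by rewrite -(ler_pM2r c0).
Qed.

Lemma nrm_syn_le p c : nrm (syn g p c) <= nrm (ev p) + M * nrm (ev c).
Proof.
have bgc : cbm (fun x => g x * (cir x * ev c x)^~*) by apply: cbmM => //; exact: cbm_conj.
apply: (le_trans (nrmD _ _ (cbm_ev p) bgc)); rewrite lerD2l.
rewrite -[nrm (ev c)]nrm_cir_ev -[X in M * X]nrm_conj; apply: nrm_le => //.
  by apply: cbm_conj; exact: bq.
by move=> x Ix; rewrite cabsM ler_wpM2r ?cabs_ge0// gM.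
Qed.

Lemma nrm_ev_le p c : nrm (ev p) <= nrm (syn g p c) + M * nrm (ev c).
Proof.
have bgc : cbm (fun x => g x * (cir x * ev c x)^~*) by apply: cbmM => //; exact: cbm_conj.
have -> : nrm (ev p) = nrm (fun x => syn g p c x - g x * (cir x * ev c x)^~*).
  by apply: eq_nrm => x _; rewrite /syn addrK.
apply: (le_trans (nrmB _ _ (cbm_syn _ p c bg) bgc)); rewrite lerD2l.
rewrite -[nrm (ev c)]nrm_cir_ev -[X in M * X]nrm_conj; apply: nrm_le => //.
  by apply: cbm_conj; exact: bq.
by move=> x Ix; rewrite cabsM ler_wpM2r ?cabs_ge0// gM.
Qed.

Lemma factor_bounds : exists A B : R, [/\ 0 < A, 0 < B & forall p c,
  A * (pnorm2 p + pnorm2 c) <= I (fun x => csq (syn g p c x)) /\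
  I (fun x => csq (syn g p c x)) <= B * (pnorm2 p + pnorm2 c)].
Proof.
pose L := K / delta; have L0 : 0 < L by rewrite divr_gt0.
have q0 : 0 < (1 + M * L) ^+ 2 + L ^+ 2 by rewrite ltr_wpDl ?sqr_ge0// exprn_gt0.
exists ((1 + M * L) ^+ 2 + L ^+ 2)^-1, (2 + 2 * M ^+ 2); split.
- by rewrite invr_gt0.
- by have := sqr_ge0 M; lra.
move=> p c; rewrite -sqr_nrm -!sqr_nrm_ev.
have s0 := nrm_ge0 (syn g p c); have p0 := nrm_ge0 (ev p); have c0 := nrm_ge0 (ev c).
have hc : nrm (ev c) <= L * nrm (syn g p c).
  by rewrite /L mulrAC ler_pdivlMr// mulrC; exact: factor_lower_c.
have hp : nrm (ev p) <= (1 + M * L) * nrm (syn g p c).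
  apply: (le_trans (nrm_ev_le p c)); rewrite mulrDl mul1r lerD2l -mulrA.
  exact: ler_wpM2l.
split.
  rewrite mulrC ler_pdivrMr// mulrC mulrDl; apply: lerD.
    by rewrite -exprMn ler_sqr ?nnegrE// mulr_ge0// addr_ge0// mulr_ge0// ltW.
  by rewrite -exprMn ler_sqr ?nnegrE// mulr_ge0// ltW.
apply: (@le_trans _ _ ((nrm (ev p) + M * nrm (ev c)) ^+ 2)).
  by rewrite ler_sqr ?nnegrE ?addr_ge0 ?mulr_ge0// nrm_syn_le.
have := sqr_ge0 (nrm (ev p) - M * nrm (ev c)); have := sqr_ge0 M.
have := sqr_ge0 (nrm (ev p)); have := sqr_ge0 (nrm (ev c)).
move: (nrm (ev p)) (nrm (ev c)) => a b ? ? ? ?.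
have : 0 <= M ^+ 2 * a ^+ 2 by rewrite mulr_ge0.
by lra.
Qed.

Lemma Y_gt0 : delta <= Y.
Proof.
have I0 : Ihalf R 0 by apply/Ihalf_itv/andP; split; lra.
by apply: le_trans (HY _ I0); apply: le_trans (Re_le _); exact: gGY.
Qed.

(** For Re y >= delta and |y| <= Y one has |1 - lam y|^2 <= 1 - 2 lam delta + lam^2 Y^2. This [lam]
    minimises the right side, and [kap] is the square root of the minimum. *)
Let lam := delta / Y ^+ 2.
Let kap := Num.sqrt (1 - delta ^+ 2 / Y ^+ 2).

Lemma kap_bounds : 0 <= kap < 1.
Proof.
have yp : 0 < Y by exact: lt_le_trans d0 Y_gt0.
have q : 0 < delta ^+ 2 / Y ^+ 2 by rewrite divr_gt0// exprn_gt0.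
by rewrite sqrtr_ge0 /= -[ltRHS]sqrtr1 ltr_sqrt// gtrBl.
Qed.

Lemma kap_contr x : Ihalf R x -> cabs (1 - lam%:C * (rho * (g x * (G x)^~*))) <= kap.
Proof.
move=> Ix; set y := rho * _.
have yp : 0 < Y by exact: lt_le_trans d0 Y_gt0.
have h1 := gGY _ Ix; have h2 := HY _ Ix; rewrite -/y in h1 h2.
have c2 : csq y <= Y ^+ 2 by rewrite -cabs_le// ltW.
rewrite cabs_le ?sqrtr_ge0// sqr_sqrtr; last first.
  rewrite subr_ge0 ler_pdivrMr ?exprn_gt0// mul1r ler_sqr ?nnegrE ?(ltW d0) ?(ltW yp)//.
  exact: Y_gt0.
have l0 : 0 <= lam by rewrite divr_ge0 ?sqr_ge0// ltW.
have -> : csq (1 - lam%:C * y) = 1 - 2 * lam * complex.Re y + lam ^+ 2 * csq y.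
  by rewrite /csq !ReImE /=; ring.
have lY : lam ^+ 2 * csq y <= lam * delta.
  rewrite expr2 -mulrA ler_wpM2l// /lam.
  by rewrite mulrAC ler_pdivrMr ?exprn_gt0// ler_wpM2l// ltW.
have -> : delta ^+ 2 / Y ^+ 2 = lam * delta by rewrite /lam; field; rewrite gt_eqF.
have : lam * delta <= lam * complex.Re y by rewrite ler_wpM2l.
by lra.
Qed.

(* Write f as [ev a + (z b)^~*] up to a small error. Since [ev p] is close to G, subtracting
   [syn g a (lam rho^~* p b)] leaves [(1 - lam rho g G^~* ) (z b)^~*], a contraction of the
   second term. *)
Lemma factor_step f (e : R) : cbm f -> 0 < e ->
  exists p c, nrm (fun x => f x - syn g p c x) <= kap * nrm f + e.
Proof.
move=> bf e0; have /andP[k0 k1] := kap_bounds.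
have e3 : 0 < e / 3 by rewrite divr_gt0.
have [a [b hab]] := trig_dense _ _ bf e3.
pose tau x := ev a x + (cir x * ev b x)^~*.
have bb : cbm (fun x => (cir x * ev b x)^~*) by apply: cbm_conj; exact: bq.
have btau : cbm tau by apply: cbmD => //; exact: cbm_ev.
have nb : nrm (ev b) <= nrm tau.
  rewrite -ler_sqr ?nnegrE ?nrm_ge0// sqr_nrm_ev sqr_nrm trig_orth lerDr.
  exact: I_csq_ge0.
have ntau : nrm tau <= nrm f + e / 3.
  rewrite (eq_nrm _ (fun x => f x - (f x - tau x))) => [|x _]; last by ring.
  by apply: (le_trans (nrmB _ _ bf (cbmB _ _ bf btau))); rewrite lerD2l.
have [Bb Bb0 hB] := cbm_bounded _ bb.
have l0 : 0 <= lam by rewrite divr_ge0 ?sqr_ge0// ltW.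
pose W := lam * M * Bb + 1.
have W0 : 0 < W by rewrite ltr_wpDl// mulr_ge0// mulr_ge0.
have eW : 0 < e / 3 / W by rewrite !divr_gt0.
have [p hp] := HG1 _ eW.
exists a, ((lam%:C * rho^~*) *: (p * b)).
have synE x : syn g a ((lam%:C * rho^~*) *: (p * b)) x =
    ev a x + lam%:C * rho * g x * (ev p x)^~* * (cir x * ev b x)^~*.
  rewrite /syn /ev hornerZ hornerM; congr (_ + _).
  by rewrite !conjcM conjcK (_ : (lam%:C)^~* = lam%:C) ?conjc_real//; ring.
have b1 : cbm (fun x => f x - tau x) by exact: cbmB.
have b2 : cbm (fun x => (1 - lam%:C * (rho * (g x * (G x)^~*))) * (cir x * ev b x)^~*).
  apply: cbmM => //; apply: cbmB (cbm_cst _) _; do 2 apply: cbmM (cbm_cst _) _.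
  by apply: cbmM => //; exact: cbm_conj.
have b3 : cbm (fun x => lam%:C * rho * g x * (cir x * ev b x)^~* * (ev p x - G x)^~*).
  apply: cbmM; last by apply: cbm_conj; apply: cbmB => //; exact: cbm_ev.
  by apply: cbmM => //; apply: cbmM => //; exact: cbm_cst.
have b4 : cbm (fun x => ev p x - G x) by apply: cbmB => //; exact: cbm_ev.
rewrite (eq_nrm _ (fun x => (f x - tau x) +
   ((1 - lam%:C * (rho * (g x * (G x)^~*))) * (cir x * ev b x)^~*
   - lam%:C * rho * g x * (cir x * ev b x)^~* * (ev p x - G x)^~*))); last first.
  by move=> x _; rewrite synE /tau conjcB; ring.
apply: (le_trans (nrmD _ _ b1 (cbmB _ _ b2 b3))).
have h1 : nrm (fun x => (1 - lam%:C * (rho * (g x * (G x)^~*))) * (cir x * ev b x)^~*) <= kap * nrm (ev b).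
  rewrite -(nrm_cir_ev b) -[X in kap * X]nrm_conj; apply: nrm_le => // x Ix.
  by rewrite cabsM ler_wpM2r ?cabs_ge0// kap_contr.
have h2 : nrm (fun x => lam%:C * rho * g x * (cir x * ev b x)^~* * (ev p x - G x)^~*) <=
    lam * M * Bb * nrm (fun x => ev p x - G x).
  apply: nrm_le => //; first by rewrite mulr_ge0// mulr_ge0.
  move=> x Ix; rewrite !cabsM cabs_conj ler_wpM2r ?cabs_ge0// rho1 mulr1 cabs_rc (ger0_norm l0).
  apply: ler_pM; rewrite ?cabs_ge0 ?(mulr_ge0 l0) ?cabs_ge0 ?hB//.
  by apply: ler_wpM2l => //; exact: gM.
have h3 : lam * M * Bb * nrm (fun x => ev p x - G x) <= e / 3.
  apply: (@le_trans _ _ (W * (e / 3 / W))).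
    apply: ler_pM => //; [by apply: mulr_ge0 => //; exact: mulr_ge0|exact: nrm_ge0|by rewrite /W lerDl].
  by rewrite mulrC divfK// gt_eqF.
have h4 : kap * nrm (ev b) <= kap * nrm f + e / 3.
  apply: (@le_trans _ _ (kap * (nrm f + e / 3))).
    by apply: ler_wpM2l => //; exact: le_trans ntau.
  by rewrite mulrDr lerD2l ler_piMl// ltW.
apply: (le_trans (lerD hab (nrmB _ _ b2 b3))).
apply: (le_trans (lerD (lexx _) (lerD (le_trans h1 h4) (le_trans h2 h3)))).
by rewrite le_eqVlt; apply/orP; left; apply/eqP; field.
Qed.

(** [factor_step] is applied again to the residual; the tolerance e/2 of the first step is only
    shrunk by later contractions, so the tolerances never exceed e in total. *)
Lemma factor_dense_cbm f n (e : R) : cbm f -> 0 < e ->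
  exists p c, nrm (fun x => f x - syn g p c x) <= kap ^+ n * nrm f + e.
Proof.
have /andP[k0 k1] := kap_bounds.
elim: n f e => [|n IH] f e bf e0.
  exists 0, 0; rewrite expr0 mul1r (eq_nrm _ f); first by rewrite lerDl ltW.
  by move=> x _; rewrite /syn /ev !horner0 mulr0 (_ : 0^~* = 0) ?conjc0// mulr0 addr0 subr0.
have e2 : 0 < e / 2 by rewrite divr_gt0.
have [p1 [c1 h1]] := factor_step _ _ bf e2.
have bf1 : cbm (fun x => f x - syn g p1 c1 x) by apply: cbmB => //; exact: cbm_syn.
have [p2 [c2 h2]] := IH _ _ bf1 e2.
exists (p1 + p2), (c1 + c2).
rewrite (eq_nrm _ (fun x => (f x - syn g p1 c1 x) - syn g p2 c2 x)); last first.
  by move=> x _; rewrite synD; ring.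
apply: (le_trans h2); have kn : kap ^+ n <= 1 by apply: exprn_ile1 => //; exact: ltW.
have kn0 : 0 <= kap ^+ n by exact: exprn_ge0.
have := ler_wpM2l kn0 h1; rewrite exprSr mulrDr mulrA.
have : kap ^+ n * (e / 2) <= 1 * (e / 2) by rewrite ler_wpM2r// ltW.
by lra.
Qed.

End Factorization.

Lemma L2_truncate f : L2 f -> forall e : R, 0 < e ->
  exists2 h, cbm h & (L2dist2 f h < e%:E)%E.
Proof.
move=> [mf fL2] e e0; have mq := measurable_csq _ mf.
pose A (n : nat) : set R := Ihalf R `&` (fun x => csq (f x)) @^-1` `]-oo, n%:R ^+ 2]%classic.
have mA n : measurable (A n) by apply: mq => //; exact: measurable_Ihalf.
pose i n (x : R) : C := (\1_(A n) x)%:C.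
have bi n : cbm (i n) by apply: cbm_rc; exact: bm_indic.
pose F n x := f x * i n x.
have bF n : cbm (F n).
  have [mr mi] := cmeasurableM _ _ mf (cbm_cmeasurable _ (bi n)).
  apply: (cbmI _ n%:R) => // x Ix; rewrite /F /i indicE.
  have [xA|xA] := boolP (x \in A n); last by rewrite mulr0 cabs0.
  rewrite mulr1 cabs_le//; move: xA; rewrite inE /A /= => -[_].
  by rewrite in_itv.
have mFn n : cmeasurable (fun x => f x - F n x).
  by apply: cmeasurableD => //; apply: cmeasurableN; exact: cbm_cmeasurable.
have fin : (Leb R).-integrable (Ihalf R) (fun x => (csq (f x))%:E).
  apply/integrableP; split; first exact/measurable_EFinP.
  apply: le_lt_trans fL2; rewrite le_eqVlt; apply/orP; left; apply/eqP.
  by apply: eq_integral => x _; rewrite gee0_abs// lee_fin csq_ge0.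
have Fi := @Leb_ae_filter R.
have FfE n x : Ihalf R x -> csq (f x) <= n%:R ^+ 2 -> F n x = f x.
  by move=> Ix h; rewrite /F /i indicE mem_set ?mulr1.
have [|||||_ _] := @dominated_convergence _ _ R mu (Ihalf R) measurable_Ihalf
  (fun n x => (csq (f x - F n x))%:E) (fun=> 0%E) (fun x => (csq (f x))%:E).
- by move=> n; apply/measurable_EFinP; exact: measurable_csq.
- exact: measurable_cst.
- apply: nearW => x Ix; apply: cvg_near_cst.
  exists (Num.bound (csq (f x))) => // n /= pnorm2.
  rewrite FfE ?subrr ?csq0//.
  have h1 := archi_boundP (csq_ge0 (f x)).
  have h2 : (Num.bound (csq (f x)))%:R <= n%:R :> R by rewrite ler_nat.
  have h3 : n%:R <= n%:R ^+ 2 :> R.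
    by rewrite -natrX ler_nat -mulnn; case: (n) => // k; rewrite leq_pmulr.
  by apply: ltW; apply: lt_le_trans h3; exact: lt_le_trans h2.
- exact: fin.
- apply: nearW => x n Ix; rewrite gee0_abs ?lee_fin ?csq_ge0//.
  rewrite /F /i indicE; case: (x \in A n); first by rewrite mulr1 subrr csq0 csq_ge0.
  by rewrite mulr0 subr0.
rewrite integral0 => /fine_cvgP[hfin /cvgrPdist_lt /(_ e e0) hd].
have [N1 _ H1] := hfin; have [N2 _ H2] := hd.
pose N := maxn N1 N2; exists (F N) => //.
have := H2 N (leq_maxr N1 N2); rewrite /= sub0r normrN => h.
rewrite /L2dist2 -[X in (X < _)%E]fineK ?lte_fin; last by apply: H1; exact: leq_maxl.
by apply: le_lt_trans h; exact: ler_norm.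
Qed.

Lemma riesz_dense_L2 g : cbm g ->
  (forall f, cbm f -> forall e : R, 0 < e -> exists p c, nrm (fun x => f x - syn g p c x) <= e) ->
  forall f, L2 f -> forall e : R, 0 < e -> exists p c, (L2dist2 f (syn g p c) < e%:E)%E.
Proof.
move=> bg H f fL2 e e0; have e4 : 0 < e / 4 by rewrite divr_gt0.
have [h bh hh] := L2_truncate _ fL2 _ e4.
(* By |a + b|^2 <= 2 |a|^2 + 2 |b|^2 the total error is less than 2 (e/4) + 2 (e/8) < e. *)
pose q := Num.sqrt (e / 8).
have q0 : 0 < q by rewrite sqrtr_gt0 divr_gt0.
have [p [c hpc]] := H h bh q q0.
exists p, c.
have bs := cbm_syn _ p c bg; have [mf _] := fL2.
have mh := cbm_cmeasurable _ bh; have ms := cbm_cmeasurable _ bs.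
have bhs : cbm (fun x => h x - syn g p c x) by exact: cbmB.
have mfh : cmeasurable (fun x => f x - h x) by apply: cmeasurableD => //; exact: cmeasurableN.
have m1 : measurable_fun (Ihalf R) (fun x => (csq (f x - h x))%:E).
  by apply/measurable_EFinP; exact: measurable_csq.
have m2 : measurable_fun (Ihalf R) (fun x => (csq (h x - syn g p c x))%:E).
  by apply/measurable_EFinP; apply: measurable_csq; exact: cbm_cmeasurable.
apply: (@le_lt_trans _ _ (2%:E * L2dist2 f h + 2%:E * (I (fun x => csq (h x - syn g p c x)))%:E)%E).
  rewrite -(EFin_I _ (bm_csq _ bhs)) /L2dist2.
  rewrite -ge0_integralZl ?lee_fin//; [|exact: measurable_Ihalf|by move=> x _; rewrite lee_fin csq_ge0].
  rewrite -ge0_integralZl ?lee_fin//; [|exact: measurable_Ihalf|by move=> x _; rewrite lee_fin csq_ge0].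
  rewrite -ge0_integralD//; last 5 first.
  - exact: measurable_Ihalf.
  - by move=> x _; rewrite mule_ge0 ?lee_fin ?csq_ge0.
  - by apply: measurable_funeM.
  - by move=> x _; rewrite mule_ge0 ?lee_fin ?csq_ge0.
  - by apply: measurable_funeM.
  apply: ge0_le_integral => //.
  - exact: measurable_Ihalf.
  - by move=> x _; rewrite lee_fin csq_ge0.
  - apply/measurable_EFinP; apply: measurable_csq; apply: cmeasurableD => //; exact: cmeasurableN.
  - by apply: emeasurable_funD; exact: measurable_funeM.
  move=> x Ix; rewrite -!EFinM -EFinD lee_fin.
  rewrite (_ : f x - _ = (f x - h x) + (h x - syn g p c x)); last by ring.
  exact: le_csqD.
have hq : I (fun x => csq (h x - syn g p c x)) <= e / 8.
  rewrite -sqr_nrm -[leRHS]sqr_sqrtr; last by rewrite divr_ge0// ltW.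
  by rewrite ler_sqr ?nnegrE ?nrm_ge0 ?sqrtr_ge0.
have d0 : (0 <= L2dist2 f h)%E by apply: integral_ge0 => x _; rewrite lee_fin csq_ge0.
have dfin : L2dist2 f h \is a fin_num by rewrite ge0_fin_numE// (lt_trans hh)// ltry.
rewrite -(fineK dfin) in hh *; rewrite lte_fin in hh.
by rewrite -!EFinM -EFinD lte_fin; lra.
Qed.

End Sufficiency.

(** * From the representation of g/|g| to the Riesz basis *)

Section HelsonSzego.
Context {R : realType}.
Notation C := R[i].
Implicit Types (f g h G : R -> C).

(** Where |g| < m, a null set, the value of g is replaced by 1; hence the condition m <= 1. *)
Lemma cbm_bounded_below g (m : R) : cbm g -> 0 < m -> m <= 1 -> aeI (fun x => m <= cabs (g x)) ->
  exists g', [/\ cbm g', aeI (fun x => g x = g' x) & forall x, Ihalf R x -> m <= cabs (g' x)].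
Proof.
move=> bg m0 m1 hm; have [mq _] := bm_csq _ bg.
pose A : set R := Ihalf R `&` (fun x => csq (g x)) @^-1` `[m ^+ 2, +oo[%classic.
have mA : measurable A by apply: mq => //; exact: measurable_Ihalf.
pose i (x : R) : C := (\1_A x)%:C.
have bi : cbm i by apply: cbm_rc; exact: bm_indic.
have iE x : m <= cabs (g x) -> Ihalf R x -> i x = 1.
  move=> h Ix; rewrite /i indicE mem_set//; split => //=.
  by rewrite in_itv/= andbT -sqr_cabs ler_sqr ?nnegrE ?cabs_ge0 ?(ltW m0).
exists (fun x => g x * i x + (1 - i x)); split.
- apply: cbmD; first exact: cbmM.
  by apply: cbmB => //; exact: cbm_cst.
- by apply: aeI_imp hm => x Ix /iE ->//; ring.
move=> x Ix; have [h|h] := leP m (cabs (g x)); first by rewrite iE// mulr1 subrr addr0.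
rewrite /i indicE memNset; first by rewrite mulr0 subr0 add0r cabs1.
by move=> -[_] /=; rewrite in_itv /= andbT -sqr_cabs ler_sqr ?nnegrE ?cabs_ge0 ?(ltW m0)// leNgt h.
Qed.

Lemma cos_ge (v d : R) : d < pi / 2 -> `|v| <= d -> cos d <= cos v.
Proof.
move=> dp vd; have pi0 := pi_gt0 R.
have <- : cos `|v| = cos v by case: (ger0P v) => // _; rewrite cosN.
have v0 := normr_ge0 v; have [vld|h|<-//] := ltgtP `|v| d.
  by apply: ltW; rewrite ltr_cos// in_itv /=; lra.
by move: vd; rewrite leNgt h.
Qed.

Lemma cbm_expi (v : R -> R) : bm v -> cbm (fun x => expi (v x)).
Proof. by move=> bv; split; apply: bm_comp => //; [exact: continuous_cos|exact: continuous_sin]. Qed.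

Lemma cexp_cvg (z : nat -> C) (a b : R) :
  complex.Re (z k) @[k --> \oo] --> a -> complex.Im (z k) @[k --> \oo] --> b ->
  cabs (cexp (z k) - (expR a)%:C * expi b) @[k --> \oo] --> 0.
Proof.
move=> ha hb.
have h1 : expR (complex.Re (z k)) @[k --> \oo] --> expR a by apply: continuous_cvg => //; exact: continuous_expR.
have h2 : cos (complex.Im (z k)) @[k --> \oo] --> cos b by apply: continuous_cvg => //; exact: continuous_cos.
have h3 : sin (complex.Im (z k)) @[k --> \oo] --> sin b by apply: continuous_cvg => //; exact: continuous_sin.
apply: cvg_cabs_ReIm; rewrite /cexp !mul_rc /=.
  rewrite (_ : (fun k => _) = (fun k => expR (complex.Re (z k)) * cos (complex.Im (z k)))).
    exact: cvgM.
  by apply/funext => k; rewrite mul0r subr0.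
rewrite (_ : (fun k => _) = (fun k => expR (complex.Re (z k)) * sin (complex.Im (z k)))).
  exact: cvgM.
by apply/funext => k; rewrite mul0r addr0.
Qed.

Lemma Helson_Szego_riesz g (m c d : R) (u v uh : R -> R) :
  cbm g -> 0 < m -> (forall x, Ihalf R x -> m <= cabs (g x)) ->
  bm u -> bm v -> d < pi / 2 -> (forall x, Ihalf R x -> `|v x| <= d) ->
  harmonic_conjugate u uh ->
  aeI (fun x => g x / (cabs (g x))%:C = expi (uh x + v x + c)) -> riesz_poly g.
Proof.
move=> bg m0 mg bu bv dp vd hu gE.
have [M M0 gM] := cbm_bounded _ bg; have [B uB] := bu.2.
have [I0 d0] : Ihalf R 0 /\ 0 <= d.
  have I0 : Ihalf R 0 by apply/Ihalf_itv/andP; split; lra.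
  by split => //; apply: le_trans (vd _ I0); exact: normr_ge0.
have cd : 0 < cos d by apply: cos_gt0_pihalf; rewrite dp andbT; have := pi_gt0 R; lra.
have Mm : m <= M by apply: le_trans (gM _ I0); exact: mg.
pose s x := g x * ((cabs (g x))^-1)%:C.
(* By hypothesis this equals e^(u + i uh) almost everywhere. Writing it through g/|g| and v makes G
   bounded and measurable without any regularity of uh, and the sector conditions then hold at every
   point. *)
pose G x := (expR (u x))%:C * (s x * expi (- (v x + c))).
pose rho : C := expi (- c).
have a0 x : Ihalf R x -> 0 < cabs (g x) by move=> Ix; exact: lt_le_trans (mg _ Ix).
have sg x : Ihalf R x -> g x * (s x)^~* = (cabs (g x))%:C.
  move=> Ix; rewrite /s conjcM mulrA -csqE conjc_real -sqr_cabs -rmorphM/=.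
  by congr (_%:C); rewrite expr2 mulfK// gt_eqF// a0.
have ss x : Ihalf R x -> s x * (s x)^~* = 1.
  move=> Ix; rewrite {1}/s mulrAC sg// -rmorphM/= mulfV// gt_eqF// a0//.
have csqs x : Ihalf R x -> csq (s x) = 1.
  by move=> Ix; have := ss x Ix; rewrite -csqE => /(congr1 (@complex.Re R)).
have cabsG x : Ihalf R x -> cabs (G x) = expR (u x).
  move=> Ix; have cs : cabs (s x) = 1 by rewrite /cabs csqs// sqrtr1.
  rewrite /G; move: (s x) cs => w cs.
  by rewrite !cabsM cabs_expi cs !mulr1 cabs_rc ger0_norm ?expR_ge0.
have cosE x : cos (v x) = complex.Re (expi (v x)) by [].
have bG : cbm G.
  apply: cbmM; first by apply: cbm_rc; apply: bm_comp => //; exact: continuous_expR.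
  apply: cbmM.
    by apply: cbmM => //; apply: cbm_rc; exact: (bmV _ m (bm_cabs _ bg) m0 mg).
  by apply: cbm_expi; apply: bmN; apply: bmD => //; exact: bm_cst.
have GB x : Ihalf R x -> expR (- B) <= cabs (G x).
  by move=> Ix; rewrite cabsG// ler_expR; have := uB _ Ix; rewrite ler_norml => /andP[].
have bGV : cbm (fun x => (G x)^-1).
  apply: (cbmV _ (expR (- B) ^+ 2) bG); first by rewrite exprn_gt0// expR_gt0.
  by move=> x Ix; rewrite -sqr_cabs ler_sqr ?nnegrE ?cabs_ge0 ?expR_ge0// GB.
have rho1 : cabs rho = 1 by exact: cabs_expi.
(* This product and the next one are positive multiples of e^(i v), and cos v >= cos d > 0; this
   yields the sector constant m e^(-B) cos d. *)
have E1 x : Ihalf R x -> rho * (g x * (G x)^~*) = (cabs (g x) * expR (u x))%:C * expi (v x).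
  move=> Ix; have cE (a : R) (w e : C) : (a%:C * (w * e))^~* = a%:C * (w^~* * e^~*).
    by rewrite !conjcM conjc_real.
  rewrite /G /rho cE -expiN opprK (rmorphM _ (cabs _) (expR _))/= -(sg _ Ix).
  have -> : expi (v x) = expi (- c) * expi (v x + c) by rewrite -expiD; congr expi; ring.
  by ring.
have E2 x : Ihalf R x -> rho * (g x * (G x)^-1) = (cabs (g x) * expR (- u x))%:C * expi (v x).
  move=> Ix; have G0 : G x != 0 by rewrite -cabs_gt0 cabsG// expR_gt0.
  apply: (mulIf G0); rewrite -(mulrA rho) divfK//.
  have gs : g x = (cabs (g x))%:C * s x by rewrite -sg// -mulrA (mulrC _ (s x)) ss// mulr1.
  rewrite {1}gs /G; move: (s x) => w.
  rewrite (rmorphM _ (cabs _) (expR _)) /= /rho.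
  have e1 : (expR (- u x))%:C * (expR (u x))%:C = 1 :> C by rewrite -rmorphM/= -expRD addNr expR0.
  have -> : expi (- c) = expi (v x) * expi (- (v x + c)) by rewrite -expiD; congr expi; ring.
  transitivity ((expR (- u x))%:C * (expR (u x))%:C * ((cabs (g x))%:C * expi (v x) * w * expi (- (v x + c)))).
    by rewrite e1; ring.
  by ring.
have posl x (a b : R) : Ihalf R x -> m <= a -> expR (- B) <= b ->
    m * expR (- B) * cos d <= complex.Re ((a * b)%:C * expi (v x)).
  move=> Ix ma hb; rewrite /expi mul_rc /=.
  have := cos_ge _ _ dp (vd _ Ix) => hc.
  apply: ler_pM => //; [by rewrite mulr_ge0 ?expR_ge0// ltW|exact: ltW|].
  by apply: ler_pM => //; exact: ltW.
have delta0 : 0 < m * expR (- B) * cos d by rewrite !mulr_gt0// expR_gt0.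
have gGd x : Ihalf R x -> m * expR (- B) * cos d <= complex.Re (rho * (g x * (G x)^-1)).
  move=> Ix; rewrite E2//; apply: posl => //; first exact: mg.
  by rewrite ler_expR lerN2; apply: le_trans (uB _ Ix); exact: ler_norm.
have gGY x : Ihalf R x -> m * expR (- B) * cos d <= complex.Re (rho * (g x * (G x)^~*)).
  move=> Ix; rewrite E1//; apply: posl => //; first exact: mg.
  by have := GB _ Ix; rewrite cabsG.
have HY x : Ihalf R x -> cabs (rho * (g x * (G x)^~*)) <= M * expR B.
  move=> Ix; rewrite E1// cabsM cabs_expi mulr1 cabs_rc ger0_norm ?mulr_ge0 ?cabs_ge0 ?expR_ge0//.
  apply: ler_pM; rewrite ?cabs_ge0 ?expR_ge0 ?gM// ler_expR.
  by apply: le_trans (uB _ Ix); exact: ler_norm.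
have GG : aeI (fun x => cabs (cexp (Herglotz u ((1 - dk k)%:C * cir x)) - G x) @[k --> \oo] --> 0).
  apply: aeI_imp (aeI_and _ _ gE (aeI_and _ _ (Poisson_dk _ bu) (Im_Fu_dk _ _ bu hu))).
  move=> x Ix [gx [hr hi]]; have -> : G x = (expR (u x))%:C * expi (uh x); last exact: cexp_cvg.
  rewrite /G; congr (_ * _); have -> : s x = expi (uh x + v x + c).
    by rewrite -gx /s; congr (_ * _); exact: fmorphV.
  by rewrite -expiD; congr expi; ring.
have GK x : Ihalf R x -> cabs (G x)^-1 <= expR B.
  move=> Ix; rewrite cabsV -[expR B]invrK lef_pV2 ?posrE ?invr_gt0 ?expR_gt0//.
    by rewrite -expRN GB.
  by rewrite cabsG// expR_gt0.
have HG1 := outer_approx u B G bu uB bG GG.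
have HG2 := outer_orth u B G _ bu uB bG (expR_gt0 _) GB GG.
split; last exact: (factor_bounds g G M (expR B) rho _ bg M0 gM (expR_gt0 _) GK bGV rho1 delta0 gGd HG2).
apply: riesz_dense_L2 => // f bf e e0.
have e2 : 0 < e / 2 by rewrite divr_gt0.
have /andP[k0 k1] := kap_bounds g G rho _ _ delta0 gGY HY.
have q0 : 0 < e / 2 / (nrm f + 1) by rewrite !divr_gt0// ltr_wpDl ?nrm_ge0.
have [n pnorm2] := small_pow _ _ k0 k1 q0.
have [p [q hpq]] := factor_dense_cbm g G M rho _ _ bg M0 gM bG rho1 delta0 gGY HY HG1 f n _ bf e2.
exists p, q; apply: (le_trans hpq); rewrite [leRHS]splitr lerD2r.
apply: (@le_trans _ _ (e / 2 / (nrm f + 1) * (nrm f + 1))).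
  by apply: ler_pM; rewrite ?exprn_ge0 ?nrm_ge0 ?lerDl.
by rewrite divfK// gt_eqF// ltr_wpDl ?nrm_ge0.
Qed.

End HelsonSzego.

(** * Fejer means and the lower bound for |g| *)

Section Fejer.
Context {R : realType}.
Notation C := R[i].
Implicit Types (u : R -> R) (p c : {poly C}) (g : R -> C).

Lemma cts_ev p : continuous (fun x => complex.Re (ev p x)) /\ continuous (fun x => complex.Im (ev p x)).
Proof.
elim/poly_ind: p => [|p a [hr hi]].
  by split => x; rewrite /ev; under eq_fun do rewrite horner0 /=; exact: cvg_cst.
have E x : ev (p * 'X + a%:P) x = ev p x * cir x + a by rewrite /ev hornerMXaddC.
split => x; under eq_fun do rewrite E !ReImE.
- apply: cvgD; last exact: cvg_cst.
  by apply: cvgB; apply: cvgM; [exact: hr|exact: cts_Re_cir|exact: hi|exact: cts_Im_cir].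
- apply: cvgD; last exact: cvg_cst.
  by apply: cvgD; apply: cvgM; [exact: hr|exact: cts_Im_cir|exact: hi|exact: cts_Re_cir].
Qed.

Lemma cts_csq_ev p : continuous (fun x => csq (ev p x)).
Proof. by move=> x; have [hr hi] := cts_ev p; apply: cvgD; apply: cvgM; try exact: hr; exact: hi. Qed.

(** The one-sided Dirichlet kernel centred at x, with frequencies 0, ..., N - 1. Being a polynomial
    it can be inserted into the Riesz and Hankel forms, and its squared modulus is N times the Fejer
    kernel. *)
Definition DirichletP (x : R) N : {poly C} := \poly_(j < N) (cir x)^~* ^+ j.

Lemma ev_Dp x N t : ev (DirichletP x N) t = \sum_(j < N) cir (t - x) ^+ j.
Proof.
rewrite /ev /DirichletP poly_def horner_sum; apply: eq_bigr => j _.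
by rewrite hornerZ hornerXn -exprMn cirD cirN mulrC.
Qed.

Lemma hn_Dp x N : pnorm2 (DirichletP x N) = N%:R.
Proof.
rewrite (Parseval_wide _ _ (size_poly _ _)) (eq_bigr (fun=> 1)); last first.
  by move=> j _; rewrite coef_poly ltn_ord csqX csq_conj csq_cir expr1n.
by rewrite sumr_const card_ord.
Qed.

Definition FejerK N (s : R) : R := N%:R^-1 * csq (ev (DirichletP 0 N) s).

Lemma csq_ev_Dp x N t : csq (ev (DirichletP x N) t) = N%:R * FejerK N (x - t).
Proof.
case: N => [|N]; first by rewrite ev_Dp big_ord0 mul0r csq0.
rewrite /FejerK mulrA divff// mul1r !ev_Dp subr0 -opprB cirN -csq_conj rmorph_sum.
by congr csq; apply: eq_bigr => j _; exact: (etrans (conjcX _ _) (congr1 (fun z => z ^+ j) (conjcK _))).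
Qed.

Lemma cts_FK N : continuous (FejerK N).
Proof. by move=> s; apply: cvgM; [exact: cvg_cst|exact: cts_csq_ev]. Qed.

Lemma FK_periodic N t : FejerK N (t + 1) = FejerK N t.
Proof. by rewrite /FejerK /ev cir_periodic. Qed.

Lemma I_FK N : (0 < N)%N -> I (FejerK N) = 1.
Proof.
move=> N0; rewrite /FejerK IZ; last by apply: bm_csq; exact: cbm_ev.
by rewrite -[I _]/(pnorm2 _) hn_Dp mulVf// pnatr_eq0 -lt0n.
Qed.

Lemma FK_ge0 N t : 0 <= FejerK N t.
Proof. by rewrite mulr_ge0 ?csq_ge0// invr_ge0. Qed.

Lemma FK_bounds N t : (0 < N)%N -> Ihalf R t ->
  `|FejerK N t| <= 1 / N%:R^-1 /\ `|FejerK N t| * t ^+ 2 <= 1 * N%:R^-1.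
Proof.
move=> N0 /Ihalf_itv It; have Np : 0 < N%:R :> R by rewrite ltr0n.
rewrite (ger0_norm (FK_ge0 N t)) div1r mul1r invrK /FejerK.
have h1 : csq (ev (DirichletP 0 N) t) <= N%:R ^+ 2.
  rewrite -cabs_le//; rewrite ev_Dp; apply: (le_trans (cabs_sum _ _ _)).
  rewrite (eq_bigr (fun=> 1)) ?sumr_const ?card_ord// => j _.
  by rewrite cabsX cabs_cir expr1n.
have h2 : csq (ev (DirichletP 0 N) t) * t ^+ 2 <= 1.
  have e1 : csq (1 - cir t) = 4 * sin (pi * t) ^+ 2.
    rewrite /csq !ReImE /cir /expi /=.
    have -> : 2 * pi * t = (pi * t) *+ 2 by ring.
    rewrite cos_mulr2n sin_mulr2n cos2sin2; have := cos2sin2 (pi * t).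
    move: (cos _) (sin _) => a b h.
    rewrite [LHS](_ : _ = (2 * b ^+ 2) ^+ 2 + 4 * a ^+ 2 * b ^+ 2); last by ring.
    by rewrite h; ring.
  have e2 : ev (DirichletP 0 N) t * (1 - cir t) = 1 - cir t ^+ N.
    by rewrite ev_Dp subr0 mulrC -[1 in RHS](expr1n _ N) subrXX; congr (_ * _); apply: eq_bigr => j _; rewrite expr1n mul1r.
  have e3 : csq (1 - cir t ^+ N) <= 4.
    apply: (le_trans (le_csqD 1 (- (cir t ^+ N)))); rewrite csqN csqX csq_cir expr1n csq1; lra.
  rewrite -e2 csqM e1 in e3.
  have h3 : t ^+ 2 <= sin (pi * t) ^+ 2.
    by rewrite -real_normK ?num_real// -[leRHS]real_normK ?num_real// ler_sqr ?nnegrE ?normr_ge0// sin_pi_ge.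
  have := ler_wpM2l (csq_ge0 (ev (DirichletP 0 N) t)) h3.
  by lra.
split; first by rewrite mulrC ler_pdivrMr// -expr2.
by rewrite -mulrA ler_piMr// invr_ge0.
Qed.

Definition FejerMean N u x := I (fun s => u s * FejerK N (x - s)).

Lemma Fejer_cvg u x : bm u -> leb_pt u x -> forall e : R, 0 < e ->
  exists N0, forall N, (N0 <= N)%N -> `|FejerMean N.+1 u x - u x| <= e.
Proof.
move=> bu lp e e0; have [d0 d00 H] := leb_pt_kernel u x 1 bu lp ltr01 e e0.
have [N0 hN] := dk_small _ d00; exists N0.+1 => -[//|N] hNN.
have Ix := lp.1.
rewrite /FejerMean -per_conv//; [|exact: cts_FK|exact: FK_periodic].
have bk : bm (FejerK N.+2) by apply: bm_cts; exact: cts_FK.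
have := I_per_sub u (FejerK N.+2) x bu Ix bk; rewrite I_FK// mulr1 => h.
apply: (le_trans h); apply: (H N.+2%:R^-1).
- by rewrite invr_gt0.
- exact: hN.
- exact: bk.
- by move=> t It; case: (FK_bounds N.+2 t isT It).
- by move=> t It; case: (FK_bounds N.+2 t isT It).
Qed.

(* Test the lower bound on Dirichlet kernels centred at a Lebesgue point. *)
Lemma riesz_lower_modulus g (A : R) : cbm g ->
  (forall p c, A * (pnorm2 p + pnorm2 c) <= I (fun x => csq (syn g p c x))) -> aeI (fun x => A <= csq (g x)).
Proof.
move=> bg HA; have bu := bm_csq _ bg.
apply: aeI_imp (leb_pt_ae _ bu) => x _ lp.
apply/ler_addgt0Pl => e e0; have [N0 hN] := Fejer_cvg _ _ bu lp _ e0.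
have := hN N0 (leqnn _); set N := N0.+1; move=> h.
have Np : 0 < N%:R :> R by rewrite ltr0n.
have := HA 0 (DirichletP x N).
rewrite hn_Dp (_ : pnorm2 0 = 0); last first.
  by rewrite (Parseval_wide 0 0) ?size_poly0// big_ord0.
rewrite add0r (eq_I _ (fun s => N%:R * (csq (g s) * FejerK N (x - s)))); last first.
  move=> s _; rewrite /syn /ev horner0 add0r csqM csq_conj csqM csq_cir mul1r -[_.[_]]/(ev _ _).
  by rewrite csq_ev_Dp; ring.
have bk : bm (fun s => csq (g s) * FejerK N (x - s)).
  by apply: bmM => //; apply: bm_reflect_cts; exact: cts_FK.
rewrite IZ// mulrC ler_pM2l// => h1; apply: (le_trans h1).
by move: h; rewrite ler_norml /FejerMean; lra.
Qed.

End Fejer.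

(** * Almost everywhere convergent subsequences of bounded L^2 Cauchy sequences *)

Section RieszFischer.
Context {R : realType}.
Notation C := R[i].
Local Notation mu := (lebesgue_measure : {measure set (measurableTypeR R) -> \bar R}).

(** Subtracting 2 K/2^n makes the sequence nondecreasing, and it stays bounded above. *)
Lemma geometric_cvg (a : nat -> R) (K : R) : (forall j, `|a j.+1 - a j| <= K / 2 ^+ j) -> cvgn a.
Proof.
move=> h; have q (j : nat) : K / 2 ^+ j.+1 = K / 2 ^+ j / 2 by rewrite exprS invfM mulrA mulrAC.
have K0 : 0 <= K by have := h 0%N; rewrite expr0 divr1; apply: le_trans.
have up n : a n + 2 * (K / 2 ^+ n) <= a 0%N + 2 * K.
  elim: n => [|n IH]; first by rewrite expr0 divr1.
  by apply: le_trans IH; have := h n; rewrite q ler_norml; lra.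
have h1 : cvgn (fun n => a n - 2 * (K / 2 ^+ n)).
  apply: nondecreasing_is_cvgn.
    apply/nondecreasing_seqP => n; have := h n; rewrite q ler_norml; lra.
  exists (a 0%N + 2 * K) => _ [n _ <-]; apply: le_trans (up n).
  have : 0 <= K / 2 ^+ n by rewrite divr_ge0// exprn_ge0.
  by lra.
have h2 : cvgn (fun n => 2 * K * 2^-1 ^+ n : R).
  by apply: is_cvgMr; apply/cvg_ex; exists 0; apply: cvg_expr; rewrite ger0_norm; lra.
suff <- : (fun n => a n - 2 * (K / 2 ^+ n)) + (fun n => 2 * K * 2^-1 ^+ n) = a by exact: is_cvgD.
apply/funext => n; transitivity (a n - 2 * (K / 2 ^+ n) + 2 * K * 2^-1 ^+ n); first by [].
by rewrite exprVn; ring.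
Qed.

(** The sum of the series has integral at most 2 K, so it is finite almost everywhere, and it
    dominates each of its terms. *)
Lemma summable_ae (F : nat -> R -> R) (K : R) : (forall j, bm (F j)) ->
  (forall j x, 0 <= F j x) -> (forall j, I (F j) <= K / 2 ^+ j) ->
  aeI (fun x => exists M : R, forall j, F j x <= M).
Proof.
move=> bF F0 FI; have mF j : measurable_fun (Ihalf R) (fun x => (F j x)%:E).
  by apply/measurable_EFinP; case: (bF j).
have K0 : 0 <= K by have := FI 0%N; rewrite expr0 divr1; apply: le_trans; exact: I_ge0.
pose S x := (\sum_(0 <= j <oo) (F j x)%:E)%E.
have S0 x : (0 <= S x)%E by apply: nneseries_ge0 => j _ _; rewrite lee_fin.
have mS : measurable_fun (Ihalf R) S.
  by apply: (ge0_emeasurable_sum (fun j x _ _ => _)) => [j x _ _|j _]; [rewrite lee_fin|exact: mF].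
have iS : (\int[mu]_(x in Ihalf R) S x <= (2 * K)%:E)%E.
  rewrite integral_nneseries//; [|exact: measurable_Ihalf|by move=> j x _; rewrite lee_fin].
  apply: lime_le.
    by apply: is_cvg_nneseries => j _ _; apply: integral_ge0 => x _; rewrite lee_fin.
  apply: nearW => n.
  rewrite (eq_bigr (fun j => (I (F j))%:E)); last by move=> j _; exact: EFin_I.
  rewrite sumEFin lee_fin; apply: (le_trans (ler_sum _ (fun j _ => FI j))).
  have h : \sum_(0 <= j < n) K / 2 ^+ j = 2 * K - 2 * K / 2 ^+ n.
    elim: n => [|n IH]; first by rewrite big_geq// expr0 divr1 subrr.
    by rewrite big_nat_recr//= IH exprS; field; rewrite expf_neq0.
  by rewrite h gerBl divr_ge0 ?exprn_ge0// mulr_ge0.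
have int : mu.-integrable (Ihalf R) S.
  apply/integrableP; split => //; apply: le_lt_trans (ltry (2 * K)).
  by under eq_integral do rewrite gee0_abs//.
have fin : aeI (fun x => S x \is a fin_num).
  have h := @integrable_ae _ _ R mu (Ihalf R) measurable_Ihalf S int.
  by move: h; rewrite /aeI => h; exact: h.
apply: aeI_imp fin => x Ix fin.
exists (fine (S x)) => j; rewrite -lee_fin fineK//.
have h : (\sum_(0 <= i < j.+1) (F i x)%:E <= S x)%E.
  by apply: nneseries_lim_ge => k _ _; rewrite lee_fin.
apply: le_trans h; rewrite sumEFin lee_fin big_nat_recr//= lerDr; exact: sumr_ge0.
Qed.

Lemma bounded_limit (F : nat -> R -> R) (M : R) : (forall n, bm (F n)) ->
  (forall n x, Ihalf R x -> `|F n x| <= M) ->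
  exists2 f, bm f & forall x, Ihalf R x -> cvgn (F^~ x) -> F n x @[n --> \oo] --> f x.
Proof.
move=> bF FM.
(* The clipped upper limit is measurable and bounded at every point, including those without
   convergence. *)
pose f x := Num.max (- M) (Num.min M (limn_sup (F^~ x))).
have ms : measurable_fun (Ihalf R) (fun x => limn_sup (F^~ x)).
  apply: measurable_fun_limn_sup => [x Ix|x Ix|n]; last by case: (bF n).
    by exists M => _ [n _ <-]; apply: le_trans (FM n x Ix); exact: ler_norm.
  by exists (- M) => _ [n _ <-]; have := FM n x Ix; rewrite ler_norml => /andP[].
have M0 : 0 <= M.
  have I0 : Ihalf R 0 by apply/Ihalf_itv/andP; split; lra.
  by apply: le_trans (FM 0%N _ I0); exact: normr_ge0.
exists f.
  split; first by apply: measurable_maxr; [exact: measurable_cst|apply: measurable_minr => //; exact: measurable_cst].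
  exists M => x Ix; rewrite /f ler_norml le_max lexx /= ge_max ge_min lexx andbT; lra.
move=> x Ix cF; rewrite /f cvg_limn_supE//.
have h1 : limn (F^~ x) <= M.
  apply: limr_le => //; apply: nearW => n; apply: le_trans (FM n x Ix); exact: ler_norm.
have h2 : - M <= limn (F^~ x).
  by apply: limr_ge => //; apply: nearW => n; have := FM n x Ix; rewrite ler_norml => /andP[].
by rewrite min_r// max_r.
Qed.

Lemma Riesz_Fischer (F : nat -> R -> C) (M : R) : (forall n, cbm (F n)) ->
  (forall n x, Ihalf R x -> cabs (F n x) <= M) ->
  (forall e : R, 0 < e -> exists N, forall n m, (N <= n)%N -> (N <= m)%N ->
     nrm (fun x => F n x - F m x) <= e) ->
  exists (k : nat -> nat) f, [/\ cbm f, forall i, (i <= k i)%N &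
    aeI (fun x => cabs (F (k i) x - f x) @[i --> \oo] --> 0)].
Proof.
move=> bF FM Fc.
have H j : exists N, forall n m, (N <= n)%N -> (N <= m)%N ->
    nrm (fun x => F n x - F m x) <= (4 ^+ j)^-1 by apply: Fc; rewrite invr_gt0 exprn_gt0.
have [N0 hN] := choice H.
(* The sum makes both k i and k (i+1) at least N0 i, and the summand i gives i <= k i. *)
pose k i := (\sum_(j < i.+1) N0 j + i)%N.
have kN i : (N0 i <= k i)%N by rewrite /k big_ord_recr /= addnAC leq_addl.
have kS i : (N0 i <= k i.+1)%N.
  by rewrite /k big_ord_recr /= (leq_trans (kN i))// /k addnAC addnS leqW// leq_addr.
(* The norm of the i-th increment is at most 4^-i, so W i still has integral at most 4^-i <= 2^-i. A
   pointwise bound B for all W i makes the increments at most sqrt(B)/2^i. *)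
pose W i x := 4 ^+ i * csq (F (k i.+1) x - F (k i) x).
have bD i : cbm (fun x => F (k i.+1) x - F (k i) x) by exact: cbmB.
have bW i : bm (W i) by apply: bmM (bm_cst _) _; exact: bm_csq.
have W0 i x : 0 <= W i x by rewrite mulr_ge0 ?csq_ge0// exprn_ge0.
have IW i : I (W i) <= 1 / 2 ^+ i.
  rewrite (IZ (4 ^+ i) _ (bm_csq _ (bD i))) -sqr_nrm.
  have h : nrm (fun x => F (k i.+1) x - F (k i) x) ^+ 2 <= (4 ^+ i)^-1 ^+ 2.
    by rewrite ler_sqr ?nnegrE ?nrm_ge0 ?invr_ge0 ?exprn_ge0// hN.
  apply: (@le_trans _ _ (4 ^+ i * (4 ^+ i)^-1 ^+ 2)); first by rewrite ler_wpM2l// exprn_ge0.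
  rewrite expr2 mulrA divff ?expf_neq0// mul1r div1r lef_pV2 ?posrE ?exprn_gt0//.
  by rewrite lerXn2r// ?nnegrE//; lra.
have ae := summable_ae W 1 bW W0 IW.
have bFk i : cbm (F (k i)) by [].
have rM i x : Ihalf R x -> `|complex.Re (F (k i) x)| <= M.
  by move=> Ix; exact: le_trans (Re_le_cabs _) (FM _ _ Ix).
have iM i x : Ihalf R x -> `|complex.Im (F (k i) x)| <= M.
  by move=> Ix; exact: le_trans (Im_le_cabs _) (FM _ _ Ix).
have [fr bfr hfr] := bounded_limit (fun i x => complex.Re (F (k i) x)) M (fun i => (bFk i).1) rM.
have [fi bfi hfi] := bounded_limit (fun i x => complex.Im (F (k i) x)) M (fun i => (bFk i).2) iM.
exists k, (fun x => Complex (fr x) (fi x)); split; first by split.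
  by move=> i; rewrite /k leq_addl.
apply: aeI_imp ae => x Ix [B hB].
have hD i : cabs (F (k i.+1) x - F (k i) x) <= Num.sqrt B / 2 ^+ i.
  have h := hB i; have B0 : 0 <= B := le_trans (W0 i x) h.
  rewrite ler_pdivlMr ?exprn_gt0// -ler_sqr ?nnegrE ?mulr_ge0 ?cabs_ge0 ?sqrtr_ge0 ?exprn_ge0//.
  rewrite sqr_sqrtr// exprMn sqr_cabs -exprM mulnC exprM (_ : 2 ^+ 2 = 4 :> R); last by ring.
  by rewrite mulrC.
apply: cvg_cabs_ReIm => /=.
- apply: hfr => //; apply: (geometric_cvg _ (Num.sqrt B)) => j.
  by apply: le_trans (hD j); apply: le_trans (Re_le_cabs _); rewrite !ReImE.
- apply: hfi => //; apply: (geometric_cvg _ (Num.sqrt B)) => j.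
  by apply: le_trans (hD j); apply: le_trans (Im_le_cabs _); rewrite !ReImE.
Qed.

End RieszFischer.

(** * Positive Hankel forms and their extension by one coefficient *)

Section HankelExtension.
Context {R : realType}.
Notation C := R[i].
Implicit Types (a c p : {poly C}) (gam : nat -> C) (z : C).

(** The requirement is w >= - Q/l where l > 0 and w <= Q/(- l) where l < 0. The first hypothesis
    puts every lower bound below every upper bound, so the supremum of the lower bounds is a
    solution. *)
Lemma separation (T : Type) (D : T -> Prop) (Q l : T -> R) :
  (forall x y, D x -> D y -> 0 < l x -> l y < 0 -> 0 <= - l y * Q x + l x * Q y) ->
  (forall x, D x -> l x = 0 -> 0 <= Q x) ->
  (exists2 x, D x & 0 < l x) -> (exists2 y, D y & l y < 0) ->
  exists w, forall x, D x -> 0 <= Q x + w * l x.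
Proof.
move=> H H0 [x0 Dx0 lx0] [y0 Dy0 ly0].
pose S : set R := [set - Q x / l x | x in [set x | D x /\ 0 < l x]]%classic.
have ub y : D y -> l y < 0 -> ubound S (Q y / - l y).
  move=> Dy ly _ [x [Dx lx] <-]; rewrite ler_pdivrMr// mulrAC ler_pdivlMr ?oppr_gt0//.
  by have := H x y Dx Dy lx ly; lra.
have S0 : S !=set0 by exists (- Q x0 / l x0), x0.
have Sb : has_ubound S by exists (Q y0 / - l y0); exact: ub.
exists (sup S) => x Dx; have [lx|lx|lx] := ltgtP (l x) 0.
- have := @ge_sup _ S (Q x / - l x) S0 (ub x Dx lx).
  by rewrite ler_pdivlMr ?oppr_gt0//; lra.
- have : - Q x / l x <= sup S by apply: ub_le_sup => //; exists x.
  by rewrite ler_pdivrMr//; lra.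
- by rewrite lx mulr0 addr0 H0.
Qed.

(** The discriminant inequality, tested at k = - conj(L)/X; for X = 0 a large multiple of - conj(L)
    gives a contradiction unless L = 0. *)
Lemma quadratic_disc (X Y : R) (L : C) : 0 <= X ->
  (forall k : C, 0 <= csq k * X + Y + 2 * complex.Re (k * L)) -> csq L <= X * Y.
Proof.
rewrite le_eqVlt => /predU1P[<-|X0] H.
  rewrite mul0r; apply/negPn; rewrite -ltNge; apply/negP => L0.
  pose t := (Y + 1) / (2 * csq L).
  have := H (- t%:C * L^~*).
  have -> : complex.Re (- t%:C * L^~* * L) = - t * csq L by rewrite /csq !ReImE; ring.
  have -> : 2 * (- t * csq L) = - (Y + 1) by rewrite /t; field; rewrite gt_eqF.
  lra.
have := H (- (X^-1)%:C * L^~*).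
have -> : complex.Re (- (X^-1)%:C * L^~* * L) = - X^-1 * csq L by rewrite /csq !ReImE; ring.
rewrite csqM csqN csq_conj csq_rc.
have -> : X^-1 ^+ 2 * csq L * X = X^-1 * csq L by field; rewrite gt_eqF.
rewrite -subr_ge0 => h; rewrite -subr_ge0.
have -> : X * Y - csq L = X * (X^-1 * csq L + Y + 2 * (- X^-1 * csq L) - 0) by field; rewrite gt_eqF.
by rewrite mulr_ge0// ltW.
Qed.

(** On a product a c this is the bilinear form of the Hankel matrix with entries gam (i + j). *)
Definition HankelL gam p : C := \sum_(i < size p) p`_i * gam i.

Lemma LamE gam p n : (size p <= n)%N -> HankelL gam p = \sum_(i < n) p`_i * gam i.
Proof.
move=> pn; rewrite /HankelL (big_ord_widen n (fun i => p`_i * gam i) pn).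
rewrite [RHS](bigID (fun i : 'I_n => (i < size p)%N)) /=.
by rewrite [X in _ = _ + X]big1 ?addr0// => i; rewrite -leqNgt => h; rewrite nth_default// mul0r.
Qed.

Lemma LamD gam p q : HankelL gam (p + q) = HankelL gam p + HankelL gam q.
Proof.
have h := size_polyD p q; rewrite (LamE _ _ _ h).
rewrite (LamE _ p _ (leq_maxl _ (size q))) (LamE _ q _ (leq_maxr (size p) _)) -big_split/=.
by apply: eq_bigr => i _; rewrite coefD mulrDl.
Qed.

Lemma LamZ gam z p : HankelL gam (z *: p) = z * HankelL gam p.
Proof.
rewrite (LamE _ _ _ (size_scale_leq z p)) /HankelL mulr_sumr.
by apply: eq_bigr => i _; rewrite coefZ mulrA.
Qed.

(** Prepending z borders the Hankel matrix: deleting its first row or first column gives back the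
    matrix of gam. *)
Definition scons z gam (i : nat) : C := if i is j.+1 then gam j else z.

Lemma Lam_scons z gam p z0 : HankelL (scons z gam) (p * 'X + z0%:P) = z0 * z + HankelL gam p.
Proof.
rewrite (LamE _ _ (size p).+1); last first.
  by rewrite size_MXaddC; case: ifP.
rewrite big_ord_recl /= coefD coefMX coefC /= add0r; congr (_ + _).
by apply: eq_bigr => i _; rewrite coefD coefMX coefC /= addr0.
Qed.

Definition wnorm2 (w : R -> R) p := I (fun x => w x * csq (ev p x)).

Lemma hnE p : pnorm2 p = wnorm2 (fun=> 1) p.
Proof. by apply: eq_I => x _; rewrite mul1r. Qed.

Lemma hw_ge0 w p : (forall x, Ihalf R x -> 0 <= w x) -> 0 <= wnorm2 w p.
Proof. by move=> w0; apply: I_ge0 => x Ix; rewrite mulr_ge0 ?csq_ge0 ?w0. Qed.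

Lemma bm_hw w p : bm w -> bm (fun x => w x * csq (ev p x)).
Proof. by move=> bw; apply: bmM => //; apply: bm_csq; exact: cbm_ev. Qed.

Lemma hwZ w z p : bm w -> wnorm2 w (z *: p) = csq z * wnorm2 w p.
Proof.
move=> bw; rewrite /wnorm2 -IZ; last exact: bm_hw.
by apply: eq_I => x _; rewrite /ev hornerZ csqM; ring.
Qed.

Lemma hwMX w p : wnorm2 w (p * 'X) = wnorm2 w p.
Proof. by apply: eq_I => x _; rewrite /ev hornerMX csqM csq_cir mulr1. Qed.

(** A weighted parallelogram identity. Its analogues for the weighted norms and for products of
    polynomials combine into the same identity for the whole form [HankelQ]. *)
Lemma csq_mix (t s : R) z1 z2 :
  (t + s) * (t * csq z1 + s * csq z2) = csq (t%:C * z1 + s%:C * z2) + t * s * csq (z1 - z2).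
Proof. by rewrite /csq !ReImE; ring. Qed.

Lemma scale_mul z1 z2 a c : (z1 *: a) * (z2 *: c) = (z1 * z2) *: (a * c).
Proof. by rewrite -!mul_polyC polyCM; ring. Qed.

Lemma poly_mix z1 z2 a1 c1 a2 c2 : (z1 + z2) *: (z1 *: (a1 * c1) + z2 *: (a2 * c2)) =
  (z1 *: a1 + z2 *: a2) * (z1 *: c1 + z2 *: c2) + (z1 * z2) *: ((a1 - a2) * (c1 - c2)).
Proof. by rewrite -!mul_polyC polyCD polyCM; ring. Qed.

Lemma hw_mix w (t s : R) p q : bm w ->
  (t + s) * (t * wnorm2 w p + s * wnorm2 w q) = wnorm2 w (t%:C *: p + s%:C *: q) + t * s * wnorm2 w (p - q).
Proof.
move=> bw; have h1 := bm_hw w p bw; have h2 := bm_hw w q bw.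
have h3 := bm_hw w (p - q) bw; have h4 := bm_hw w (t%:C *: p + s%:C *: q) bw.
have b1 : bm (fun x => t * (w x * csq (ev p x))) by exact: bmM (bm_cst _) _.
have b2 : bm (fun x => s * (w x * csq (ev q x))) by exact: bmM (bm_cst _) _.
have b3 : bm (fun x => t * s * (w x * csq (ev (p - q) x))) by exact: bmM (bm_cst _) _.
rewrite /wnorm2 -(IZ t _ h1) -(IZ s _ h2) -(IZ (t * s) _ h3) -(ID _ _ b1 b2) -(ID _ _ h4 b3).
rewrite -(IZ (t + s) _ (bmD _ _ b1 b2)); apply: eq_I => x _; have := csq_mix t s (ev p x) (ev q x).
rewrite /ev !(hornerD, hornerN, hornerZ).
move: (csq (_ + _)) (csq (_ - _)) => A B h.
transitivity (w x * ((t + s) * (t * csq p.[cir x] + s * csq q.[cir x]))); first by ring.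
by rewrite h; ring.
Qed.

Section Positivity.
Variables (al : R) (be : R -> R).
Hypotheses (al0 : 0 <= al) (bbe : bm be) (be0 : forall x, Ihalf R x -> 0 <= be x).

Definition HankelQ gam a c : R := al * pnorm2 a + wnorm2 be c + 2 * complex.Re (HankelL gam (a * c)).

Definition HankelPos gam := forall a c, 0 <= HankelQ gam a c.

Lemma QF_mix gam (t s : R) a1 c1 a2 c2 :
  (t + s) * (t * HankelQ gam a1 c1 + s * HankelQ gam a2 c2) =
  HankelQ gam (t%:C *: a1 + s%:C *: a2) (t%:C *: c1 + s%:C *: c2) + t * s * HankelQ gam (a1 - a2) (c1 - c2).
Proof.
rewrite /HankelQ !hnE.
have e1 := hw_mix (fun=> 1) t s a1 a2 (bm_cst 1); have e2 := hw_mix be t s c1 c2 bbe.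
have e3 : (t + s) * (t * complex.Re (HankelL gam (a1 * c1)) + s * complex.Re (HankelL gam (a2 * c2))) =
  complex.Re (HankelL gam ((t%:C *: a1 + s%:C *: a2) * (t%:C *: c1 + s%:C *: c2))) +
  t * s * complex.Re (HankelL gam ((a1 - a2) * (c1 - c2))).
  have := congr1 (fun p => complex.Re (HankelL gam p)) (poly_mix t%:C s%:C a1 c1 a2 c2).
  by rewrite !(LamD, LamZ) !ReImE; move: (complex.Im (HankelL _ _)) => ?; lra.
transitivity (al * ((t + s) * (t * wnorm2 (fun=> 1) a1 + s * wnorm2 (fun=> 1) a2)) +
  (t + s) * (t * wnorm2 be c1 + s * wnorm2 be c2) + 2 * ((t + s) * (t * complex.Re (HankelL gam (a1 * c1)) + s * complex.Re (HankelL gam (a2 * c2))))).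
  by ring.
by rewrite e1 e2 e3; ring.
Qed.

Lemma QF_scale gam (k l : C) (r : R) a c : csq k = r -> csq l = r -> k * l = r%:C ->
  HankelQ gam (k *: a) (l *: c) = r * HankelQ gam a c.
Proof.
move=> kr lr kl; rewrite /HankelQ !hnE !hwZ//; last exact: bm_cst.
by rewrite kr lr scale_mul LamZ kl cReM Re_rc Im_rc; ring.
Qed.

Lemma QF_scons z gam a c : HankelQ (scons z gam) a c = HankelQ (scons 0 gam) a c + 2 * complex.Re (a`_0 * c`_0 * z).
Proof.
rewrite /HankelQ -coef0M; elim/poly_ind: (a * c) => [|p w _].
  by rewrite coef0 mul0r /HankelL size_poly0 !big_ord0; ring.
rewrite !Lam_scons coefD coefMX coefC /= add0r mulr0 !ReImE; ring.
Qed.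

(** If a = z a1, only the shifted sequence gam enters the form, and a and a1 have the same norm; so
    the value is that of the old form at (a1, c). *)
Lemma QF_a0 z gam a c : HankelPos gam -> a`_0 = 0 -> 0 <= HankelQ (scons z gam) a c.
Proof.
move=> P; elim/poly_ind: a => [|a w _].
  move=> _; rewrite /HankelQ mul0r /HankelL size_poly0 big_ord0 mulr0 addr0.
  by rewrite addr_ge0 ?hw_ge0// mulr_ge0// I_csq_ge0.
rewrite coefD coefMX coefC /= add0r => ->; rewrite addr0 /HankelQ hnE hwMX -hnE.
rewrite mulrAC -[a * c * 'X]addr0 -(polyC0 _) Lam_scons mul0r add0r.
exact: P.
Qed.

Lemma QF_c0 z gam a c : HankelPos gam -> c`_0 = 0 -> 0 <= HankelQ (scons z gam) a c.
Proof.
move=> P; elim/poly_ind: c => [|c w _].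
  move=> _; rewrite /HankelQ mulr0 /HankelL size_poly0 big_ord0 mulr0 addr0.
  by rewrite addr_ge0 ?hw_ge0// mulr_ge0// I_csq_ge0.
rewrite coefD coefMX coefC /= add0r => ->; rewrite addr0 /HankelQ hwMX.
rewrite mulrA -[a * c * 'X]addr0 -(polyC0 _) Lam_scons mul0r add0r.
exact: P.
Qed.

(** In the parallelogram identity for the form, the difference a1 - a2 has no constant term, so the
    mixed term is nonnegative by [QF_a0] whatever z is. *)
Lemma QF_convex z gam (t s : R) a1 c1 a2 c2 : HankelPos gam -> 0 < t -> 0 < s ->
  a1`_0 = 1 -> a2`_0 = 1 ->
  0 <= HankelQ (scons z gam) (t%:C *: a1 + s%:C *: a2) (t%:C *: c1 + s%:C *: c2) ->
  0 <= t * HankelQ (scons z gam) a1 c1 + s * HankelQ (scons z gam) a2 c2.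
Proof.
move=> P t0 s0 h1 h2 h; have ts : 0 < t + s by rewrite addr_gt0.
rewrite -(pmulr_rge0 _ ts) QF_mix addr_ge0// mulr_ge0//; first by rewrite mulr_ge0// ltW.
by apply: QF_a0 => //; rewrite coefB h1 h2 subrr.
Qed.

(** Dividing a by its constant coefficient and c by the conjugate of that number divides all three
    terms of the form by the same positive number. *)
Lemma QF_normalize z gam : (forall a c, a`_0 = 1 -> 0 <= HankelQ (scons z gam) a c) ->
  HankelPos gam -> HankelPos (scons z gam).
Proof.
move=> H P a c; have [a0|a0] := eqVneq a`_0 0; first exact: QF_a0.
have -> : a = a`_0 *: ((a`_0)^-1 *: a) by rewrite scalerA divff// scale1r.
have c0 : (a`_0)^~* != 0 by rewrite conjc_eq0.
have -> : c = (a`_0)^~* *: (((a`_0)^~*)^-1 *: c) by rewrite scalerA divff// scale1r.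
rewrite (QF_scale _ _ _ (csq a`_0)) ?csq_conj ?csqE// mulr_ge0 ?csq_ge0// H//.
by rewrite coefZ mulVf.
Qed.

(* The condition on z is a family of linear inequalities indexed by a convex set of
   pairs (a, c) with [a`_0 = 1]; its real and imaginary parts are found one after the
   other by separation. *)
Lemma Hankel_step gam : HankelPos gam -> exists z, HankelPos (scons z gam).
Proof.
move=> P.
have D1 : exists w1 : R, forall x : {poly C} * {poly C}, x.1`_0 = 1 /\ complex.Im x.2`_0 = 0 ->
    0 <= HankelQ (scons 0 gam) x.1 x.2 + w1 * complex.Re x.2`_0.
  apply: separation.
  (* The weights - l y and l x cancel the real constant coefficients, so the mixed c has no constant
     term and [QF_c0] applies. *)
  - move=> [a1 c1] [a2 c2] /= [ha1 hc1] [ha2 hc2] l1 l2; apply: QF_convex => //.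
      by rewrite oppr_gt0.
    apply: QF_c0 => //; rewrite coefD !coefZ; apply: complexP; rewrite !ReImE /=.
      by ring.
    by rewrite hc1 hc2; ring.
  - move=> [a c] /= [_ hi] hr; apply: QF_c0 => //; exact: complexP.
  - by exists (1, 1) => /=; rewrite coef1.
  - by exists (1, -1) => /=; rewrite ?coefN coef1 //= ?oppr0// ltrN10.
have [w1 H1] := D1; set z1 := (w1 / 2)%:C.
(* In the second separation the mixed a has constant coefficient t + s rather than 1; a positive
   scaling of both arguments covers this case. *)
have H1' a c (r : R) : a`_0 = r%:C -> 0 < r -> complex.Im c`_0 = 0 -> 0 <= HankelQ (scons z1 gam) a c.
  move=> ha r0 hc; have rn : r%:C != 0 by rewrite -cabs_gt0 cabs_rc normr_gt0 gt_eqF.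
  have -> : a = r%:C *: ((r^-1)%:C *: a) by rewrite scalerA -rmorphM/= divff ?gt_eqF// scale1r.
  have -> : c = r%:C *: ((r^-1)%:C *: c) by rewrite scalerA -rmorphM/= divff ?gt_eqF// scale1r.
  rewrite (QF_scale _ _ _ (r ^+ 2)) ?csq_rc// -?rmorphM//= mulr_ge0 ?sqr_ge0//.
  have := H1 ((r^-1)%:C *: a, (r^-1)%:C *: c); rewrite /= !coefZ ha -rmorphM/= mulVf ?gt_eqF//.
  rewrite !ReImE hc mulr0 mul0r addr0 => /(_ (conj erefl erefl)) h.
  rewrite QF_scons !coefZ ha mulrA -rmorphM/= mulVf ?gt_eqF// mul1r /z1 !ReImE hc.
  apply: le_trans h _; rewrite le_eqVlt; apply/orP; left; apply/eqP; field; rewrite gt_eqF//.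
have D2 : exists w2 : R, forall x : {poly C} * {poly C}, x.1`_0 = 1 ->
    0 <= HankelQ (scons z1 gam) x.1 x.2 + w2 * complex.Im x.2`_0.
  apply: separation.
  (* The weights now cancel the imaginary parts, so the mixed pair falls under [H1']. *)
  - move=> [a1 c1] [a2 c2] /= ha1 ha2 l1 l2; apply: QF_convex => //.
      by rewrite oppr_gt0.
    apply: (H1' _ _ (- complex.Im c2`_0 + complex.Im c1`_0)).
    + by rewrite coefD !coefZ ha1 ha2 !mulr1 rmorphD.
    + by rewrite addr_gt0// oppr_gt0.
    + by rewrite coefD !coefZ !ReImE; ring.
  - by move=> [a c] /= ha hc; apply: (H1' _ _ 1).
  - have h1 : (1 : {poly C})`_0 = 1 by rewrite coef1.
    have h2 : complex.Im ((Complex 0 1 : C)%:P)`_0 = 1 by rewrite coefC.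
    by exists (1, (Complex 0 1 : C)%:P); [exact: h1|change (0 < complex.Im ((Complex 0 1 : C)%:P)`_0); rewrite h2].
  - have h1 : (1 : {poly C})`_0 = 1 by rewrite coef1.
    have h2 : complex.Im ((Complex 0 (-1) : C)%:P)`_0 = -1 by rewrite coefC.
    exists (1, (Complex 0 (-1) : C)%:P); [exact: h1|change (complex.Im ((Complex 0 (-1) : C)%:P)`_0 < 0)].
    by rewrite h2 ltrN10.
have ReC (x y : R) : complex.Re (Complex x y) = x by [].
have ImC (x y : R) : complex.Im (Complex x y) = y by [].
(* For this z one has 2 Re(c_0 z) = w1 Re c_0 + w2 Im c_0. *)
have [w2 H2] := D2; exists (Complex (w1 / 2) (- (w2 / 2))).
apply: QF_normalize => // a c ha.
have := H2 (a, c) ha; rewrite /= QF_scons ha !mul1r /z1 !ReImE => h.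
rewrite QF_scons ha mul1r cReM ReC ImC; by apply: le_trans h _; rewrite le_eqVlt; apply/orP; left; apply/eqP; field.
Qed.

Lemma Hpos_CS gam a c : HankelPos gam -> csq (HankelL gam (a * c)) <= al * pnorm2 a * wnorm2 be c.
Proof.
move=> P; apply: quadratic_disc; first by rewrite mulr_ge0// I_csq_ge0.
move=> k; have := P (k *: a) (1 *: c).
by rewrite /HankelQ scale_mul mulr1 LamZ scale1r !hnE (hwZ _ _ _ (bm_cst 1)); lra.
Qed.

End Positivity.
End HankelExtension.

(** * The bounded function defined by the extended Hankel form *)

Section HankelFunction.
Context {R : realType}.
Notation C := R[i].
Implicit Types (a c p : {poly C}).

Lemma CI_mul_ev (h : R -> C) p : cbm h ->
  CI (fun x => h x * (cir x * ev p x)) = HankelL (fun i => CI (fun x => h x * cir x ^+ i.+1)) p.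
Proof.
move=> bh; rewrite /HankelL (eq_CI _ (fun x => \sum_(i < size p) p`_i * (h x * cir x ^+ i.+1))); last first.
  move=> x _; rewrite /ev horner_coef !mulr_sumr; apply: eq_bigr => i _; rewrite exprS; ring.
have bX n : cbm (fun x => h x * cir x ^+ n) by apply: cbmM => //; apply: cbmX; exact: cbm_cir.
by rewrite CI_sum => [|j]; [apply: eq_bigr => i _; rewrite CIZ|apply: cbmM (cbm_cst _) _].
Qed.

Variables (g : R -> C) (A : R).
Hypotheses (bg : cbm g) (A1 : A <= 1) (gA : forall x, Ihalf R x -> A <= csq (g x)).
Hypothesis HA : forall p c, A * (pnorm2 p + pnorm2 c) <= I (fun x => csq (syn g p c x)).

Let al := 1 - A.
Let be x := csq (g x) - A.
(** The Fourier coefficient of conj(g) at the frequency -(i+1). *)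
Let gam0 i := CI (fun x => (g x)^~* * cir x ^+ i.+1).

Let al0 : 0 <= al. Proof. by rewrite subr_ge0. Qed.
Let bbe : bm be. Proof. by apply: bmB (bm_cst _); exact: bm_csq. Qed.
Let be0 x : Ihalf R x -> 0 <= be x. Proof. by move=> Ix; rewrite subr_ge0 gA. Qed.

Let Lam_gam0 p : HankelL gam0 p = CI (fun x => (g x)^~* * (cir x * ev p x)).
Proof.
have bgc : cbm (fun x => (g x)^~*) by exact: cbm_conj.
by rewrite CI_mul_ev.
Qed.

Lemma Hpos_gam0 : HankelPos al be gam0.
Proof.
move=> p c; have := HA p c; rewrite -subr_ge0; congr (_ <= _).
have bp := cbm_ev p; have bq : cbm (fun x => (g x)^~* * (cir x * ev (p * c) x)).
  by apply: cbmM; [exact: cbm_conj|apply: cbmM; [exact: cbm_cir|exact: cbm_ev]].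
have b1 := bm_csq _ (cbm_ev p); have b2 := bm_hw _ c (bm_csq _ bg).
have b3 := bm_csq _ (cbm_ev c); have b4 : bm (fun x => A * csq (ev c x)) by exact: bmM (bm_cst _) _.
rewrite (eq_I _ (fun x => (csq (ev p x) + csq (g x) * csq (ev c x)) +
    2 * complex.Re ((g x)^~* * (cir x * ev (p * c) x)))); last first.
  move=> x _; rewrite (_ : ev (p * c) x = ev p x * ev c x) /syn; last exact: hornerM.
  have -> : csq (g x) * csq (ev c x) = csq (g x * (cir x * ev c x)^~*).
    by rewrite csqM csq_conj csqM csq_cir mul1r.
  by rewrite /csq !ReImE; ring.
case: (bq) => bq1 _.
rewrite ID; [|exact: bmD|exact: bmM (bm_cst _) _]; rewrite ID// IZ// -Re_CI -Lam_gam0.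
rewrite /HankelQ /wnorm2 (eq_I (fun x => be x * _) (fun x => csq (g x) * csq (ev c x) - A * csq (ev c x))).
  by rewrite IB// IZ// /al /pnorm2; ring.
by move=> x _; rewrite /be; ring.
Qed.

Variable step : (nat -> C) -> C.
Hypothesis stepP : forall gam, HankelPos al be gam -> HankelPos al be (scons (step gam) gam).

Let G n := iter n (fun gam => scons (step gam) gam) gam0.

Let HG n : HankelPos al be (G n).
Proof. by elim: n => [|n IH]; [exact: Hpos_gam0|exact: stepP]. Qed.

(** The coefficient added at step j. Since gam0 occupies the frequencies -1, -2, ..., it becomes the
    coefficient of the sought function at the frequency j. *)
Let b j := G j.+1 0.
Let d j := (gam0 j)^~*.

Let G_high n i : G n (n + i) = gam0 i.
Proof. by elim: n => [|n IH]. Qed.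

Let G_low n i : G (i + n.+1) i = b n.
Proof. by elim: i => [|i IH]. Qed.

Variable Bb : R.
Hypothesis beB : forall x, Ihalf R x -> be x <= Bb.

Let Bb0 : 0 <= Bb.
Proof.
have I0 : Ihalf R 0 by apply/Ihalf_itv/andP; split; lra.
exact: le_trans (be0 _ I0) (beB _ I0).
Qed.

Let hw_le p : wnorm2 be p <= Bb * pnorm2 p.
Proof.
rewrite /pnorm2 -IZ; last by apply: bm_csq; exact: cbm_ev.
apply: le_I; [exact: bm_hw|by apply: bmM (bm_cst _) _; apply: bm_csq; exact: cbm_ev|].
by move=> x Ix; rewrite ler_wpM2r ?csq_ge0// beB.
Qed.

(** The form is tested at a = 1 and at c with the conjugates of the row as coefficients. The
    functional then equals the sum S, and the Cauchy-Schwarz bound reads S^2 <= al Bb S. *)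
Lemma hankel_row_bound n m : \sum_(i < m) csq (G n i) <= al * Bb.
Proof.
set S := \sum_(i < m) _; have S0 : 0 <= S by apply: sumr_ge0 => i _; exact: csq_ge0.
pose c := \poly_(i < m) (G n i)^~*.
have Lc : HankelL (G n) (1 * c) = S%:C.
  rewrite mul1r (LamE _ _ _ (size_poly _ _)) /S rmorph_sum/=; apply: eq_bigr => i _.
  by rewrite coef_poly ltn_ord mulrC -csqE.
have hc : pnorm2 c = S.
  rewrite (Parseval_wide _ _ (size_poly _ _)); apply: eq_bigr => i _.
  by rewrite coef_poly ltn_ord csq_conj.
have := Hpos_CS _ _ al0 _ 1 c (HG n); rewrite Lc csq_rc.
have -> : pnorm2 (1 : {poly C}) = 1 by rewrite (Parseval_wide 1 1) ?size_poly1// big_ord1 coef1 csq1.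
rewrite mulr1 => h; have h2 := ler_wpM2l al0 (hw_le c); rewrite hc in h2.
have h3 := le_trans h h2.
have [->|S1] := eqVneq S 0; first by rewrite mulr_ge0.
by rewrite -(@ler_pM2r _ S) ?lt_def ?S1//; move: h3; rewrite expr2 mulrA.
Qed.

Let pS k : {poly C} := \poly_(j < k.+1) b j.
Let cS k : {poly C} := \poly_(j < k) d j.
Let Sk k x := ev (pS k) x + (cir x * ev (cS k) x)^~*.
Let E k := pnorm2 (pS k) + pnorm2 (cS k).

Lemma hn_poly n (e : nat -> C) : pnorm2 (\poly_(j < n) e j) = \sum_(j < n) csq (e j).
Proof.
rewrite (Parseval_wide _ _ (size_poly _ _)); apply: eq_bigr => i _.
by rewrite coef_poly ltn_ord.
Qed.

Lemma hn_poly_sub n m (e : nat -> C) : (n <= m)%N ->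
  pnorm2 (\poly_(j < m) e j - \poly_(j < n) e j) = pnorm2 (\poly_(j < m) e j) - pnorm2 (\poly_(j < n) e j).
Proof.
move=> nm; rewrite hn_poly.
rewrite (Parseval_wide (\poly_(j < n) e j) m) ?(leq_trans (size_poly _ _))//.
rewrite (Parseval_wide _ m); last first.
  by apply: (leq_trans (size_polyD _ _)); rewrite size_polyN geq_max size_poly (leq_trans (size_poly _ _)).
rewrite -sumrB; apply: eq_bigr => i _; rewrite coefB !coef_poly ltn_ord.
by case: ifP => _; rewrite ?csq0 ?subr0// !subrr csq0.
Qed.

Let bS k : cbm (Sk k).
Proof.
apply: cbmD; first exact: cbm_ev.
by apply: cbm_conj; apply: cbmM; [exact: cbm_cir|exact: cbm_ev].
Qed.

Let nrm_S k l : (k <= l)%N -> nrm (fun x => Sk l x - Sk k x) ^+ 2 = E l - E k.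
Proof.
move=> kl; rewrite sqr_nrm.
rewrite (eq_I _ (fun x => csq (ev (pS l - pS k) x + (cir x * ev (cS l - cS k) x)^~*))).
  by rewrite trig_orth hn_poly_sub// hn_poly_sub// /E; ring.
move=> x _; congr csq; rewrite /Sk /ev !(hornerD, hornerN) mulrBr conjcB; ring.
Qed.

(** The first 2 k + 1 entries of [G k.+1] are b_k, ..., b_0, gam0_0, ..., gam0_(k-1), which up to
    conjugation are all the coefficients of [Sk k]. *)
Let E_bound k : E k <= al * Bb.
Proof.
apply: le_trans (hankel_row_bound k.+1 (k.+1 + k)).
rewrite big_split_ord /= /E !hn_poly; apply: lerD.
  rewrite (reindex_inj rev_ord_inj) le_eqVlt; apply/orP; left; apply/eqP.
  apply: eq_bigr => i _; congr csq; rewrite /= subSS.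
  by have := G_low (k - i) i; rewrite addnS subnKC// -ltnS ltn_ord.
by apply: ler_sum => i _; rewrite G_high csq_conj.
Qed.

Let E_mono k l : (k <= l)%N -> E k <= E l.
Proof. by move=> kl; rewrite -subr_ge0 -nrm_S// sqr_ge0. Qed.

Let E_cauchy (e : R) : 0 < e -> exists K, forall l, (K <= l)%N -> E l <= E K + e.
Proof.
move=> e0; have cE : cvgn E.
  apply: nondecreasing_is_cvgn => //; exists (al * Bb) => _ [n _ <-]; exact: E_bound.
have /cvgrPdist_lt /(_ _ e0) [K _ hK] := cE; exists K => l Kl.
have h1 := hK K (leqnn K); have h2 : E l <= limn E by apply: nondecreasing_cvgn_le.
by move: h1; rewrite /= ltr_norml; lra.
Qed.

Let Fk n x := n.+1%:R^-1%:C * \sum_(k < n.+1) Sk k x.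

Let bF n : cbm (Fk n).
Proof. by apply: cbmM (cbm_cst _) _; apply: cbm_sum => j; exact: bS. Qed.

Lemma nrm_sum (n : nat) (h : nat -> R -> C) : (forall k, cbm (h k)) ->
  nrm (fun x => \sum_(k < n) h k x) <= \sum_(k < n) nrm (h k).
Proof.
move=> bh; elim: n => [|n IH].
  rewrite big_ord0; apply: nrm_bound => //; last by move=> x _; rewrite big_ord0 cabs0.
  by apply: cbm_sum.
rewrite big_ord_recr /= (eq_nrm _ (fun x => \sum_(k < n) h k x + h n x)); last first.
  by move=> x _; rewrite big_ord_recr.
apply: (le_trans (nrmD _ _ _ _)) => //; first exact: cbm_sum.
by rewrite lerD2r.
Qed.

(** Cesaro means of a Cauchy sequence: the first K terms contribute at most K D/(n+1), and the
    others are within e/2 of [Sk K]. *)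
Let F_near_S (e : R) : 0 < e -> exists K0, forall K, (K0 <= K)%N -> exists N, forall n, (N <= n)%N ->
  nrm (fun x => Fk n x - Sk K x) <= e.
Proof.
move=> e0; have e2 : 0 < e / 2 by rewrite divr_gt0.
have e4 : 0 < (e / 2) ^+ 2 by rewrite exprn_gt0.
have [K0 hK0] := E_cauchy _ e4; exists K0 => K hK.
pose D := al * Bb + 1; have D1 : 1 <= D by rewrite lerDr mulr_ge0.
have tail k : (K <= k)%N -> nrm (fun x => Sk k x - Sk K x) <= e / 2.
  move=> Kk; rewrite -ler_sqr ?nnegrE ?nrm_ge0 ?(ltW e2)// nrm_S//.
  have h1 := hK0 _ (leq_trans hK Kk); have h2 := E_mono _ _ hK; lra.
have head k : (k < K)%N -> nrm (fun x => Sk k x - Sk K x) <= D.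
  move=> kK; rewrite (eq_nrm _ (fun x => - (Sk K x - Sk k x))); last by move=> x _; ring.
  rewrite nrmN -ler_sqr ?nnegrE ?nrm_ge0//; last by apply: le_trans D1.
  rewrite nrm_S 1?ltnW//; apply: (@le_trans _ _ D).
    have := E_bound K; have : 0 <= E k by rewrite addr_ge0 ?I_csq_ge0.
    by rewrite /D; lra.
  by rewrite expr2 ler_peMr// (le_trans _ D1).
pose N := Num.bound (2 * K%:R * D / e); exists N => n Nn.
have n0 : 0 < n.+1%:R :> R by [].
have bD k : cbm (fun x => Sk k x - Sk K x) by exact: cbmB.
rewrite (eq_nrm _ (fun x => (n.+1%:R^-1)%:C * \sum_(k < n.+1) (Sk k x - Sk K x))); last first.
  move=> x _; rewrite /Fk sumrB mulrBr; congr (_ - _).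
  rewrite sumr_const card_ord -(mulr_natl (Sk K x)) mulrA.
  have -> : n.+1%:R = (n.+1%:R)%:C :> C by rewrite rmorph_nat.
  by rewrite -rmorphM/= mulVf ?mul1r// gt_eqF.
rewrite nrmZ; last exact: cbm_sum.
rewrite cabs_rc gtr0_norm ?invr_gt0// mulrC ler_pdivrMr//.
apply: (le_trans (nrm_sum n.+1 (fun k x => Sk k x - Sk K x) bD)).
apply: (@le_trans _ _ (\sum_(k < n.+1) ((if (k < K)%N then D else 0) + e / 2))).
  apply: ler_sum => k _; case: ltnP => kK; last by rewrite add0r tail.
  by apply: (le_trans (head _ kK)); rewrite lerDl ltW.
rewrite big_split /= sumr_const card_ord -[(e / 2) *+ _]mulr_natr.
have h1 : \sum_(k < n.+1) (if (k < K)%N then D else 0) <= K%:R * D.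
  have -> m : \sum_(k < m) (if (k < K)%N then D else 0) = (minn m K)%:R * D.
    elim: m => [|m IH]; first by rewrite big_ord0 min0n mul0r.
    rewrite big_ord_recr /= {}IH; case: ltnP => mK.
      by rewrite (minn_idPl mK) mulrS mulrDl mul1r addrC.
    by rewrite (minn_idPr (leqW mK)) addr0.
  by rewrite ler_wpM2r ?(le_trans _ D1)// ler_nat geq_minr.
have h2 : 2 * K%:R * D / e < n.+1%:R.
  apply: lt_le_trans (archi_boundP _) _; last by rewrite ler_nat (leq_trans Nn).
  by rewrite divr_ge0 ?(ltW e0)// !mulr_ge0// (le_trans _ D1).
move: h2; rewrite ltr_pdivrMr// => h2.
by move: h1 h2; rewrite -!mulrA; lra.
Qed.

Let F_cauchy (e : R) : 0 < e -> exists N, forall n m, (N <= n)%N -> (N <= m)%N ->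
  nrm (fun x => Fk n x - Fk m x) <= e.
Proof.
move=> e0; have e2 : 0 < e / 2 by rewrite divr_gt0.
have [K0 /(_ K0 (leqnn _)) [N hN]] := F_near_S _ e2; exists N => n m Nn Nm.
rewrite (eq_nrm _ (fun x => (Fk n x - Sk K0 x) - (Fk m x - Sk K0 x))); last by move=> x _; ring.
apply: (le_trans (nrmB _ _ (cbmB _ _ (bF n) (bS K0)) (cbmB _ _ (bF m) (bS K0)))).
by rewrite [leRHS]splitr lerD ?hN.
Qed.

Lemma Lam_mul gam n m (a c : nat -> C) :
  HankelL gam (\poly_(k < n) a k * \poly_(l < m) c l) = \sum_(k < n) \sum_(l < m) a k * c l * gam (k + l)%N.
Proof.
have Lsum (J : finType) (F : J -> {poly C}) : HankelL gam (\sum_j F j) = \sum_j HankelL gam (F j).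
  elim/big_rec2: _ => [|j z p _ <-]; last by rewrite LamD.
  by rewrite /HankelL size_poly0 big_ord0.
rewrite !poly_def mulr_suml Lsum; apply: eq_bigr => k _.
rewrite mulr_sumr Lsum; apply: eq_bigr => l _.
rewrite scale_mul LamZ -exprD (LamE _ _ _ (eq_leq (size_polyXn _ _))).
rewrite big_ord_recr /= big1 ?add0r ?coefXn ?eqxx ?mul1r// => i _.
by rewrite coefXn ltn_eqF ?ltn_ord// mul0r.
Qed.

(** The Dirichlet kernel with its coefficients reversed and conjugated. The reversal turns the
    Hankel index k + l into a difference, so that the form becomes the Toeplitz sum of the terms
    [tkl] below. *)
Let Dr x N : {poly C} := \poly_(l < N) cir x ^+ (N.-1 - l).

Let tkl x (k l : nat) : C :=
  (cir x)^~* ^+ k * cir x ^+ l * (if (l < k)%N then gam0 (k - l).-1 else b (l - k)).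

Let Lam_tkl x N : HankelL (G N) (DirichletP x N * Dr x N) = \sum_(k < N) \sum_(l < N) tkl x k l.
Proof.
rewrite Lam_mul; apply: eq_bigr => k _; rewrite (reindex_inj rev_ord_inj); apply: eq_bigr => l _ /=.
have lN := ltn_ord l; have kN := ltn_ord k.
rewrite /tkl; congr (_ * _ * _).
  by congr (_ ^+ _); lia.
case: ltnP => kl.
  have -> : (k + (N - l.+1) = N + (k - l).-1)%N by lia.
  by rewrite G_high.
have -> : (k + (N - l.+1) = N - (l - k).+1)%N by lia.
have := G_low (l - k) (N - (l - k).+1); rewrite subnK//; lia.
Qed.

Let tkl_ge x k l : (k <= l)%N -> tkl x k l = b (l - k) * cir x ^+ (l - k).
Proof.
move=> kl; have e : cir x ^+ l = cir x ^+ k * cir x ^+ (l - k) by rewrite -exprD subnKC.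
by rewrite /tkl ltnNge kl e mulrA (mulrC ((cir x)^~* ^+ k)) cir_conjMX mul1r mulrC.
Qed.

Let tkl_lt x k l : (l < k)%N -> tkl x k l = gam0 (k - l).-1 * ((cir x)^~* ^+ (k - l)).
Proof.
move=> kl; have e : (cir x)^~* ^+ k = (cir x)^~* ^+ l * (cir x)^~* ^+ (k - l).
  by rewrite -exprD subnKC// ltnW.
by rewrite /tkl kl e (mulrAC _ _ (cir x ^+ l)) (mulrC ((cir x)^~* ^+ l)) cir_conjMX mul1r mulrC.
Qed.

Let Sk_tkl x N : Sk N x = \sum_(k < N.+1) tkl x k N + \sum_(l < N) tkl x N l.
Proof.
congr (_ + _).
  rewrite /ev /pS poly_def horner_sum (reindex_inj rev_ord_inj); apply: eq_bigr => k _ /=.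
  rewrite hornerZ hornerXn tkl_ge; last by rewrite -ltnS.
  by rewrite subSS.
rewrite /ev /cS poly_def horner_sum mulr_sumr rmorph_sum (reindex_inj rev_ord_inj).
apply: eq_bigr => l _; have lN := ltn_ord l; rewrite tkl_lt//.
have rl : nat_of_ord (rev_ord l) = (N - l.+1)%N by [].
change ((cir x * (d (rev_ord l) *: 'X^(rev_ord l)).[cir x])^~* = gam0 (N - l).-1 * (cir x)^~* ^+ (N - l)).
rewrite hornerZ hornerXn conjcM (conjcM (d _)) /d conjcK mulrCA; congr (_ * _).
  by congr gam0; rewrite rl; lia.
by rewrite -conjcM -exprS conjcX; congr (_ ^+ _); rewrite rl; lia.
Qed.

(** Passing from N to N + 1 adds the last row and the last column of the Toeplitz square, and this
    border is [Sk N] by [Sk_tkl]. *)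
Let sum_Sk x N : \sum_(k < N) Sk k x = \sum_(k < N) \sum_(l < N) tkl x k l.
Proof.
elim: N => [|N IH]; first by rewrite !big_ord0.
rewrite big_ord_recr /= IH [RHS]big_ord_recr /=.
under [X in _ = X + _]eq_bigr do rewrite big_ord_recr /=.
by rewrite big_split /= Sk_tkl !big_ord_recr /=; ring.
Qed.

(* The Fejer mean is a value of the extended Hankel form on Dirichlet kernels, so
   positivity bounds it pointwise. *)
Let FkE n x : Fk n x = (n.+1%:R^-1)%:C * HankelL (G n.+1) (DirichletP x n.+1 * Dr x n.+1).
Proof. by rewrite Lam_tkl -sum_Sk. Qed.

Let csq_ev_Dr x N t : csq (ev (Dr x N) t) = csq (ev (DirichletP x N) t).
Proof.
case: N => [|N]; first by rewrite /Dr /DirichletP !poly_def !big_ord0.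
rewrite ev_Dp -[RHS]csq_conj.
have -> : ev (Dr x N.+1) t = cir t ^+ N * (\sum_(j < N.+1) cir (t - x) ^+ j)^~*.
  rewrite /ev /Dr poly_def horner_sum rmorph_sum mulr_sumr (reindex_inj rev_ord_inj).
  apply: eq_bigr => j _; have jN := ltn_ord j; rewrite hornerZ hornerXn /=.
  rewrite subSS subKn// cirD cirN exprMn conjcM !conjcX conjcK.
  rewrite mulrA mulrC; congr (_ * _).
  have e : cir t ^+ N = cir t ^+ (N - j) * cir t ^+ j by rewrite -exprD subnK.
  by rewrite e -mulrA cir_conjMX mulr1.
by rewrite csqM csqX csq_cir expr1n mul1r.
Qed.

Let hw_Dr x n : wnorm2 be (Dr x n.+1) = n.+1%:R * FejerMean n.+1 be x.
Proof.
have bk : bm (fun s => be s * FejerK n.+1 (x - s)).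
  by apply: bmM => //; apply: bm_reflect_cts; exact: cts_FK.
rewrite /wnorm2 /FejerMean -IZ//; apply: eq_I => t _; rewrite csq_ev_Dr csq_ev_Dp; ring.
Qed.

Let F_Fejer n x : csq (Fk n x) <= al * FejerMean n.+1 be x.
Proof.
have n0 : 0 < n.+1%:R :> R by [].
rewrite FkE csqM csq_rc; have := Hpos_CS _ _ al0 _ (DirichletP x n.+1) (Dr x n.+1) (HG n.+1).
rewrite hn_Dp hw_Dr => h.
apply: (le_trans (ler_wpM2l (sqr_ge0 _) h)); rewrite le_eqVlt; apply/orP; left; apply/eqP.
by field; rewrite gt_eqF.
Qed.

Let F_bounded n x : Ihalf R x -> cabs (Fk n x) <= Num.sqrt (al * Bb).
Proof.
move=> Ix; rewrite cabs_le ?sqrtr_ge0// sqr_sqrtr ?mulr_ge0//.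
apply: (le_trans (F_Fejer n x)); rewrite ler_wpM2l//.
rewrite -(@ler_pM2l _ n.+1%:R)// -hw_Dr; apply: (le_trans (hw_le _)).
have -> : pnorm2 (Dr x n.+1) = n.+1%:R; last by rewrite mulrC.
by rewrite -(hn_Dp x n.+1); apply: eq_I => t _; rewrite csq_ev_Dr.
Qed.

Let CI_S m k : (m < k)%N -> CI (fun x => Sk k x * cir x ^+ m.+1) = gam0 m.
Proof.
move=> mk; have bX : cbm (fun x : R => cir x ^+ m.+1) by apply: cbmX; exact: cbm_cir.
have bc : cbm (fun x => (cir x * ev (cS k) x)^~*).
  by apply: cbm_conj; apply: cbmM; [exact: cbm_cir|exact: cbm_ev].
rewrite (eq_CI _ (fun x => cir x * ev ('X^m * pS k) x + (ev (cS k) x * (cir x)^~* ^+ m)^~*)); last first.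
  move=> x _; rewrite /Sk /ev hornerM hornerXn mulrDl; congr (_ + _); first by rewrite exprS; ring.
  rewrite exprS !conjcM conjcX conjcK; set w := _^~*.
  transitivity (cir x * w * (((cS k).[cir x])^~* * cir x ^+ m)); first by ring.
  by rewrite cir_conjM mul1r.
rewrite CID; last 2 first.
  by apply: cbmM; [exact: cbm_cir|exact: cbm_ev].
  by apply: cbm_conj; apply: cbmM; [exact: cbm_ev|apply: cbmX; apply: cbm_conj; exact: cbm_cir].
rewrite CI_cir_ev add0r CI_conj; last first.
  by apply: cbmM; [exact: cbm_ev|apply: cbmX; apply: cbm_conj; exact: cbm_cir].
by rewrite CI_ev_conjX coef_poly mk /d conjcK.
Qed.

(** The Fejer means [Fk] are uniformly bounded and Cauchy in norm, so a subsequence converges almost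
    everywhere. Their bound al [FejerMean] be tends to al be at Lebesgue points of be, and the
    coefficients pass to the limit through [Sk]. *)
Lemma Hankel_function : exists f, [/\ cbm f, aeI (fun x => csq (f x) <= al * be x) &
  forall n, CI (fun x => f x * cir x ^+ n.+1) = gam0 n].
Proof.
have [k [f [bf hk hf]]] := Riesz_Fischer Fk _ bF F_bounded F_cauchy.
exists f; split => //.
- apply: aeI_imp (aeI_and _ _ hf (leb_pt_ae _ bbe)) => x Ix [hx lp].
  have h1 : cabs (Fk (k i) x) @[i --> \oo] --> cabs (f x).
    apply/cvgrPdist_le => e e0; have /cvgrPdist_le /(_ _ e0) [N _ hN] := hx.
    exists N => // i Ni; have := hN i Ni; rewrite /= sub0r normrN ger0_norm ?cabs_ge0// => h.
    have a1 := cabs_lerB (Fk (k i) x) (f x); have a2 := cabs_lerB (f x) (Fk (k i) x).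
    rewrite cabs_distC in a2; rewrite ler_norml; move: h a1 a2; lra.
  have h2 : csq (Fk (k i) x) @[i --> \oo] --> csq (f x).
    rewrite -sqr_cabs; under eq_fun do rewrite -sqr_cabs expr2; rewrite expr2; exact: cvgM.
  apply/ler_addgt0Pl => e e0.
  have e2 : 0 < e / 2 by rewrite divr_gt0.
  have e3 : 0 < e / 2 / (al + 1) by rewrite divr_gt0// ltr_wpDl.
  have /cvgrPdist_le /(_ _ e2) [N1 _ hN1] := h2.
  have [N2 hN2] := Fejer_cvg _ _ bbe lp _ e3.
  have := hN1 (maxn N1 N2) (leq_maxl _ _); set i := maxn N1 N2; move=> b1.
  have := hN2 (k i) (leq_trans (leq_maxr _ _) (hk i)) => b2.
  have b3 := F_Fejer (k i) x.
  have b4 : al * FejerMean (k i).+1 be x <= al * be x + e / 2.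
    have b5 : FejerMean (k i).+1 be x <= be x + e / 2 / (al + 1) by move: b2; rewrite ler_norml; lra.
    apply: (le_trans (ler_wpM2l al0 b5)); rewrite mulrDr lerD2l.
    apply: (@le_trans _ _ ((al + 1) * (e / 2 / (al + 1)))).
      by rewrite ler_wpM2r ?(ltW e3)// lerDl.
    by rewrite mulrC divfK// gt_eqF// ltr_wpDl.
  by move: b1; rewrite ler_norml /=; lra.
move=> m; apply/eqP; rewrite -subr_eq0; apply/eqP; apply: (small_eq0 _ 2) => e e0.
have [K0 hK0] := F_near_S _ e0; pose K := maxn K0 m.+1.
have [N hN] := hK0 K (leq_maxl _ _).
have h := nrm_dct (fun i => Fk (k i)) f _ (fun i => bF (k i)) bf (fun i x Ix => F_bounded (k i) x Ix) hf.
have /cvgrPdist_le /(_ _ e0) [N1 _ hN1] := h.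
have := hN1 (maxn N N1) (leq_maxr _ _); set i := maxn N N1.
rewrite /= sub0r normrN ger0_norm ?nrm_ge0// => h1.
have h2 := hN (k i) (leq_trans (leq_maxl _ _) (hk i)).
have bX : cbm (fun x : R => cir x ^+ m.+1) by apply: cbmX; exact: cbm_cir.
have bD : cbm (fun x => f x - Sk K x) by exact: cbmB.
rewrite -(CI_S m K); last exact: leq_maxr.
rewrite -CIB; [|exact: cbmM|exact: cbmM].
rewrite (eq_CI _ (fun x => (f x - Sk K x) * cir x ^+ m.+1)); last by move=> x _; ring.
apply: (le_trans (nrm_CS _ _ bD bX)).
apply: (@le_trans _ _ (nrm (fun x => f x - Sk K x) * 1)).
  rewrite ler_wpM2l ?nrm_ge0//; apply: nrm_bound => // x _.
  by rewrite cabsX cabs_cir expr1n.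
rewrite mulr1 (eq_nrm _ (fun x => (Fk (k i) x - Sk K x) - (Fk (k i) x - f x))); last by move=> x _; ring.
apply: (le_trans (nrmB _ _ (cbmB _ _ (bF _) (bS _)) (cbmB _ _ (bF _) bf))).
by rewrite mulr_natl lerD.
Qed.

End HankelFunction.

Lemma Hankel_extension {R : realType} (g : R -> R[i]) (A : R) :
  cbm g -> A <= 1 -> (forall x, Ihalf R x -> A <= csq (g x)) ->
  (forall p c, A * (pnorm2 p + pnorm2 c) <= I (fun x => csq (syn g p c x))) ->
  exists f, [/\ cbm f, aeI (fun x => csq (f x) <= (1 - A) * (csq (g x) - A)) &
    forall n, CI (fun x => f x * cir x ^+ n.+1) = CI (fun x => (g x)^~* * cir x ^+ n.+1)].
Proof.
move=> bg A1 gA HA; pose be x := csq (g x) - A.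
have al0 : 0 <= 1 - A by rewrite subr_ge0.
have bbe : bm be by apply: bmB (bm_cst _); exact: bm_csq.
have be0 x : Ihalf R x -> 0 <= be x by move=> Ix; rewrite subr_ge0 gA.
(* Choice needs a statement about every sequence, so positivity becomes a premise under the
   quantifier; sequences without it receive 0. *)
have H gam : exists z, HankelPos (1 - A) be gam -> HankelPos (1 - A) be (scons z gam).
  have [P|nP] := pselect (HankelPos (1 - A) be gam); last by exists 0.
  by have [z hz] := Hankel_step _ _ al0 bbe be0 _ P; exists z.
have [step stepP] := choice H; have [Bb hB] := bbe.2.
apply: (Hankel_function g A bg A1 gA HA step stepP Bb) => x Ix.
exact: le_trans (ler_norm _) (hB _ Ix).
Qed.

(** * Bounded boundary functions without negative frequencies *)

Section HardyClass.
Context {R : realType}.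
Notation C := R[i].
Implicit Types (f g h : R -> C) (p c : {poly C}) (w : C).

Definition hardy h := forall n, CI (fun x => h x * cir x ^+ n.+1) = 0.

Lemma hardy_orth h p : cbm h -> hardy h -> CI (fun x => h x * (cir x * ev p x)) = 0.
Proof.
by move=> bh hh; rewrite CI_mul_ev// /HankelL big1// => i _; rewrite hh mulr0.
Qed.

(** On the circle z K = z + w K for the Cauchy kernel K at w. Multiplying by z therefore multiplies
    the transform by w, up to an integral that vanishes for h in the Hardy class. *)
Lemma CT_mul_ev h p w : cbm h -> hardy h -> cabs w < 1 ->
  CauchyT (fun x => h x * ev p x) w = CauchyT h w * p.[w].
Proof.
move=> bh hh w1; have bk := cbm_ck _ w1.
elim/poly_ind: p => [|p a IH].
  rewrite horner0 mulr0 /CauchyT (eq_CI _ (fun=> 0)) ?CI_cst// => t _.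
  by rewrite /ev horner0 mulr0 mul0r.
have bp := cbm_ev p; have bhp : cbm (fun t => h t * ev p t * CauchyK w t).
  by apply: cbmM => //; exact: cbmM.
have bhk : cbm (fun t => h t * CauchyK w t) by exact: cbmM.
have bz : cbm (fun t => h t * (cir t * ev p t)) by apply: cbmM => //; apply: cbmM => //; exact: cbm_cir.
rewrite hornerMXaddC mulrDr mulrA -IH /CauchyT.
rewrite (eq_CI _ (fun t => h t * (cir t * ev p t) + w * (h t * ev p t * CauchyK w t) + a * (h t * CauchyK w t))).
  rewrite CID; [|by apply: cbmD => //; apply: cbmM (cbm_cst _) _|by apply: cbmM (cbm_cst _) _].
  rewrite CID//; last exact: cbmM (cbm_cst _) _.
  by rewrite hardy_orth// !CIZ//; ring.
move=> t _; have e : cir t * CauchyK w t = cir t + w * CauchyK w t.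
  have k0 := ck_neq0 _ t w1; apply: (mulIf k0); rewrite -mulrA /CauchyK mulVf// mulr1 mulrDl -mulrA mulVf//.
  rewrite mulr1 mulrBr mulr1 mulrCA cir_conjM mulr1; ring.
rewrite /ev hornerMXaddC -/(ev p t) mulrDr mulrDl.
have -> : h t * (ev p t * cir t) * CauchyK w t = h t * ev p t * (cir t * CauchyK w t) by ring.
by rewrite e; ring.
Qed.

(** The conjugate kernel is 1 plus a series in positive powers of z, which are annihilated by h. *)
Lemma hardy_conj_ck h w : cbm h -> hardy h -> cabs w < 1 -> CI (fun t => h t * (CauchyK w t)^~*) = CI h.
Proof.
move=> bh hh w1; have bk := cbm_ck _ w1; have [M M0 hM] := cbm_bounded _ bh.
have bhk : cbm (fun t => h t * (CauchyK w t)^~*) by apply: cbmM => //; exact: cbm_conj.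
apply/eqP; rewrite -subr_eq0; apply/eqP; apply: (small_eq0 _ (M / (1 - cabs w))) => e e0.
have [n pnorm2] := small_pow _ _ (cabs_ge0 w) w1 e0.
pose s t := (\sum_(i < n.+1) (w * (cir t)^~*) ^+ i)^~*.
pose q : {poly C} := \poly_(i < n) w^~* ^+ i.+1.
have sE t : s t = 1 + cir t * ev q t.
  rewrite /s big_ord_recl expr0 conjcD; congr (_ + _); first exact: conjc1.
  rewrite /ev /q poly_def horner_sum mulr_sumr rmorph_sum; apply: eq_bigr => i _.
  rewrite hornerZ hornerXn lift0; transitivity (((w * (cir t)^~*) ^+ i.+1)^~*); first by [].
  by rewrite conjcX conjcM conjcK exprMn [cir t ^+ _]exprS; ring.
have bs : cbm s by apply: (eq_cbm (fun t => 1 + cir t * ev q t)) => //; apply: cbmD (cbm_cst _) _; apply: cbmM; [exact: cbm_cir|exact: cbm_ev].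
have -> : CI h = CI (fun t => h t * s t).
  rewrite (eq_CI (fun t => h t * s t) (fun t => h t + h t * (cir t * ev q t))); last by move=> t _; rewrite sE; ring.
  rewrite CID ?hardy_orth ?addr0//; apply: cbmM => //; apply: cbmM; [exact: cbm_cir|exact: cbm_ev].
have b1 : cbm (fun t => h t * s t) by exact: cbmM.
rewrite -CIB//; apply: CI_bound; first exact: cbmB.
move=> t It; rewrite -mulrBr cabsM -mulrA; apply: ler_pM; rewrite ?cabs_ge0 ?hM//.
rewrite /s -conjcB cabs_conj; apply: (le_trans (ck_geom_le _ _ t n.+1 (lexx _) w1)).
rewrite mulrC ler_wpM2l ?invr_ge0 ?subr_ge0 ?(ltW w1)//; apply: le_trans pnorm2.
by rewrite exprS ler_piMl ?exprn_ge0 ?cabs_ge0 ?(ltW w1).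
Qed.

(** The Poisson kernel is K + conj(K) - 1 with K the Cauchy kernel; against h the terms conj(K) and
    1 have the same integral. A positive kernel of mass 1 then gives the maximum principle and
    radial limits. *)
Lemma hardy_Poisson h (r x : R) : cbm h -> hardy h -> 0 <= r -> r < 1 ->
  CauchyT h (r%:C * cir x) = CI (fun t => h t * (PoissonK r (x - t))%:C).
Proof.
move=> bh hh r0 r1; set w := r%:C * cir x.
have w1 : cabs w < 1 by rewrite /w cabs_rcir.
have bk := cbm_ck _ w1; have hc := hardy_conj_ck _ _ bh hh w1.
rewrite (eq_CI (fun t => h t * _) (fun t => h t * CauchyK w t + h t * (CauchyK w t)^~* - h t)).
  rewrite CIB//; last by apply: cbmD; apply: cbmM => //; exact: cbm_conj.
  by rewrite CID ?hc ?addrK//; apply: cbmM => //; exact: cbm_conj.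
move=> t _; have e := ckE r x t r0 r1; rewrite -/w in e.
have -> : (PoissonK r (x - t))%:C = CauchyK w t + (CauchyK w t)^~* - 1; last by ring.
move: e; move: (CauchyK w t) (PoissonK r (x - t)) (conjPoissonK r (x - t)) => z P Q.
have -> : 2 * z - 1 = z + z - 1 by ring.
move=> /(congr1 (@complex.Re R)); rewrite !ReImE /= => e.
by apply: complexP; rewrite !ReImE /= -?e; ring.
Qed.

Lemma hardy_bound h (M r x : R) : cbm h -> hardy h -> 0 <= r -> r < 1 ->
  (forall t, Ihalf R t -> cabs (h t) <= M) -> cabs (CauchyT h (r%:C * cir x)) <= M.
Proof.
move=> bh hh r0 r1 hM; rewrite hardy_Poisson//.
have bP : bm (fun t => PoissonK r (x - t)) by apply: bm_reflect_cts; exact: cts_PK.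
have bhP : cbm (fun t => h t * (PoissonK r (x - t))%:C) by apply: cbmM => //; exact: cbm_rc.
apply: (le_trans (CI_cabs _ bhP)); rewrite -[leRHS]mulr1 -(I_PK_refl r x r0 r1) -IZ//.
apply: le_I; [exact: bm_cabs|exact: bmM (bm_cst _) _|move=> t It].
by rewrite cabsM cabs_rc (ger0_norm (PK_ge0 _ _ r0 r1)) ler_wpM2r ?PK_ge0 ?hM.
Qed.

Lemma hardy_radial h x : cbm h -> hardy h ->
  leb_pt (fun t => complex.Re (h t)) x -> leb_pt (fun t => complex.Im (h t)) x ->
  forall e : R, 0 < e -> exists2 d0 : R, 0 < d0 & forall d : R, 0 < d -> d < d0 -> d <= 2^-1 /\
    cabs (CauchyT h ((1 - d)%:C * cir x) - h x) <= e.
Proof.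
move=> bh hh lr li e e0; have e2 : 0 < e / 2 by rewrite divr_gt0.
have [br bi] := bh.
have [d1 d10 H1] := Poisson_cvg _ _ br lr _ e2; have [d2 d20 H2] := Poisson_cvg _ _ bi li _ e2.
exists (Num.min d1 d2); first by rewrite lt_min d10.
move=> d dp; rewrite lt_min => /andP[dd1 dd2]; have [dh h1] := H1 d dp dd1; have [_ h2] := H2 d dp dd2.
split => //; have r0 : 0 <= 1 - d by lra.
have r1 : 1 - d < 1 by lra.
rewrite hardy_Poisson//; apply: (le_trans (cabs_le_ReIm _)); rewrite [leRHS]splitr; apply: lerD.
  rewrite cReD cReN Re_CI (eq_I _ (fun t => complex.Re (h t) * PoissonK (1 - d) (x - t))); last first.
    by move=> t _; rewrite !ReImE mulr0 subr0.
  by move: h1; rewrite FuE.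
rewrite cImD cImN Im_CI (eq_I _ (fun t => complex.Im (h t) * PoissonK (1 - d) (x - t))); last first.
  by move=> t _; rewrite !ReImE mulr0 add0r.
by move: h2; rewrite FuE.
Qed.

End HardyClass.

(** * An outer function is determined by its modulus up to a unimodular constant *)

Section OuterUniqueness.
Context {R : realType}.
Notation C := R[i].
Implicit Types (p c : {poly C}) (w : C).
Variables (h : R -> C) (m M : R).
Hypotheses (bh : cbm h) (hh : hardy h) (m0 : 0 < m).
Hypotheses (hm : forall x, Ihalf R x -> m <= cabs (h x)) (hM : forall x, Ihalf R x -> cabs (h x) <= M).
(** Beurling's form of being outer: 1 lies in the closure of the polynomial multiples of h. *)
Hypothesis hinv : forall e : R, 0 < e -> exists c, nrm (fun x => h x * ev c x - 1) <= e.

Let U x := ln (cabs (h x)).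

Let U_ge x : Ihalf R x -> ln m <= U x <= ln M.
Proof.
move=> Ix; have a := hm _ Ix; have b := hM _ Ix; have h0 := lt_le_trans m0 a.
by rewrite !ler_ln ?posrE ?a ?b// (lt_le_trans h0 b).
Qed.

Lemma bm_ln_cabs : bm U.
Proof.
split; first by apply: measurableT_comp; [exact: measurable_ln|case: (bm_cabs _ bh)].
by exists (`|ln m| + `|ln M|) => x /U_ge /andP[]; have := ler_norm (ln M); have := ler_norm (- ln m);
  have := normr_ge0 (ln m); have := normr_ge0 (ln M); rewrite normrN ler_norml; lra.
Qed.

Let bU := bm_ln_cabs.

Let bhV : cbm (fun x => (h x)^-1).
Proof.
apply: (cbmV _ (m ^+ 2) bh); first by rewrite exprn_gt0.
by move=> x Ix; rewrite -sqr_cabs ler_sqr ?nnegrE ?cabs_ge0 ?(ltW m0)// hm.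
Qed.

Let h0 x : Ihalf R x -> h x != 0.
Proof. by move=> Ix; rewrite -cabs_gt0 (lt_le_trans m0)// hm. Qed.

Let hinv_V (e : R) : 0 < e -> exists c, nrm (fun x => h x * ev c x - 1) <= e /\
  nrm (fun x => ev c x - (h x)^-1) <= m^-1 * e.
Proof.
move=> e0; have [c hc] := hinv _ e0; exists c; split => //.
have bc := cbm_ev c; have b1 : cbm (fun x => h x * ev c x - 1) by apply: cbmB (cbm_cst _); exact: cbmM.
apply: (@le_trans _ _ (m^-1 * nrm (fun x => h x * ev c x - 1))); last by rewrite ler_wpM2l// invr_ge0 ltW.
apply: nrm_le => //; [by rewrite invr_ge0 ltW|exact: cbmB|move=> x Ix].
rewrite (_ : ev c x - _ = (h x)^-1 * (h x * ev c x - 1)); last by rewrite mulrBr mulKf ?h0// mulr1.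
by rewrite cabsM ler_wpM2r ?cabs_ge0// cabsV lef_pV2 ?posrE ?hm// (lt_le_trans m0)// hm.
Qed.

Let nrm1_le (k : R -> C) (B : R) : cbm k -> (forall x, Ihalf R x -> cabs (k x) <= B) -> 0 <= B ->
  forall f, cbm f -> cabs (CI (fun x => f x * k x)) <= B * nrm f.
Proof.
move=> bk kB B0 f bf; apply: (le_trans (nrm_CS _ _ bf bk)); rewrite mulrC ler_wpM2r ?nrm_ge0//.
exact: nrm_bound.
Qed.

Lemma hardyV : hardy (fun x => (h x)^-1).
Proof.
move=> n; apply: (small_eq0 _ m^-1) => e e0; have [c [_ hc]] := hinv_V _ e0.
have bX : cbm (fun x : R => cir x ^+ n.+1) by apply: cbmX; exact: cbm_cir.
have bc := cbm_ev c; have bd : cbm (fun x => ev c x - (h x)^-1) by exact: cbmB.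
apply: le_trans hc; rewrite -[leRHS]mul1r.
have <- : CI (fun x => - (ev c x - (h x)^-1) * cir x ^+ n.+1) = CI (fun x => (h x)^-1 * cir x ^+ n.+1).
  rewrite (eq_CI _ (fun x => (h x)^-1 * cir x ^+ n.+1 - cir x * ev ('X^n * c) x)); last first.
    by move=> x _; rewrite /ev hornerM hornerXn exprS; ring.
  rewrite CIB; [|exact: cbmM|by apply: cbmM; [exact: cbm_cir|exact: cbm_ev]].
  by rewrite CI_cir_ev subr0.
rewrite -[nrm _]nrmN; apply: nrm1_le => //; last exact: cbmN.
by move=> x _; rewrite cabsX cabs_cir expr1n.
Qed.

(** The polynomials c of [hinv_V] satisfy h c -> 1 and c -> 1/h in norm, and the transform of h c is
    the transform of h times c(w). *)
Lemma CT_inv w : cabs w < 1 -> CauchyT h w * CauchyT (fun x => (h x)^-1) w = 1.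
Proof.
move=> w1; apply/eqP; rewrite -subr_eq0; apply/eqP.
have bk := cbm_ck _ w1; have q0 : 0 < 1 - cabs w by rewrite subr_gt0.
have kB x : Ihalf R x -> cabs (CauchyK w x) <= (1 - cabs w)^-1 by move=> _; exact: cabs_ck.
have B0 : 0 <= (1 - cabs w)^-1 by rewrite invr_ge0 ltW.
apply: (small_eq0 _ ((1 - cabs w)^-1 * (1 + cabs (CauchyT h w) * m^-1))) => e e0.
have [c [hc1 hc2]] := hinv_V _ e0; have bc := cbm_ev c.
have b1 : cbm (fun x => h x * ev c x - 1) by apply: cbmB (cbm_cst _); exact: cbmM.
have b2 : cbm (fun x => ev c x - (h x)^-1) by exact: cbmB.
have bhc : cbm (fun x => h x * ev c x * CauchyK w x) by apply: cbmM => //; exact: cbmM.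
have CT1 : CauchyT (fun=> 1) w = 1.
  rewrite -[RHS](hornerC (1 : C) w) -Cauchy_poly// /CauchyT; apply: eq_CI => t _.
  by rewrite /ev hornerC.
have e1 : CauchyT h w * c.[w] - 1 = CI (fun x => (h x * ev c x - 1) * CauchyK w x).
  rewrite -CT_mul_ev// -[X in _ - X]CT1 /CauchyT -CIB//; last exact: cbmM (cbm_cst _) _.
  by apply: eq_CI => x _; ring.
have e2 : c.[w] - CauchyT (fun x => (h x)^-1) w = CI (fun x => (ev c x - (h x)^-1) * CauchyK w x).
  rewrite -Cauchy_poly// /CauchyT -CIB; [|exact: cbmM|exact: cbmM].
  by apply: eq_CI => x _; ring.
have -> : CauchyT h w * CauchyT (fun x => (h x)^-1) w - 1 =
   (CauchyT h w * c.[w] - 1) - CauchyT h w * (c.[w] - CauchyT (fun x => (h x)^-1) w) by ring.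
apply: (le_trans (cabsB _ _)); rewrite cabsM e1 e2.
have i1 := nrm1_le _ _ bk kB B0 _ b1; have i2 := nrm1_le _ _ bk kB B0 _ b2.
have j1 := le_trans i1 (ler_wpM2l B0 hc1); have j2 := le_trans i2 (ler_wpM2l B0 hc2).
apply: (le_trans (lerD j1 (ler_wpM2l (cabs_ge0 (CauchyT h w)) j2))).
by rewrite le_eqVlt; apply/orP; left; apply/eqP; ring.
Qed.

Let aF := analytic_Fu _ bU.
(** [J] is e^H divided by the extension of h, with H the Herglotz transform of log |h|, and [Io] is
    its inverse: the inner factor of h, bounded and with radial limits of modulus 1. The goal is
    that [J] is constant. *)
Let J w := CauchyT (fun x => (h x)^-1) w * cexp (Herglotz U w).
Let Io w := CauchyT h w * cexp (-1 * Herglotz U w).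

Let aJ : analytic J.
Proof. by apply: analyticM; [exact: analytic_CT|exact: analytic_cexp]. Qed.
Let aI : analytic Io.
Proof.
apply: analyticM; [exact: analytic_CT|apply: analytic_cexp].
by apply: analyticM => //; exact: analytic_cst.
Qed.

Let JI w : cabs w < 1 -> J w * Io w = 1.
Proof.
move=> w1; rewrite /J /Io mulN1r.
transitivity ((CauchyT h w * CauchyT (fun x => (h x)^-1) w) * (cexp (Herglotz U w) * cexp (- Herglotz U w))); first by ring.
by rewrite CT_inv// cexpNM mulr1.
Qed.

Let wk (k : nat) (x : R) : C := (1 - dk k)%:C * cir x.

Let wk1 k x : cabs (wk k x) < 1.
Proof. by rewrite /wk cabs_rcir ?rk_ge0// rk_lt1. Qed.

Let BU := proj1_sig (cid bU.2).
Let BUP x : Ihalf R x -> `|U x| <= BU := proj2_sig (cid bU.2) x.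

Let J_bound k x : cabs (J (wk k x)) <= m^-1 * expR BU.
Proof.
rewrite cabsM cabs_cexp; apply: ler_pM; rewrite ?cabs_ge0 ?expR_ge0//.
  apply: hardy_bound => //; [exact: hardyV|exact: rk_ge0|exact: rk_lt1|move=> t It].
  by rewrite cabsV lef_pV2 ?posrE ?hm// (lt_le_trans m0)// hm.
rewrite ler_expR; apply: le_trans (ler_norm _) _.
by apply: Re_Fu_bound => //; [exact: rk_ge0|exact: rk_lt1].
Qed.

Let Io_bound k x : cabs (Io (wk k x)) <= M * expR BU.
Proof.
rewrite cabsM cabs_cexp; apply: ler_pM; rewrite ?cabs_ge0 ?expR_ge0//.
  by apply: hardy_bound => //; [exact: rk_ge0|exact: rk_lt1].
rewrite ler_expR; apply: le_trans (ler_norm _) _.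
rewrite mulN1r cReN normrN.
by apply: Re_Fu_bound => //; [exact: rk_ge0|exact: rk_lt1].
Qed.

Let expU x : Ihalf R x -> expR (U x) = cabs (h x).
Proof. by move=> Ix; rewrite /U lnK// posrE (lt_le_trans m0)// hm. Qed.

Let I_radial : aeI (fun x => cabs (Io (wk k x)) @[k --> \oo] --> (1 : R)).
Proof.
have [br bi] := bh.
apply: aeI_imp (aeI_and _ _ (Poisson_dk _ bU) (aeI_and _ _ (leb_pt_ae _ br) (leb_pt_ae _ bi))).
move=> x Ix [pU [lr li]].
have c1 : cabs (CauchyT h (wk k x)) @[k --> \oo] --> cabs (h x).
  apply: (dk_cvg (fun d => cabs (CauchyT h ((1 - d)%:C * cir x)))) => e e0.
  have [d0 d00 H] := hardy_radial _ _ bh hh lr li _ e0; exists d0 => // d dp dd.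
  have [_ hd] := H d dp dd; have a1 := cabs_lerB (CauchyT h ((1 - d)%:C * cir x)) (h x).
  have a2 := cabs_lerB (h x) (CauchyT h ((1 - d)%:C * cir x)); rewrite cabs_distC in a2.
  by rewrite ler_norml; move: hd a1 a2; lra.
have c2 : expR (- complex.Re (Herglotz U (wk k x))) @[k --> \oo] --> expR (- U x).
  by apply: continuous_cvg; [exact: continuous_expR|exact: cvgN].
have E : (fun k => cabs (Io (wk k x))) = (fun k => cabs (CauchyT h (wk k x)) * expR (- complex.Re (Herglotz U (wk k x)))).
  by apply/funext => k; rewrite /Io cabsM cabs_cexp mulN1r cReN.
have e1 : cabs (h x) * expR (- U x) = 1 by rewrite expRN expU// divff// gt_eqF// cabs_gt0 h0.
have c3 : cabs (CauchyT h (wk k x)) * expR (- complex.Re (Herglotz U (wk k x))) @[k --> \oo] --> cabs (h x) * expR (- U x).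
  exact: cvgM.
by rewrite e1 -E in c3.
Qed.

(* [J = conj Io + J (1 - |Io|^2)]: the first term has no positive frequencies and the
   second one vanishes at the boundary. *)
Let J_coef n (s : R) : (0 < n)%N -> 0 < s -> s < 1 -> coefc J s n = 0.
Proof.
move=> n0 s0 s1.
pose D k x := J (wk k x) * (1 - csq (Io (wk k x)))%:C.
have bJ k : cbm (fun x => J (wk k x)) by apply: (cbm_analytic _ _ aJ); [exact: rk_ge0|exact: rk_lt1].
have bI k : cbm (fun x => Io (wk k x)) by apply: (cbm_analytic _ _ aI); [exact: rk_ge0|exact: rk_lt1].
have bD k : cbm (D k) by apply: cbmM => //; apply: cbm_rc; apply: bmB (bm_cst _) _; exact: bm_csq.
have DE k x : D k x = J (wk k x) - (Io (wk k x))^~*.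
  have e z : (1 - csq z)%:C = 1 - z * z^~* by rewrite rmorphB/= csqE.
  by rewrite /D e mulrBr mulr1 mulrA JI// mul1r.
pose B := m^-1 * expR BU + M * expR BU.
have D_bound k x : Ihalf R x -> cabs (D k x) <= B.
  by move=> _; rewrite DE; apply: (le_trans (cabsB _ _)); rewrite cabs_conj; apply: lerD.
have Dcvg : nrm (fun x => D k x - 0) @[k --> \oo] --> 0.
  apply: (nrm_dct D (fun=> 0) B bD (cbm_cst 0) D_bound).
  apply: aeI_imp I_radial => x Ix hx.
  have c1 : `|1 - cabs (Io (wk k x)) ^+ 2| @[k --> \oo] --> `|1 - 1 ^+ 2 : R|.
    by apply: cvg_norm; apply: cvgB; [exact: cvg_cst|apply: cvgM].
  rewrite expr1n subrr normr0 in c1.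
  apply: (@squeeze_cvgr _ _ _ _ (fun=> 0) (fun k => m^-1 * expR BU * `|1 - cabs (Io (wk k x)) ^+ 2|)).
  - apply: nearW => k; rewrite cabs_ge0 subr0 /D cabsM cabs_rc sqr_cabs /=.
    by rewrite ler_wpM2r.
  - exact: cvg_cst.
  - by rewrite -[0](mulr0 (m^-1 * expR BU)); apply: cvgM => //; exact: cvg_cst.
have bX : cbm (fun x : R => (cir x)^~* ^+ n) by apply: cbmX; apply: cbm_conj; exact: cbm_cir.
have coefb k : cabs (coefc J (1 - dk k) n) <= nrm (fun x => D k x - 0).
  have -> : coefc J (1 - dk k) n = CI (fun x => D k x * (cir x)^~* ^+ n).
    have bc : cbm (fun x => (Io (wk k x))^~* * (cir x)^~* ^+ n) by apply: cbmM => //; exact: cbm_conj.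
    rewrite (eq_CI (fun x => D k x * _) (fun x => J (wk k x) * (cir x)^~* ^+ n - (Io (wk k x))^~* * (cir x)^~* ^+ n)).
      rewrite CIB//; last exact: cbmM.
      rewrite (eq_CI (fun x => (Io _)^~* * _) (fun x => (Io (wk k x) * (cir x * ev 'X^(n.-1) x))^~*)).
        rewrite CI_conj; last by apply: cbmM => //; apply: cbmM; [exact: cbm_cir|exact: cbm_ev].
        have o : CI (fun x => Io (wk k x) * (cir x * ev 'X^(n.-1) x)) = 0.
          exact: (analytic_orth Io (1 - dk k) 'X^(n.-1) aI (rk_ge0 k) (rk_lt1 k)).
        by rewrite o conjc0 subr0.
      move=> x _; rewrite /ev hornerXn -exprS prednK// conjcM; congr (_ * _); by rewrite conjcX.
    by move=> x _; rewrite DE; ring.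
  rewrite (eq_nrm (fun x => D k x - 0) (D k)); last by move=> x _; rewrite subr0.
  rewrite -[leRHS]mul1r; apply: nrm1_le => //.
  by move=> x _; rewrite cabsX cabs_conj cabs_cir expr1n.
have h2 k : coefc J s n * (1 - dk k)%:C ^+ n = coefc J (1 - dk k) n * s%:C ^+ n.
  by apply: coefc_scale => //; [exact: ltW|exact: rk_ge0|exact: rk_lt1].
(* The estimates concern circles that tend to the unit circle; returning to the fixed radius s costs
   (1 - dk k)^-n, at most 2^n. *)
apply: (eq0_of_cvg_bound _ (fun k => 2 ^+ n * nrm (fun x => D k x - 0))).
  by rewrite -[X in _ --> X](mulr0 (2 ^+ n)); apply: cvgM => //; exact: cvg_cst.
move=> k; have rk : (0 : R) < 1 - dk k by rewrite subr_gt0 dk_lt1.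
move: (h2 k) (coefb k); move: (coefc J s n) (coefc J (1 - dk k) n) => a b.
move=> /(congr1 (@cabs R)); rewrite !cabsM !cabsX !cabs_rc !gtr0_norm// => h3 hb.
rewrite -(@ler_pM2r _ ((1 - dk k) ^+ n)) ?exprn_gt0// h3.
apply: (@le_trans _ _ (nrm (fun x => D k x - 0))).
  by apply: le_trans hb; rewrite ler_piMr ?cabs_ge0// exprn_ile1 ?ltW.
rewrite mulrAC -exprMn ler_peMl ?nrm_ge0// exprn_ege1//.
by have := @dk_le R k; lra.
Qed.

Lemma outer_unique : exists2 j : C, cabs j = 1 & forall w, cabs w < 1 -> cexp (Herglotz U w) = j * CauchyT h w.
Proof.
have Jc w : cabs w < 1 -> J w = J 0.
  move=> w1; have r1 : (1 + cabs w) / 2 < 1 by lra.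
  have r0 : 0 < (1 + cabs w) / 2 by have := cabs_ge0 w; lra.
  apply: (analytic_constant _ _ aJ r0 r1); last by lra.
  by move=> n n0; apply: J_coef.
exists (J 0); last first.
  move=> w w1; rewrite -(Jc w w1) /J.
  transitivity ((CauchyT h w * CauchyT (fun x => (h x)^-1) w) * cexp (Herglotz U w)); last by ring.
  by rewrite CT_inv// mul1r.
(* One point with the radial limit is enough to compute |J 0|; it exists because otherwise 1 = 0
   almost everywhere on an interval of length 1. *)
have [x [_ hx]] : exists x, Ihalf R x /\ cabs (Io (wk k x)) @[k --> \oo] --> (1 : R).
  apply: contrapT => H.
  have : aeI (fun _ : R => False).
    by apply: aeI_imp I_radial => x Ix hx; apply: H; exists x.
  move=> F; have h1 : I (fun=> 1) = I (fun=> 0 : R).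
    by apply: eq_I_ae; [exact: bm_cst|exact: bm_cst|apply: aeI_imp F].
  by move: h1; rewrite !I_cst => /eqP; rewrite oner_eq0.
have jI k : cabs (J 0) * cabs (Io (wk k x)) = 1 by rewrite -cabsM -(Jc _ (wk1 k x)) JI// cabs1.
have h1 : cabs (J 0) * cabs (Io (wk k x)) @[k --> \oo] --> cabs (J 0) * 1.
  by apply: cvgM => //; exact: cvg_cst.
rewrite mulr1 in h1; have h2 : cabs (J 0) * cabs (Io (wk k x)) @[k --> \oo] --> (1 : R).
  by under eq_fun do rewrite jI; exact: cvg_cst.
exact: (cvg_unique _ h1 h2).
Qed.

End OuterUniqueness.

(** * From the Riesz basis to the representation of g/|g| *)

Section Necessity.
Context {R : realType}.
Notation C := R[i].
Implicit Types (p c : {poly C}) (w z : C).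

Lemma cos_atan_gt0 (t : R) : 0 < cos (atan t).
Proof. by apply: cos_gt0_pihalf; rewrite atan_gtNpi2 atan_ltpi2. Qed.

Lemma expi_atan z : 0 < complex.Re z -> z = (cabs z)%:C * expi (atan (complex.Im z / complex.Re z)).
Proof.
move=> z0; set t := _ / _; have c0 := cos_atan_gt0 t.
have st : sin (atan t) = t * cos (atan t).
  by rewrite -{2}[t](@atanK R) /tan divfK// gt_eqF.
have zi : complex.Im z = t * complex.Re z by rewrite /t divfK// gt_eqF.
have e1 : cos (atan t) * cabs z = complex.Re z.
  apply/eqP; rewrite -(@eqrXn2 _ 2)// ?mulr_ge0 ?cabs_ge0 ?(ltW c0) ?(ltW z0)//; apply/eqP.
  rewrite exprMn sqr_cabs /csq zi.
  have := cos2sin2 (atan t); rewrite st => e.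
  transitivity (complex.Re z ^+ 2 * (cos (atan t) ^+ 2 + (t * cos (atan t)) ^+ 2)); first by ring.
  by rewrite e; ring.
rewrite /expi mul_rc st -mulrCA; apply: complexP => /=; first by rewrite mulrC e1.
by rewrite zi -e1; ring.
Qed.

(** The function f of the Hankel extension has the negative frequencies of conj(g), so h = conj(g) -
    f is in the Hardy class, and 1 - h/conj(g) = f/conj(g) is controlled by |f|^2 <= (1 - A)
    |g|^2. *)
Lemma hardy_approximation g (A : R) : cbm g -> 0 < A -> A <= 1 ->
  (forall x, Ihalf R x -> A <= csq (g x)) ->
  (forall p c, A * (pnorm2 p + pnorm2 c) <= I (fun x => csq (syn g p c x))) ->
  exists h : R -> C, [/\ cbm h, hardy h &
    forall x, Ihalf R x -> csq (1 - h x / (g x)^~*) <= 1 - A].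
Proof.
move=> bg A0 A1 gA HA.
have [f [bf fg fe]] := Hankel_extension g A bg A1 gA HA.
have g0 x : Ihalf R x -> 0 < csq (g x) by move=> /gA; exact: lt_le_trans.
pose q x := (1 - A) * csq (g x) - csq (f x).
have bq : bm q by apply: bmB; [apply: bmM (bm_cst _) _|]; exact: bm_csq.
(* Setting f to 0 outside S changes it on a null set only and makes its bound hold at every
   point. *)
pose S : set R := Ihalf R `&` q @^-1` `[0, +oo[%classic.
have mS : measurable S by apply: bq.1 => //; exact: measurable_Ihalf.
have bi : cbm (fun x => (\1_S x)%:C : C) by apply: cbm_rc; exact: bm_indic.
have bg' : cbm (fun x => (g x)^~*) by exact: cbm_conj.
have bfi : cbm (fun x => f x * (\1_S x)%:C) by exact: cbmM.
have fi : aeI (fun x => f x * (\1_S x)%:C = f x).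
  apply: aeI_imp fg => x Ix h; rewrite indicE mem_set ?mulr1//; split => //=.
  rewrite in_itv/= andbT /q subr_ge0; apply: (le_trans h).
  by rewrite ler_wpM2l ?subr_ge0// gerBl ltW.
exists (fun x => (g x)^~* - f x * (\1_S x)%:C); split; first exact: cbmB.
- move=> n; have bX : cbm (fun x : R => cir x ^+ n.+1) by apply: cbmX; exact: cbm_cir.
  rewrite (eq_CI _ (fun x => (g x)^~* * cir x ^+ n.+1 - f x * (\1_S x)%:C * cir x ^+ n.+1)); last first.
    by move=> x _; ring.
  rewrite CIB; [|exact: cbmM|exact: cbmM]; rewrite -fe -CIB; [|exact: cbmM|exact: cbmM].
  rewrite (eq_CI_ae _ (fun=> 0)) ?CI_cst//; [by apply: cbmB; exact: cbmM|exact: cbm_cst|].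
  by apply: aeI_imp fi => x _ ->; rewrite subrr.
move=> x Ix; have gx := g0 x Ix.
have gn : (g x)^~* != 0 by rewrite conjc_eq0 -csq_gt0.
have -> : 1 - ((g x)^~* - f x * (\1_S x)%:C) / (g x)^~* = f x * (\1_S x)%:C / (g x)^~* by field.
rewrite csqM csqV csq_conj ler_pdivrMr// csqM csq_rc indicE.
have [xS|xS] := boolP (x \in S); last by rewrite expr0n mulr0 mulr_ge0 ?subr_ge0// ltW.
rewrite expr1n mulr1; move: xS; rewrite inE => -[_] /=.
by rewrite in_itv/= andbT /q subr_ge0.
Qed.

(* Approximate [(z k)^~*] with [k = g^~* / h] by [syn g p c]. The error is the conjugate of
   [- ev p ^~* - k x] with [x = h z c - z]; pairing it with x kills the first term and
   [Re k >= d > 0] bounds x. *)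
Lemma hardy_inverse g (h : R -> C) (rho m : R) : cbm g -> cbm h -> hardy h ->
  0 < m -> (forall x, Ihalf R x -> m <= csq (g x)) -> 0 <= rho -> rho < 1 ->
  (forall x, Ihalf R x -> cabs (1 - h x / (g x)^~*) <= rho) ->
  (forall f, L2 f -> forall e : R, 0 < e -> exists p c, (L2dist2 f (syn g p c) < e%:E)%E) ->
  forall e : R, 0 < e -> exists c, nrm (fun x => h x * ev c x - 1) <= e.
Proof.
move=> bg bh hh m0 gm rho0 rho1 hr dense e e0.
pose ka x := h x / (g x)^~*.
have gn x : Ihalf R x -> (g x)^~* != 0.
  by move=> Ix; rewrite conjc_eq0 -csq_gt0 (lt_le_trans m0)// gm.
have bgc : cbm (fun x => (g x)^~*) by exact: cbm_conj.
have bgV : cbm (fun x => ((g x)^~*)^-1).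
  by apply: (cbmV _ m bgc m0) => x Ix; rewrite csq_conj gm.
have bka : cbm ka by exact: cbmM.
have kaR x : Ihalf R x -> 1 - rho <= complex.Re (ka x).
  move=> Ix; have := le_trans (Re_le_cabs _) (hr x Ix); rewrite -/(ka x) cReD cReN /=.
  by rewrite ler_norml; lra.
have kaC x : Ihalf R x -> cabs (ka x) <= 2.
  move=> Ix; rewrite (_ : ka x = 1 - (1 - ka x)); last by ring.
  apply: (le_trans (cabsB _ _)); rewrite cabs1; have := hr x Ix; rewrite -/(ka x); lra.
(* With k = [ka x], Re(1/k) = Re k/|k|^2, where Re k >= 1 - rho and |k| <= 2. *)
pose d := (1 - rho) / 4; have d0 : 0 < d by rewrite divr_gt0// subr_gt0.
have kas x : Ihalf R x -> (1 - rho) ^+ 2 <= csq (ka x).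
  move=> Ix; have := kaR x Ix; have r1 : 0 <= 1 - rho by lra.
  move=> hk; apply: (@le_trans _ _ (complex.Re (ka x) ^+ 2)); last by rewrite /csq lerDl sqr_ge0.
  by rewrite ler_sqr ?nnegrE// (le_trans r1).
have bk : cbm (fun x => (ka x)^-1).
  by apply: (cbmV _ ((1 - rho) ^+ 2) bka) => //; rewrite exprn_gt0// subr_gt0.
have kR x : Ihalf R x -> d <= complex.Re (ka x)^-1.
  move=> Ix; have c0 : 0 < csq (ka x) by apply: lt_le_trans (kas x Ix); rewrite exprn_gt0// subr_gt0.
  have -> : complex.Re (ka x)^-1 = complex.Re (ka x) / csq (ka x) by case: (ka x).
  have c4 : csq (ka x) <= 4.
    by have := kaC x Ix; rewrite cabs_le// => h4; apply: (le_trans h4); lra.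
  rewrite ler_pdivlMr//; apply: le_trans (kaR x Ix).
  by rewrite /d mulrAC ler_pdivrMr// ler_wpM2l// subr_ge0 ltW.
have kg x : Ihalf R x -> (ka x)^-1 * h x = (g x)^~*.
  move=> Ix; rewrite /ka invf_div -mulrA mulVf ?mulr1//.
  rewrite -csq_gt0; have := kas x Ix; rewrite /ka csqM => hk.
  have : 0 < csq (h x) * csq ((g x)^~*)^-1 by apply: lt_le_trans hk; rewrite exprn_gt0// subr_gt0.
  by rewrite csqV pmulr_lgt0// invr_gt0 csq_gt0 gn.
have bT : cbm (fun x => ((ka x)^-1 * cir x)^~*).
  by apply: cbm_conj; apply: cbmM => //; exact: cbm_cir.
have ed : 0 < (d * e) ^+ 2 by rewrite exprn_gt0// mulr_gt0.
have [p [c hpc]] := dense _ (L2_cbm _ bT) _ ed.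
have bs := cbm_syn g p c bg.
have bD : cbm (fun x => ((ka x)^-1 * cir x)^~* - syn g p c x) by exact: cbmB.
have hs : nrm (fun x => ((ka x)^-1 * cir x)^~* - syn g p c x) <= d * e.
  have de : 0 <= d * e by rewrite ltW// mulr_gt0.
  rewrite -ler_sqr ?nnegrE ?nrm_ge0// sqr_nrm -lee_fin.
  by rewrite -EFin_I; [exact: ltW|exact: bm_csq].
exists c; have bc := cbm_ev c; have bz := @cbm_cir R.
pose x_ x := h x * (cir x * ev c x) - cir x.
have bx : cbm x_ by apply: cbmB => //; apply: cbmM => //; exact: cbmM.
have -> : nrm (fun x => h x * ev c x - 1) = nrm x_.
  congr Num.sqrt; apply: eq_I => x _.
  by rewrite /x_ -[LHS]mul1r -(csq_cir x) -csqM; congr csq; ring.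
pose s x := (((ka x)^-1 * cir x)^~* - syn g p c x)^~*.
have bs' : cbm s by exact: cbm_conj.
have sE x : Ihalf R x -> s x = - (ev p x)^~* - (ka x)^-1 * x_ x.
  move=> Ix; have cc (a1 a2 a3 a4 : C) : (a1^~* - (a2 + a3 * a4^~*))^~* = a1 - (a2^~* + a3^~* * a4).
    by rewrite conjcB conjcK conjcD conjcM conjcK.
  by rewrite /s /syn cc -kg// /x_; ring.
have bxc : cbm (fun x => (x_ x)^~*) by exact: cbm_conj.
have orth : CI (fun x => (ev p x)^~* * (x_ x)^~*) = 0.
  have bpx : cbm (fun x => ev p x * x_ x) by apply: cbmM => //; exact: cbm_ev.
  rewrite (eq_CI _ (fun x => (ev p x * x_ x)^~*)); last by move=> x _; rewrite conjcM.
  rewrite CI_conj// (eq_CI _ (fun x => h x * (cir x * ev (p * c) x) - cir x * ev p x)); last first.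
    by move=> x _; rewrite /x_ /ev hornerM; ring.
  rewrite CIB; first by rewrite hardy_orth// CI_cir_ev subrr conjc0.
    by apply: cbmM => //; apply: cbmM => //; exact: cbm_ev.
  by apply: cbmM => //; exact: cbm_ev.
have key : d * nrm x_ ^+ 2 <= d * e * nrm x_.
  have bkx : cbm (fun x => (ka x)^-1 * (csq (x_ x))%:C).
    by apply: cbmM => //; apply: cbm_rc; exact: bm_csq.
  have bsx : cbm (fun x => s x * (x_ x)^~*) by exact: cbmM.
  have bpx : cbm (fun x => (ev p x)^~* * (x_ x)^~*).
    by apply: cbmM => //; apply: cbm_conj; exact: cbm_ev.
  have e1 : CI (fun x => (ka x)^-1 * (csq (x_ x))%:C) = - CI (fun x => s x * (x_ x)^~*).
    rewrite (eq_CI _ (fun x => - (ev p x)^~* * (x_ x)^~* - s x * (x_ x)^~*)); last first.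
      by move=> x Ix; rewrite sE// csqE; ring.
    rewrite (eq_CI _ (fun x => - ((ev p x)^~* * (x_ x)^~*) - s x * (x_ x)^~*)); last by move=> x _; ring.
    by rewrite CIB ?CIN ?orth ?oppr0 ?add0r//; exact: cbmN.
  apply: (@le_trans _ _ (complex.Re (CI (fun x => (ka x)^-1 * (csq (x_ x))%:C)))).
    rewrite Re_CI sqr_nrm -IZ; last exact: bm_csq.
    apply: le_I; [by apply: bmM (bm_cst _) _; exact: bm_csq|by case: bkx|move=> x Ix].
    by rewrite cReM Re_rc Im_rc mulr0 subr0 ler_wpM2r ?csq_ge0 ?kR.
  rewrite e1; apply: (le_trans (Re_le _)); rewrite cabsN; apply: (le_trans (nrm_CS _ _ bs' bxc)).
  rewrite (nrm_conj x_); apply: ler_wpM2r; first exact: nrm_ge0.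
  by rewrite /s nrm_conj.
have [x0|x0] : nrm x_ = 0 \/ 0 < nrm x_.
  by have := nrm_ge0 x_; rewrite le_eqVlt => /predU1P[<-|]; [left|right].
- by rewrite x0 ltW.
- by move: key; rewrite expr2 mulrA ler_pM2r// ler_pM2l.
Qed.

Lemma conj_truncN (U : R -> R) x d : bm U -> 0 < d -> -2^-1 < x < 2^-1 ->
  conj_trunc (fun t => - U t) x d = - conj_trunc U x d.
Proof.
move=> bU d0 Ix; rewrite !conj_truncE -IN; last by apply: bmM; [exact: bm_per_refl|exact: bm_cotk].
by apply: eq_I => t _; rewrite /per mulNr.
Qed.

(** Along a radius e^H tends to j h, so Im H tends to an argument L of j h by [arg_lift], and
    [conj_cvg] carries this limit over to the truncated integrals. The minus sign of u anticipates
    that the argument of g is near that of conj(h). *)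
Lemma outer_conjugate (h : R -> C) (j : C) (m M : R) : cbm h -> hardy h -> 0 < m ->
  (forall x, Ihalf R x -> m <= cabs (h x)) -> (forall x, Ihalf R x -> cabs (h x) <= M) ->
  cabs j = 1 -> (forall w, cabs w < 1 -> cexp (Herglotz (fun x => ln (cabs (h x))) w) = j * CauchyT h w) ->
  exists uh : R -> R, harmonic_conjugate (fun x => - ln (cabs (h x))) uh /\
    aeI (fun x => h x * j = (cabs (h x))%:C * expi (- uh x)).
Proof.
move=> bh hh m0 hm hM j1 HJ; set U := fun x => ln (cabs (h x)).
have bU : bm U by exact: (bm_ln_cabs h m M).
have [br bi] := bh.
have ae : aeI (fun x => exists2 L : R, expi L = j * (h x / (cabs (h x))%:C) &
   conj_trunc (fun t => - U t) x d @[d --> 0^'+] --> - L).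
  apply: aeI_imp (aeI_and _ _ (leb_pt_ae _ bU) (aeI_and _ _ (leb_pt_ae _ br) (leb_pt_ae _ bi))).
  move=> x Ix [lU [lr li]].
  have hx0 : 0 < cabs (h x) by rewrite (lt_le_trans m0)// hm.
  have expU : expR (U x) = cabs (h x) by rewrite /U lnK.
  pose th d := complex.Im (Herglotz U ((1 - d)%:C * cir x)).
  have [L hL1 hL2] : exists2 L : R, expi L = j * (h x / (cabs (h x))%:C) &
     forall e : R, 0 < e -> exists2 d1 : R, 0 < d1 & forall d, 0 < d -> d < d1 -> `|th d - L| <= e.
    apply: (arg_lift th 1) => //.
    - rewrite -sqr_cabs !cabsM cabsV cabs_rc ger0_norm ?cabs_ge0// j1 mul1r divff ?expr1n// gt_eqF//.
    - by move=> d d0 d1; exact: cts_Im_Fu.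
    move=> e e0.
    have H0 : forall e : R, 0 < e -> exists2 d1 : R, 0 < d1 & forall d, 0 < d -> d < d1 ->
        cabs (cexp (Herglotz U ((1 - d)%:C * cir x)) - j * h x) <= e.
      move=> e' e'0; have [d1 d10 H1] := hardy_radial _ _ bh hh lr li _ e'0.
      exists d1 => // d d0 dd; have [dh h1] := H1 d d0 dd.
      rewrite HJ; first by rewrite -mulrBr cabsM j1 mul1r.
      by rewrite cabs_rcir; lra.
    have e2 : 0 < e * cabs (h x) / 2 by rewrite divr_gt0// mulr_gt0.
    have [d1 d10 H1] := H0 _ e2; exists d1 => // d d0 dd; have hd := H1 d d0 dd.
    set z := Herglotz U _ in hd *; rewrite -/z in hd.
    have a1 : `|expR (complex.Re z) - cabs (h x)| <= e * cabs (h x) / 2.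
      have b1 := cabs_lerB (cexp z) (j * h x); have b2 := cabs_lerB (j * h x) (cexp z).
      rewrite cabs_distC in b2; rewrite !cabs_cexp !cabsM !j1 !mul1r in b1 b2.
      by rewrite ler_norml; move: hd b1 b2; lra.
    have hC : (cabs (h x))%:C != 0 :> C by rewrite -cabs_gt0 cabs_rc ger0_norm ?cabs_ge0.
    have -> : expi (th d) - j * (h x / (cabs (h x))%:C) =
        (((cabs (h x))%:C - (expR (complex.Re z))%:C) * expi (th d) + (cexp z - j * h x)) / (cabs (h x))%:C.
      by rewrite /cexp -/(th d) -/z; field.
    rewrite cabsM cabsV [cabs (cabs (h x))%:C]cabs_rc ger0_norm ?cabs_ge0// ler_pdivrMr//.
    apply: (le_trans (cabsD _ _)); rewrite cabsM cabs_expi mulr1 -rmorphB/= cabs_rc distrC.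
    by move: a1 hd; lra.
  exists L => //; apply/cvgrPdist_le => e e0; have e2 : 0 < e / 2 by rewrite divr_gt0.
  have [d1 d10 H1] := hL2 _ e2; have [d2 d20 H2] := conj_cvg _ _ bU lU _ e2.
  exists (Num.min d1 d2); first by rewrite /= lt_min d10.
  move=> d /=; rewrite sub0r normrN => dd d0; move: dd; rewrite gtr0_norm// lt_min => /andP[dd1 dd2].
  rewrite conj_truncN//; last exact: lU.1.
  have h1 := H1 d d0 dd1; have [_ h2] := H2 d d0 dd2.
  have -> : - L - - conj_trunc U x d = (conj_trunc U x d - th d) + (th d - L) by ring.
  by apply: (le_trans (ler_normD _ _)); rewrite [e]splitr lerD.
exists (fun x => lim (conj_trunc (fun t => - U t) x d @[d --> 0^'+])); split.
  apply: aeI_imp ae => x Ix [L _ hL]; 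
  by have -> : lim (conj_trunc (fun t => - U t) x d @[d --> 0^'+]) = - L by exact: cvg_lim.
apply: aeI_imp ae => x Ix [L hL1 hL2].
have -> : lim (conj_trunc (fun t => - U t) x d @[d --> 0^'+]) = - L by exact: cvg_lim.
rewrite opprK hL1; have hx0 : 0 < cabs (h x) by rewrite (lt_le_trans m0)// hm.
have hC : (cabs (h x))%:C != 0 :> C by rewrite -cabs_gt0 cabs_rc ger0_norm ?cabs_ge0.
by field.
Qed.

Lemma riesz_Helson_Szego g : cbm g -> riesz_poly g ->
  exists2 m : R, 0 < m & aeI (fun x => m <= cabs (g x)) /\
  exists (c : R) (u v uh : R -> R), [/\ bm u, bm v,
    exists2 d : R, d < pi / 2 & forall x, Ihalf R x -> `|v x| <= d,
    harmonic_conjugate u uh &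
    aeI (fun x => g x / (cabs (g x))%:C = expi (uh x + v x + c))].
Proof.
move=> bg0 rp0; have [_ [A [B [A0 B0 HA0]]]] := rp0.
have hn0 : pnorm2 (0 : {poly C}) = 0 by rewrite (Parseval_wide 0 0) ?size_poly0// big_ord0.
have hn1 : pnorm2 (1 : {poly C}) = 1 by rewrite (Parseval_wide 1 1) ?size_poly1// big_ord1 coef1 csq1.
(* The pair p = 1, c = 0 has norm 1 and gives the constant function 1. *)
have A1 : A <= 1.
  have [+ _] := HA0 1 0; rewrite hn0 hn1 addr0 mulr1 => h; apply: (le_trans h).
  rewrite (eq_I _ (fun=> 1)) ?I_cst// => x _.
  by rewrite /syn /ev hornerC horner0 mulr0 conjc0 mulr0 addr0 csq1.
pose m := Num.sqrt A; have m0 : 0 < m by rewrite sqrtr_gt0.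
have mA : m ^+ 2 = A by rewrite sqr_sqrtr// ltW.
have m1 : m <= 1 by rewrite -sqrtr1 ler_sqrt.
have mg : aeI (fun x => m <= cabs (g x)).
  apply: aeI_imp (riesz_lower_modulus _ _ bg0 (fun p c => (HA0 p c).1)) => x _ h.
  by rewrite -ler_sqr ?nnegrE ?cabs_ge0 ?(ltW m0)// mA sqr_cabs.
exists m => //; split => //.
have [g1 [bg gg1 gm]] := cbm_bounded_below _ _ bg0 m0 m1 mg.
have mg0 := cbm_cmeasurable _ bg0.
have rp : riesz_poly g1.
  apply/(riesz_polyP g g1 mg0 bg gg1)/(riesz_polyP g g mg0 bg0) => //; exact: aeI_T.
have gA x : Ihalf R x -> A <= csq (g1 x).
  by move=> Ix; rewrite -mA -sqr_cabs ler_sqr ?nnegrE ?cabs_ge0 ?(ltW m0)// gm.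
have [dense _] := rp.
have HA p c : A * (pnorm2 p + pnorm2 c) <= I (fun x => csq (syn g1 p c x)).
  have [h _] := HA0 p c; apply: (le_trans h); rewrite le_eqVlt; apply/orP; left; apply/eqP.
  apply: eq_I_ae; [by apply: bm_csq; exact: cbm_syn|by apply: bm_csq; exact: cbm_syn|].
  by apply: aeI_imp (aeI_syn _ _ p c gg1) => x _ ->.
have [h [bh hh hg]] := hardy_approximation _ _ bg A0 A1 gA HA.
have [rho [rho0 rho1 rhoE]] : exists rho : R, [/\ 0 <= rho, rho < 1 & rho ^+ 2 = 1 - A].
  exists (Num.sqrt (1 - A)); rewrite sqrtr_ge0 sqr_sqrtr ?subr_ge0//; split => //.
  by rewrite -[ltRHS]sqrtr1 ltr_sqrt// gtrBl.
have hr x : Ihalf R x -> cabs (1 - h x / (g1 x)^~*) <= rho.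
  by move=> Ix; rewrite cabs_le// rhoE hg.
have hinv := hardy_inverse _ _ _ _ bg bh hh A0 gA rho0 rho1 hr dense.
pose ka x := h x / (g1 x)^~*.
have gn x : Ihalf R x -> (g1 x)^~* != 0.
  by move=> Ix; rewrite conjc_eq0 -csq_gt0 (lt_le_trans A0)// gA.
have kg x : Ihalf R x -> ka x * (g1 x)^~* = h x by move=> Ix; rewrite /ka divfK// gn.
have kaR x : Ihalf R x -> 1 - rho <= complex.Re (ka x).
  move=> Ix; have := le_trans (Re_le_cabs _) (hr x Ix); rewrite -/(ka x) cReD cReN /=.
  by rewrite ler_norml => /andP[_]; rewrite !lerBlDr addrC.
have kaI x : Ihalf R x -> `|complex.Im (ka x)| <= rho.
  move=> Ix; have := le_trans (Im_le_cabs _) (hr x Ix); rewrite -/(ka x) cImD cImN /= add0r.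
  by rewrite normrN.
have q0 : 0 < 1 - rho by rewrite subr_gt0.
have ka0 x : Ihalf R x -> 0 < complex.Re (ka x) by move=> /kaR; exact: lt_le_trans.
have hm x : Ihalf R x -> (1 - rho) * m <= cabs (h x).
  move=> Ix; rewrite -kg// cabsM cabs_conj; apply: ler_pM; rewrite ?gm ?(ltW q0) ?(ltW m0)//.
  by apply: le_trans (Re_le _); exact: kaR.
have hm0 : 0 < (1 - rho) * m by rewrite mulr_gt0.
have [M M0 hM] := cbm_bounded _ bh.
have [j j1 HJ] := outer_unique _ _ _ bh hh hm0 hm hM hinv.
have [uh [huh hj]] := outer_conjugate _ _ _ _ bh hh hm0 hm hM j1 HJ.
(* The constant c of the representation is an argument of the unimodular constant j. *)
have [c hc] := expi_surj j (etrans (esym (sqr_cabs j)) (etrans (congr1 (fun t => t ^+ 2) j1) (expr1n _ 2))).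
have bka : cbm ka.
  apply: cbmM => //; apply: (cbmV _ A (cbm_conj _ bg) A0) => x Ix; rewrite csq_conj gA//.
have [bkr bki] := bka.
pose v x := atan (complex.Im (ka x) * (complex.Re (ka x))^-1).
have bv : bm v.
  apply: (bm_comp (fun x => complex.Im (ka x) * (complex.Re (ka x))^-1) atan).
    exact: continuous_atan.
  by apply: bmM => //; exact: (bmV _ (1 - rho)).
exists c, (fun x => - ln (cabs (h x))), v, uh; split => //.
- by apply: bmN; exact: (bm_ln_cabs h _ M bh hm0 hm hM).
(* The disc |1 - k| <= rho gives |Im k| <= rho and Re k >= 1 - rho. *)
- exists (atan (rho / (1 - rho))); first exact: atan_ltpi2.
  move=> x Ix; rewrite ler_norml.
  have hb : `|complex.Im (ka x) * (complex.Re (ka x))^-1| <= rho / (1 - rho).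
    rewrite normrM normfV (gtr0_norm (ka0 x Ix)); apply: ler_pM => //.
      by rewrite invr_ge0 ltW// ka0.
    exact: kaI.
    by rewrite lef_pV2 ?posrE ?ka0// kaR.
  move: hb; rewrite ler_norml -atanN => /andP[b1 b2].
  by rewrite /v !le_atan.
apply: aeI_imp (aeI_and _ _ gg1 hj) => x Ix [-> hjx].
have kE := expi_atan _ (ka0 x Ix).
have kC : (cabs (ka x))%:C != 0 :> C.
  by rewrite -cabs_gt0 cabs_rc ger0_norm ?cabs_ge0// (lt_le_trans (ka0 x Ix))// Re_le.
have gC : (cabs (g1 x))%:C != 0 :> C.
  by rewrite -cabs_gt0 cabs_rc ger0_norm ?cabs_ge0// (lt_le_trans m0)// gm.
have jj : j * j^~* = 1 by rewrite -csqE -sqr_cabs j1 expr1n.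
have hE : (h x)^~* = (cabs (ka x))%:C * (cabs (g1 x))%:C * expi (uh x) * j.
  have := congr1 (fun z => z^~* * j) hjx; rewrite !conjcM conjc_real -expiN opprK.
  rewrite -mulrA (mulrC _ j) jj mulr1 => ->.
  by rewrite -(rmorphM _ (cabs _) (cabs _)) /= -(cabs_conj (g1 x)) -cabsM kg.
(* Comparing phases: k contributes e^(-i v) on the left, and conj(h) = |h| e^(i uh) j on the right,
   so g/|g| = e^(i (uh + v)) j. *)
have gk : g1 x * (ka x)^~* = (h x)^~* by rewrite -(kg x Ix) (conjcM (ka x)) conjcK mulrC.
apply: (mulIf gC); rewrite divfK//; apply: (mulIf kC).
rewrite kE conjcM conjc_real -expiN -/(v x) hE in gk.
have -> : g1 x * (cabs (ka x))%:C = g1 x * ((cabs (ka x))%:C * expi (- v x)) * expi (v x).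
  by rewrite -!mulrA -expiD addNr expi0 mulr1.
by rewrite gk !expiD hc; ring.
Qed.

End Necessity.

Theorem mainTheorem6 (R : realType) (g : R -> R[i]) (hg : Linf g) :
  riesz_basis (Fsys g) <->
  (Linf_inv g /\
   exists (c : R) (u v uh : R -> R),
     measurable_fun (Ihalf R) u /\
     (exists M : R, forall x, Ihalf R x -> `|u x| <= M) /\
     measurable_fun (Ihalf R) v /\
     (exists d : R, d < pi / 2 /\ forall x, Ihalf R x -> `|v x| <= d) /\
     harmonic_conjugate u uh /\
     {ae Leb R, forall x, Ihalf R x ->
        g x / (cabs (g x))%:C = expi (uh x + v x + c)}).
Proof.
have mg := cmeasurable_Linf _ hg; have [g1 bg1 gg1] := Linf_cbm _ hg.
split.
  move=> /(riesz_polyP _ _ mg bg1 gg1) rp.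
  have [m m0 [mg1 [c [u [v [uh [bu bv [d dp vd] hu gE]]]]]]] := riesz_Helson_Szego _ bg1 rp.
  split.
    exists m^-1; apply: aeI_imp (aeI_and _ _ gg1 mg1) => x _ [-> hm].
    have g0 : 0 < cabs (g1 x) by exact: lt_le_trans hm.
    by rewrite -cabs_gt0 g0 cabsV lef_pV2.
  exists c, u, v, uh; split; [exact: bu.1|split; [exact: bu.2|split; [exact: bv.1|]]].
  split; first by exists d.
  split => //; apply: aeI_imp (aeI_and _ _ gg1 gE) => x _ [-> ->].
  by [].
move=> [[M hM] [c [u [v [uh [mu [uB [mv [[d [dp vd]] [hu gE]]]]]]]]]].
(* The added 1 makes m well defined and at most 1, as [cbm_bounded_below] requires. *)
pose m : R := (`|M| + 1)^-1.
have M1 : 1 <= `|M| + 1 by rewrite lerDr.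
have m0 : 0 < m by rewrite invr_gt0; exact: lt_le_trans M1.
have m1 : m <= 1 by rewrite invf_le1//; exact: lt_le_trans M1.
have mg1 : aeI (fun x => m <= cabs (g1 x)).
  apply: aeI_imp (aeI_and _ _ gg1 hM) => x _ [-> [g0 h]].
  have c0 : 0 < cabs (g1 x) by rewrite cabs_gt0.
  rewrite -[cabs _]invrK lef_pV2 ?posrE ?invr_gt0// ?(lt_le_trans ltr01 M1)//.
  by rewrite -cabsV; apply: (le_trans h); apply: (le_trans (ler_norm _)); rewrite lerDl.
have [g2 [bg2 g12 gm]] := cbm_bounded_below _ _ bg1 m0 m1 mg1.
have gg2 : aeI (fun x => g x = g2 x).
  by apply: aeI_imp (aeI_and _ _ gg1 g12) => x _ [-> ->].
apply/(riesz_polyP _ _ mg bg2 gg2).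
apply: (Helson_Szego_riesz _ m c d u v uh) => //.
  by split => //; exists d.
by apply: aeI_imp (aeI_and _ _ gg2 gE) => x _ [<- ->].
Qed.
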